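(* Let $\{\nu_n\}_{n=1}^\infty$ be an increasing sequence of positive integers and let $\{a_n\}_{n=1}^\infty\in\ell^2(\mathbb{Z}^+)$ with $a_n>0$ for all $n$. With $S_N$ and $T_N$ as defined in the context, suppose that the sequences $\{S_NT_N\}_{N\ge1}$ and $\{S_{N+1}/S_N\}_{N\ge1}$ are bounded. Then $$\sum_{n=1}^\infty b_n e(\nu_n x)\in\mathrm{BMO}\qquad\text{for any complex sequence } \{b_n\} \text{ with } |b_n|\le a_n \text{ for all } n,$$ and there is a constant $C$ such that the Hardy type inequality $$\sum_{n=1}^\infty a_n\big|\widehat f(\nu_n)\big|\le C\,\|f\|_{H^1}$$ holds for every $f\in H^1$.
   Context: Notation: $\mathbb{Z}^+$ is the set of positive integers and $e(x):=e^{2\pi i x}$. For each $N\in\mathbb{Z}^+$ put $$S_N=\sum_{n=1}^N a_n\nu_n,\qquad T_N=\sum_{n=N+1}^\infty\frac{a_n^2}{M(n)},$$ where, in the definition of $T_N$, $M(n)=\min(\nu_n-\nu_{n-1},\ \nu_{n+1}-\nu_n)$ for $n>N+1$, with the special definition $M(N+1)=\nu_{N+2}-\nu_{N+1}$ for the first term. $\mathrm{BMO}=\mathrm{BMO}(\mathbb{T})$ is the space of $1$-periodic integrable functions $f$ such that $\|f\|_*:=\sup_{I\subset\mathbb{T}}\|f\|_I<\infty$, where $I$ ranges over intervals of $\mathbb{T}=\mathbb{R}/\mathbb{Z}$, $\|f\|_I=|I|^{-1}\int_I|f-f_I|$, and $f_I=|I|^{-1}\int_I f$ is the average of $f$ on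 $I$. The series $\sum b_n e(\nu_n x)$ is understood as the $L^2(\mathbb{T})$ function with these Fourier coefficients. $H^1$ is the space of analytic functions $f$ in the unit disc with $\|f\|_{H^1}:=\sup_{r<1}\int_0^{2\pi}|f(re^{i\theta})|\,d\theta<\infty$, and $\widehat f(k)=\int_0^1 e^{-2\pi i kx}f(e^{2\pi i x})\,dx$ (using boundary values of $f$). *)

(* Defs.v *)
From HB Require Import structures.
From mathcomp Require Export all_boot all_order all_algebra.
From mathcomp Require Export all_classical all_reals all_analysis.
From mathcomp Require Export complex.
Export numFieldNormedType.Exports.
Export Order.TTheory GRing.Theory Num.Theory.

Set Implicit Arguments.
Unset Strict Implicit.
Unset Printing Implicit Defensive.

Local Open Scope classical_set_scope.
Local Open Scope ring_scope.

(* Sequences indexed by the positive integers are functions on nat whose value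
   at 0 is never used. *)

Section Sequences.
Context {R : realType}.
Implicit Types (nu : nat -> nat) (a : nat -> R).

Definition Ssum nu a (N : nat) : R := \sum_(1 <= n < N.+1) a n * (nu n)%:R.

Definition gap nu (n : nat) : R := (nu n)%:R - (nu n.-1)%:R.

(* The special convention for the first term n = N + 1 of the tail makes M
   depend on N. *)
Definition Mgap nu (N n : nat) : R :=
  if n == N.+1 then gap nu n.+1 else Num.min (gap nu n) (gap nu n.+1).

Definition Ttail nu a (N : nat) : \bar R :=
  (\sum_(N.+1 <= n <oo) (a n ^+ 2 / Mgap nu N n)%:E)%E.

End Sequences.

Section ComplexFunctions.
Context {R : realType}.
Local Notation mu := (@lebesgue_measure R).
Implicit Types (f g : R -> R[i]) (D : set R).

Definition cmod (z : R[i]) : R := ComplexField.Normc.normc z.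

Definition cexp (t : R) : R[i] := (cos t +i* sin t)%C.

Definition e1 (x : R) : R[i] := cexp (2 * pi * x).

Definition cmeasurable g : Prop :=
  measurable_fun setT (fun x => complex.Re (g x)) /\
  measurable_fun setT (fun x => complex.Im (g x)).

Definition cintegrable D g : Prop :=
  mu.-integrable D (fun x => (complex.Re (g x))%:E) /\
  mu.-integrable D (fun x => (complex.Im (g x))%:E).

Definition cintegral D g : R[i] :=
  ((\int[mu]_(x in D) complex.Re (g x))%R
     +i* (\int[mu]_(x in D) complex.Im (g x))%R)%C.

(* Functions on R/Z are 1-periodic functions on R. *)
Definition periodic1 g : Prop := forall x, g (x + 1) = g x.

Definition fourier_coef g (k : int) : R[i] :=
  cintegral `[0, 1] (fun x => e1 (- k%:~R * x) * g x).

Definition is_L2 g : Prop :=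
  [/\ periodic1 g, cmeasurable g &
      (\int[mu]_(x in `[0%R, 1%R]) (cmod (g x) ^+ 2)%:E < +oo)%E].

(* g represents the L2 class of the series sum_(n >= 1) b_n e(nu_n x). *)
Definition is_lacunary_sum (nu : nat -> nat) (b : nat -> R[i]) g : Prop :=
  [/\ is_L2 g,
      forall n, (1 <= n)%N -> fourier_coef g (nu n)%:Z = b n &
      forall k : int, (forall n, (1 <= n)%N -> k != (nu n)%:Z) ->
        fourier_coef g k = 0].

Definition caverage (s t : R) g : R[i] :=
  ((t - s)^-1)%:C%C * cintegral `[s, t] g.

Definition oscillation (s t : R) g : \bar R :=
  (((t - s)^-1)%R%:E *
    \int[mu]_(x in `[s, t]) (cmod (g x - caverage s t g))%:E)%E.

(* The intervals of R/Z are the images of the [s, t] with s < t <= s + 1. *)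
Definition bmo_norm g : \bar R :=
  ereal_sup [set oscillation I.1 I.2 g | I in [set I : R * R | I.1 < I.2 <= I.1 + 1]].

Definition BMO g : Prop :=
  [/\ periodic1 g, cintegrable `[0, 1] g & (bmo_norm g < +oo)%E].

End ComplexFunctions.

Section Hardy.
Context {R : realType}.
Local Notation mu := (@lebesgue_measure R).
Implicit Types f : R[i] -> R[i].

(* R[i]^o carries the topology of the modulus. *)
Definition analytic_at f (z0 : R[i]) : Prop :=
  exists (c : nat -> R[i]) (r : R), 0 < r /\
    forall z, cmod (z - z0) < r ->
      series (fun k => c k * (z - z0) ^+ k : R[i]^o) @ \oo --> (f z : R[i]^o).

Definition analytic_in_disc f : Prop :=
  forall z, cmod z < 1 -> analytic_at f z.

Definition H1_norm f : \bar R :=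
  ereal_sup [set (\int[mu]_(t in `[0%R, (2 * pi)%R]) (cmod (f (r%:C%C * cexp t)))%:E)%E
            | r in [set r : R | 0 <= r < 1]].

Definition H1 f : Prop := analytic_in_disc f /\ (H1_norm f < +oo)%E.

(* Radial boundary values x |-> f(e(x)); lim is total, hence this is
   meaningful only where the radial limit exists. *)
Definition boundary f (x : R) : R[i] :=
  lim ((fun r : R => f (r%:C%C * e1 x) : R[i]^o) @ 1^'-).

Definition H1_coef f (k : int) : R[i] := fourier_coef (boundary f) k.

End Hardy.

(* Main.v *)
(* BMO: on an interval of length delta split the series at the N with S_N ~ 1 / delta.
   The low frequencies form a Lipschitz function with constant of order S_N, and by
   Gallagher's large sieve inequality the mean square of the high frequencies is at most
   of order T_N / delta + sum a_n^2.

   Hardy: every f in H^1 is a product of two H^2 functions, so the coefficient of f at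
   nu_n is bounded by a Cauchy product of two l^2 sequences A, B, and the inequality
   reduces to the boundedness of the Hankel form
   sum_n a_n sum_(j + k = nu_n) A_j B_k, which follows from a weighted Schur test.
   The factorization is obtained without inner and outer functions: dilations of f are
   uniform limits of polynomials (harmonic functions with continuous boundary values, and
   the maximum principle), each linear factor of a polynomial is approximately a product
   F G with |F|^2 and |G|^2 close to its modulus on the circle, and the
   coefficients of the approximate factors converge along an ultrafilter.  The boundary
   values of f are then the products of those of the factors, by Fatou's theorem for
   Poisson integrals at Lebesgue points. *)

(* The hypothesis on [S_N T_N] enters in two one-sided forms. BMO needs the tail over the gaps above
   [nu n], because the blocks in the large sieve extend upwards from [nu n]; the Hankel form needs
   the tail over the gaps below [nu n], because [nu n - k] is located among the smaller frequencies.
   The bounded ratios [S_(N+1) / S_N] pay for the index shifts between these forms and [T_N]. By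
   symmetry the Schur test concerns [k <= nu n / 2]. If [nu n - k] lies in the last gap, square
   summability is enough. Otherwise [k * nu n] is compared with [S_n ^ 2]: when [S_n] is large the
   tail bound is strong, when it is small the increments [a_n nu_n] of [S_n] control the entries.
   Analyticity is used only through continuity and moments over small circles. These properties
   persist under multiplication by [z], which removes the antianalytic part of the approximating
   harmonic polynomials. The boundary function is a pointwise [lim], so its integrals are computed
   through almost everywhere equality with a product of two L2 functions. *)
Require Import Defs.
From mathcomp Require Import measurable_realfun ring lra zify.

Set Implicit Arguments.
Unset Strict Implicit.
Unset Printing Implicit Defensive.

Local Open Scope ring_scope.

(** * Weighted Schur test for Hankel forms with nonnegative entries *)

Section PositiveHankelForms.
Context {R : realType}.
Implicit Types (A B phi : nat -> R).

(** Every Schur condition below is checked with a bounded nondecreasing potential [phi]: inside the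
    region its increments dominate the terms, outside they only add nonnegative amounts, so the
    total is at most the range of [phi]. *)
Lemma ler_sum_telescope (P : pred nat) (u phi : nat -> R) (c M : R) (X : nat) :
  0 <= c -> (forall n, 0 <= phi n <= M) -> (forall n, phi n <= phi n.+1) ->
  (forall n, (n.+1 < X)%N -> P n.+1 -> u n.+1 <= c * (phi n.+1 - phi n)) ->
  \sum_(1 <= n < X | P n) u n <= c * M.
Proof.
move=> c0 phi_M phi_mono u_phi.
apply: (@le_trans _ _ (\sum_(1 <= n < X) c * (phi n - phi n.-1))).
  rewrite big_mkcond /= big_nat_cond [leRHS]big_nat_cond.
  apply: ler_sum => -[|n]; rewrite ?andbT //= => nX.
  case: ifP => Pn; first exact: u_phi.
  by rewrite mulr_ge0 ?subr_ge0.
rewrite -mulr_sumr ler_wpM2l //.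
case: X {u_phi} => [|X]; first by rewrite big_geq //; have /andP[] := phi_M 0%N; exact: le_trans.
rewrite big_add1 /= (@telescope_sumr _ 0 X) //.
have /andP[? _] := phi_M 0%N; have /andP[_ ?] := phi_M X; lra.
Qed.

(** As [a n <= sqrt (U n k) * sqrt (V n k)], the arithmetic-geometric mean inequality splits each
    entry into half a weighted square of [B k] and half a weighted square of [A (nu n - k)]. Summing
    over [n] first, at fixed [k] and at fixed [j = nu n - k], leaves the two weight sums. *)
Lemma schur_test_form (nu : nat -> nat) (a : nat -> R) (reg : nat -> nat -> bool)
    (U V : nat -> nat -> R) (K1 K2 L : R) (X : nat) A B :
  (forall n, (nu n <= nu n.+1)%N) ->
  (forall n k, 0 <= U n k) -> (forall n k, 0 <= V n k) ->
  (forall k, 0 <= A k) -> (forall k, 0 <= B k) ->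
  (forall K, \sum_(0 <= k < K) A k ^+ 2 <= L) ->
  (forall K, \sum_(0 <= k < K) B k ^+ 2 <= L) ->
  (forall n k, (0 < n)%N -> reg n k -> a n ^+ 2 <= U n k * V n k) ->
  (forall k, \sum_(1 <= n < X | reg n k) U n k <= K1) ->
  (forall j, \sum_(1 <= n < X | (j <= nu n)%N && reg n (nu n - j)%N)
     V n (nu n - j)%N <= K2) ->
  \sum_(1 <= n < X) \sum_(0 <= k < (nu n).+1 | reg n k)
     a n * (B k * A (nu n - k)%N) <= (K1 + K2) / 2 * L.
Proof.
move=> nu_mono U0 V0 A0 B0 AL BL aUV hU hV.
have nu_le m n : (m <= n)%N -> (nu m <= nu n)%N.
  by move=> mn; rewrite -(subnK mn); elim: (n - m)%N => // i IH; apply: leq_trans IH _; rewrite addSn.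
have L0 : 0 <= L by have := AL 0%N; rewrite big_geq.
(* A common range for [k] and [j], large enough for every [n < X], so that the order of summation
   can be exchanged. *)
pose N := (nu X).+1.
apply: (@le_trans _ _ (\sum_(1 <= n < X)
   (2^-1 * \sum_(0 <= k < N | reg n k) U n k * B k ^+ 2 +
    2^-1 * \sum_(0 <= j < N | (j <= nu n)%N && reg n (nu n - j)%N)
       V n (nu n - j)%N * A j ^+ 2))).
  rewrite big_nat_cond [leRHS]big_nat_cond.
  apply: ler_sum => n; rewrite andbT => /andP[n0 nX].
  have nuN : ((nu n).+1 <= N)%N by rewrite ltnS nu_le // ltnW.
  apply: (@le_trans _ _ (2^-1 * \sum_(0 <= k < (nu n).+1 | reg n k) U n k * B k ^+ 2 +
     2^-1 * \sum_(0 <= k < (nu n).+1 | reg n k) V n k * A (nu n - k)%N ^+ 2)).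
    rewrite -mulrDr -big_split /= mulr_sumr.
    apply: ler_sum => k rnk.
    have UV := aUV _ _ n0 rnk.
    have := U0 n k; have := V0 n k; have := B0 k; have := A0 (nu n - k)%N.
    move: (U n k) (V n k) (B k) (A _) UV => u v b c UV c0 b0 v0 u0.
    have h : a n <= Num.sqrt u * Num.sqrt v.
      rewrite -sqrtrM // (le_trans (ler_norm _)) // -sqrtr_sqr ler_wsqrtr //.
    have {1}-> : u = Num.sqrt u ^+ 2 by rewrite sqr_sqrtr.
    have {1}-> : v = Num.sqrt v ^+ 2 by rewrite sqr_sqrtr.
    have h1 : a n * (b * c) <= Num.sqrt u * Num.sqrt v * (b * c) by rewrite ler_wpM2r // mulr_ge0.
    apply: le_trans h1 _.
    have := sqr_ge0 (Num.sqrt u * b - Num.sqrt v * c).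
    move: (Num.sqrt u) (Num.sqrt v) => p q; lra.
  apply: lerD; rewrite ler_wpM2l ?invr_ge0 //.
    rewrite (big_cat_nat (leq0n _) nuN) /= lerDl sumr_ge0 // => k _.
    by rewrite mulr_ge0 // sqr_ge0.
  (* The reversal [j = nu n - k]. *)
  rewrite big_mkord (reindex_inj rev_ord_inj) /=.
  rewrite (big_cat_nat (leq0n _) nuN) /= -[leLHS]addr0 lerD //; last first.
    by rewrite sumr_ge0 // => k _; rewrite mulr_ge0 // sqr_ge0.
  rewrite big_mkord le_eqVlt; apply/orP; left; apply/eqP; apply: eq_big => i.
    by rewrite subSS -ltnS ltn_ord.
  by rewrite subSS subKn // -ltnS.
rewrite big_split /= -!mulr_sumr.
rewrite (_ : (K1 + K2) / 2 * L = 2^-1 * (K1 * L) + 2^-1 * (K2 * L)); last by field.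
apply: lerD; rewrite ler_wpM2l ?invr_ge0 //.
  under eq_bigr do rewrite big_mkcond.
  rewrite exchange_big /= (@le_trans _ _ (\sum_(0 <= k < N) K1 * B k ^+ 2)) //.
    apply: ler_sum => k _.
    rewrite (eq_bigr (fun n => (if reg n k then U n k else 0) * B k ^+ 2)); last first.
      by move=> n _; case: ifP => //; rewrite mul0r.
    by rewrite -mulr_suml -big_mkcond ler_wpM2r // sqr_ge0.
  rewrite -mulr_sumr ler_wpM2l //; have := hU 0%N; apply: le_trans; exact: sumr_ge0.
under eq_bigr do rewrite big_mkcond.
rewrite exchange_big /= (@le_trans _ _ (\sum_(0 <= k < N) K2 * A k ^+ 2)) //.
  apply: ler_sum => j _.
  rewrite (eq_bigr (fun n => (if (j <= nu n)%N && reg n (nu n - j)%N then V n (nu n - j)%N else 0) * A j ^+ 2)); last first.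
    by move=> n _; case: ifP => //; rewrite mul0r.
  by rewrite -mulr_suml -big_mkcond ler_wpM2r // sqr_ge0.
rewrite -mulr_sumr ler_wpM2l //; have := hV 0%N; apply: le_trans; exact: sumr_ge0.
Qed.

Section HalfForm.
Variables (nu : nat -> nat) (a : nat -> R) (C E : R).
Hypothesis nu0 : nu 0%N = 0%N.
Hypothesis nu_incr : forall n, (nu n < nu n.+1)%N.
Hypothesis a_pos : forall n, (0 < n)%N -> 0 < a n.
Let S (n : nat) : R := Ssum nu a n.
Let t (n : nat) : R := a n ^+ 2 / gap nu n.
Hypothesis tail_bound : forall n X, (1 < n)%N ->
  S n * \sum_(n <= i < X) t i <= C.
Hypothesis sq_bound : forall X, \sum_(1 <= i < X) a i ^+ 2 <= E.

Let nu_le n : (nu n <= nu n.+1)%N. Proof. exact: ltnW. Qed.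

Let nu_gt0 n : (0 < n)%N -> (0 < nu n)%N.
Proof. by case: n => // n _; apply: leq_ltn_trans (nu_incr n). Qed.

Let S0 : S 0 = 0. Proof. by rewrite /S /Ssum big_geq. Qed.

Let SS n : S n.+1 = S n + a n.+1 * (nu n.+1)%:R.
Proof. by rewrite /S /Ssum big_nat_recr. Qed.

Let S_mono n : S n < S n.+1.
Proof. by rewrite SS ltrDl mulr_gt0 ?a_pos ?ltr0n ?nu_gt0. Qed.

Let S_ge0 n : 0 <= S n.
Proof. by elim: n => [|n IH]; rewrite ?S0 // (le_trans IH) // ltW. Qed.

Let S_gt0 n : (0 < n)%N -> 0 < S n.
Proof. by case: n => // n _; apply: le_lt_trans (S_mono n). Qed.

Let gap_gt0 n : (0 < n)%N -> 0 < gap nu n :> R.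
Proof. by case: n => // n _; rewrite /gap subr_gt0 ltr_nat. Qed.

Let t_ge0 n : 0 <= t n.
Proof.
by case: n => [|n]; rewrite /t /gap /= ?subrr ?invr0 ?mulr0 // divr_ge0 ?sqr_ge0 // ltW // gap_gt0.
Qed.

Let psi_bounds (k : nat) n : 0 <= S n / (S n + k%:R) <= 1.
Proof.
have := S_ge0 n; have : 0 <= k%:R :> R by []; move: (S n) (k%:R) => s x x0 s0.
(* When [S n] and [k] both vanish the quotient takes the default value 0. *)
have [->|sx] := eqVneq (s + x) 0; first by rewrite invr0 mulr0 lexx ler01.
have sx0 : 0 < s + x by rewrite lt_neqAle eq_sym sx addr_ge0.
by rewrite divr_ge0 ?ler_pdivrMr //; lra.
Qed.

Let psi_mono (k : nat) n : (0 < k)%N ->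
  S n / (S n + k%:R) <= S n.+1 / (S n.+1 + k%:R).
Proof.
move=> k0; have k1 : 0 < k%:R :> R by rewrite ltr0n.
have := S_ge0 n; have := S_mono n; move: (S n) (S n.+1) (k%:R) k1 => s s' x x0 ss' s0.
rewrite ler_pdivrMr ?ltr_wpDl // mulrAC ler_pdivlMr; last lra.
nra.
Qed.

(** The exact increment is [k * (S n.+1 - S n)] over [(S n + k) * (S n.+1 + k)], and
    [S n <= S n.+1]. Since [S n.+1 - S n = a n.+1 * nu n.+1], this controls [a n.+1] as soon as
    [(S n.+1 + k) ^+ 2] is at most a multiple of [k * nu n.+1]. *)
Let psi_incr (k : nat) n : (0 < k)%N ->
  k%:R * (S n.+1 - S n) <=
  (S n.+1 / (S n.+1 + k%:R) - S n / (S n + k%:R)) * (S n.+1 + k%:R) ^+ 2.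
Proof.
move=> k0; have k1 : 0 < k%:R :> R by rewrite ltr0n.
have := S_ge0 n; have := S_mono n; move: (S n) (S n.+1) (k%:R) k1 => s s' x x0 ss' s0.
have -> : (s' / (s' + x) - s / (s + x)) * (s' + x) ^+ 2 = x * (s' - s) * ((s' + x) / (s + x)).
  by field; apply/andP; split; rewrite gt_eqF //; lra.
by rewrite ler_peMr ?mulr_ge0 //; try lra; rewrite ler_pdivlMr; lra.
Qed.

(** With [j = nu n - k], [near] says that [j] lies above [nu n.-1], so that [j] determines [n],
    while [far] says that [j <= nu n.-1]. Far pairs are divided at [k * nu n = S n ^+ 2], where the
    tail bound takes over from the increments of [S]. *)
Let near n k := ((k + nu n.-1 < nu n) && (k.*2 <= nu n))%N.
Let far n k := ((nu n <= k + nu n.-1) && (k.*2 <= nu n))%N.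
Let reg1 n k := far n k && ((k * nu n)%:R <= S n ^+ 2).
Let reg2 n k := far n k && (S n ^+ 2 < (k * nu n)%:R).

Let far_gt0 n k : (0 < n)%N -> far n k -> (0 < k)%N.
Proof. by case: n => // n _ /andP[] /= h1 h2; have := nu_incr n; lia. Qed.

(** Weights [a n ^+ 2] and 1: at fixed [k] the sum is at most the l2 bound, at fixed [j] at most one
    because a single gap contains [j]. The potential is the step function of the condition
    [j <= nu n]. *)
Lemma near_form A B (L : R) X :
  (forall k, 0 <= A k) -> (forall k, 0 <= B k) ->
  (forall K, \sum_(0 <= k < K) A k ^+ 2 <= L) ->
  (forall K, \sum_(0 <= k < K) B k ^+ 2 <= L) ->
  \sum_(1 <= n < X) \sum_(0 <= k < (nu n).+1 | near n k)
    a n * (B k * A (nu n - k)%N) <= (E + 1) / 2 * L.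
Proof.
move=> A0 B0 AL BL.
apply: (@schur_test_form nu a near (fun n _ => a n ^+ 2) (fun _ _ => 1)) => //.
- by move=> n _; rewrite sqr_ge0.
- by move=> n k _ _; rewrite mulr1.
- move=> k; apply: le_trans (sq_bound X).
  by rewrite big_mkcond ler_sum // => n _; case: ifP; rewrite ?sqr_ge0.
- move=> j; rewrite -[leRHS]mul1r.
  apply: (@ler_sum_telescope _ _ (fun n => (j <= nu n)%N%:R)) => //.
  + by move=> n; case: (j <= _)%N; rewrite /= ?lexx ler01.
  + by move=> n; have := nu_incr n; rewrite ler_nat; lia.
  + move=> n _ /andP[jn /andP[] /=]; have := nu_incr n => nn h _.
    have -> : (j <= nu n)%N = false by lia.
    by rewrite jn subr0 mulr1.
Qed.

(** The two weights have product [a n ^+ 2]. At fixed [k] the region forces [S n >= k], as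
    [k ^+ 2 <= k * nu n <= S n ^+ 2], and summation against the tails [tau n <= C / S n] gives
    [2 * C]. At fixed [j] it forces [S n >= sqrt (k * j)], so the second weight is at most the gap
    divided by [k ^ (3/4) * j ^ (1/4)], which is a Riemann sum of [k ^ (-3/4)] over [k <= j], up to
    the factor in [j]. *)
Lemma far_form1 A B (L : R) X :
  (forall k, 0 <= A k) -> (forall k, 0 <= B k) ->
  (forall K, \sum_(0 <= k < K) A k ^+ 2 <= L) ->
  (forall K, \sum_(0 <= k < K) B k ^+ 2 <= L) ->
  \sum_(1 <= n < X) \sum_(0 <= k < (nu n).+1 | reg1 n k)
    a n * (B k * A (nu n - k)%N) <= (2 * C + 4) / 2 * L.
Proof.
move=> A0 B0 AL BL.
have C0 : 0 <= C.
  by have := @tail_bound 2%N 0%N isT; rewrite big_geq // mulr0.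
apply: (@schur_test_form nu a reg1 (fun n k => t n * Num.sqrt (k%:R * S n))
  (fun n k => `|gap nu n| / Num.sqrt (k%:R * S n))) => //.
- by move=> n k; rewrite mulr_ge0 ?sqrtr_ge0.
- move=> n k n0 /andP[/(far_gt0 n0) k0 _].
  have g0 := gap_gt0 n0; rewrite (gtr0_norm g0) /t.
  have q0 : 0 < Num.sqrt (k%:R * S n) by rewrite sqrtr_gt0 mulr_gt0 ?ltr0n ?S_gt0.
  rewrite le_eqVlt; apply/orP; left; apply/eqP; field.
  by rewrite !gt_eqF.
- move=> k; case: k => [|k].
    rewrite big_nat_cond big1 ?mulr_ge0 // => n /andP[/andP[n0 _] /andP[h _]].
    by have := far_gt0 n0 h.
  set K : R := k.+1%:R; have K0 : 0 < K by rewrite /K ltr0n.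
  pose tau n := \sum_(n <= i < X) t i.
  have tau0 n : 0 <= tau n by rewrite sumr_ge0.
  (* On the region [tau n <= C / S n <= C / K]. Truncating the square root of [tau] at [M] keeps the
     potential bounded before the region is reached. *)
  pose M := Num.sqrt (C / K).
  have M0 : 0 <= M by rewrite sqrtr_ge0.
  have -> : 2 * C = (2 * Num.sqrt C * Num.sqrt K) * M.
    rewrite -!mulrA /M -sqrtrM ?ltW // [K * _]mulrCA divff ?gt_eqF // mulr1.
    by rewrite -expr2 sqr_sqrtr.
  apply: (@ler_sum_telescope _ _ (fun n => M - Num.min (Num.sqrt (tau n.+1)) M)).
  + by rewrite !mulr_ge0 ?sqrtr_ge0.
  + move=> n; have : 0 <= Num.min (Num.sqrt (tau n.+1)) M by rewrite le_min sqrtr_ge0.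
    have : Num.min (Num.sqrt (tau n.+1)) M <= M by rewrite ge_min lexx orbT.
    by move: (Num.min _ _) => x *; apply/andP; lra.
  + move=> n; rewrite lerB // le_min !ge_min lexx orbT andbT.
    rewrite ler_wsqrtr // /tau.
    case: (ltnP n.+1 X) => nX; last by rewrite !big_geq // ltnW.
    by rewrite [leRHS]big_ltn // lerDr.
  + move=> n nX /andP[fa hS].
    have [/andP[f1 f2] hk] := (fa, far_gt0 (ltn0Sn n) fa).
    (* The index 1 has no far pair: its gap is [nu 1], whereas [0 < k <= nu 1 / 2]. So the tail
       bound is available. *)
    have n1 : (0 < n)%N by case: n f1 f2 {hS fa nX} => //=; rewrite nu0; lia.
    have Sk : K <= S n.+1.
      rewrite -ler_sqr ?nnegrE ?S_ge0 ?(ltW K0) // (le_trans _ hS) // /K expr2 -natrM ler_nat.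
      by rewrite leq_mul //; lia.
    have tn : t n.+1 = tau n.+1 - tau n.+2 by rewrite /tau big_ltn // addrK.
    have SC : S n.+1 * tau n.+1 <= C by exact: tail_bound.
    have tauC : tau n.+1 <= C / K.
      rewrite ler_pdivlMr // mulrC; apply: le_trans SC; rewrite ler_wpM2r //.
    have tau_mono : tau n.+2 <= tau n.+1 by rewrite -subr_ge0 -tn.
    have -> : Num.min (Num.sqrt (tau n.+1)) M = Num.sqrt (tau n.+1).
      by apply/min_idPl; rewrite /M ler_wsqrtr.
    have -> : Num.min (Num.sqrt (tau n.+2)) M = Num.sqrt (tau n.+2).
      by apply/min_idPl; rewrite /M ler_wsqrtr // (le_trans tau_mono).
    rewrite sqrtrM ?(ltW K0) // tn.
    have : Num.sqrt (S n.+1) * Num.sqrt (tau n.+1) <= Num.sqrt C.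
      by rewrite -sqrtrM ?S_ge0 // ler_wsqrtr.
    have : Num.sqrt (tau n.+2) <= Num.sqrt (tau n.+1) by rewrite ler_wsqrtr.
    have -> : tau n.+1 - tau n.+2 = Num.sqrt (tau n.+1) ^+ 2 - Num.sqrt (tau n.+2) ^+ 2.
      by rewrite !sqr_sqrtr.
    have := sqrtr_ge0 (tau n.+2); have := sqrtr_ge0 (S n.+1); have := sqrtr_ge0 K.
    move: (Num.sqrt (tau n.+1)) (Num.sqrt (tau n.+2)) (Num.sqrt (S n.+1)) (Num.sqrt K) (Num.sqrt C).
    move=> x y s q c q0 s0 y0 yx sx.
    have h1 : (x ^+ 2 - y ^+ 2) <= 2 * x * (x - y) by have := sqr_ge0 (x - y); lra.
    have h2 : (x ^+ 2 - y ^+ 2) * s <= 2 * c * (x - y).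
      have h3 : (s * x) * (x - y) <= c * (x - y) by rewrite ler_wpM2r ?subr_ge0.
      have : (x ^+ 2 - y ^+ 2) * s <= 2 * x * (x - y) * s by rewrite ler_wpM2r.
      lra.
    rewrite [q * s]mulrC mulrA.
    rewrite (_ : 2 * c * q * (M - y - (M - x)) = 2 * c * (x - y) * q); last by ring.
    by rewrite ler_wpM2r.
- move=> j; case: j => [|j].
    rewrite big_nat_cond big1 // => n /andP[/andP[n0 _] /andP[_ /andP[/andP[_]]]].
    by rewrite subn0; have := nu_gt0 n0; lia.
  (* Fourth roots. With [k'] the value of [k] one index earlier, the gap is [q k ^+ 4 - q k' ^+ 4],
     at most [4 * q k ^+ 3 * (q k - q k')]; the cube cancels against the weight and the rest
     telescopes. *)
  pose q (m : nat) : R := Num.sqrt (Num.sqrt m%:R).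
  have q_mono m n : (m <= n)%N -> q m <= q n by move=> mn; rewrite !ler_wsqrtr // ler_nat.
  have q_ge0 m : 0 <= q m by rewrite sqrtr_ge0.
  have q2 m : q m ^+ 2 = Num.sqrt m%:R by rewrite sqr_sqrtr ?sqrtr_ge0.
  have q4 m : q m ^+ 4 = m%:R by rewrite (exprM _ 2 2) q2 sqr_sqrtr.
  have qj0 : 0 < q j.+1 by rewrite !sqrtr_gt0 ltr0n.
  have -> : 4 = (4 / q j.+1) * q j.+1 by rewrite divfK ?gt_eqF.
  apply: (@ler_sum_telescope _ _ (fun n => Num.min (q (nu n - j.+1)%N) (q j.+1))).
  + by rewrite divr_ge0.
  + by move=> n; rewrite le_min ge_min lexx orbT !q_ge0.
  + move=> n; rewrite le_min !ge_min lexx orbT andbT q_mono //; have := nu_incr n; lia.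
  + move=> n nX /andP[jn /andP[fa hS]].
    have [/andP[/= f1 f2] hk] := (fa, far_gt0 (ltn0Sn n) fa).
    set k := (nu n.+1 - j.+1)%N in fa hS f1 f2 hk *.
    set k' := (nu n - j.+1)%N.
    have kj : (k <= j.+1)%N by rewrite /k; lia.
    have k'k : (k' <= k)%N by rewrite /k /k'; have := nu_incr n; lia.
    have -> : Num.min (q k) (q j.+1) = q k by apply/min_idPl; exact: q_mono.
    have -> : Num.min (q k') (q j.+1) = q k' by apply/min_idPl; apply: q_mono; apply: leq_trans kj.
    have -> : `|gap nu n.+1| = q k ^+ 4 - q k' ^+ 4.
      rewrite gtr0_norm ?gap_gt0 // !q4 /gap /= /k /k'.
      have jn' : (j.+1 <= nu n)%N by lia.
      rewrite !natrB //; ring.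
    have hsq : q k ^+ 3 * q j.+1 <= Num.sqrt (k%:R * S n.+1).
      rewrite sqrtrM //.
      have -> : q k ^+ 3 * q j.+1 = q k ^+ 2 * (q k * q j.+1) by ring.
      rewrite q2 ler_wpM2l ?sqrtr_ge0 // /q -sqrtrM ?sqrtr_ge0 // ler_wsqrtr //.
      rewrite -sqrtrM // -[leRHS]ger0_norm // -sqrtr_sqr ler_wsqrtr // (le_trans _ hS) //.
      by rewrite -natrM ler_nat leq_mul.
    have qk0 : 0 < q k by rewrite !sqrtr_gt0 ltr0n.
    rewrite ler_pdivrMr; last by apply: lt_le_trans hsq; rewrite mulr_gt0 ?exprn_gt0.
    have qq : q k' <= q k by exact: q_mono.
    apply: (@le_trans _ _ (4 / q j.+1 * (q k - q k') * (q k ^+ 3 * q j.+1))); last first.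
      by rewrite ler_wpM2l // mulr_ge0 ?subr_ge0 // divr_ge0.
    have -> : 4 / q j.+1 * (q k - q k') * (q k ^+ 3 * q j.+1) = 4 * q k ^+ 3 * (q k - q k').
      by field; rewrite gt_eqF.
    have := q_ge0 k'; move: (q k) (q k') qq => x y yx y0.
    have -> : x ^+ 4 - y ^+ 4 = (x ^+ 3 + x ^+ 2 * y + x * y ^+ 2 + y ^+ 3) * (x - y) by ring.
    rewrite ler_wpM2r ?subr_ge0 //.
    have x0 : 0 <= x by lra.
    have h1 : y ^+ 2 <= x ^+ 2 by rewrite ler_sqr.
    have h2 : y ^+ 3 <= x ^+ 3 by rewrite ler_pXn2r.
    have h3 : x ^+ 2 * y <= x ^+ 3 by rewrite [x ^+ 3]exprSr ler_wpM2l ?sqr_ge0.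
    have h4 : x * y ^+ 2 <= x ^+ 3 by rewrite [x ^+ 3]exprS ler_wpM2l.
    lra.
Qed.

(** Both weights are [a n] and both potentials are of the form [S n / (S n + x)]. For [x = k],
    [S n ^+ 2 < k * nu n] and [2 k <= nu n] give [(S n + k) ^+ 2 <= 4 * k * nu n]. For [x = j],
    [k <= j] and [nu n <= 2 j] give [S n <= 2 j], hence [(S n + j) ^+ 2 <= 9 * j ^+ 2]. *)
Lemma far_form2 A B (L : R) X :
  (forall k, 0 <= A k) -> (forall k, 0 <= B k) ->
  (forall K, \sum_(0 <= k < K) A k ^+ 2 <= L) ->
  (forall K, \sum_(0 <= k < K) B k ^+ 2 <= L) ->
  \sum_(1 <= n < X) \sum_(0 <= k < (nu n).+1 | reg2 n k)
    a n * (B k * A (nu n - k)%N) <= (4 + 9) / 2 * L.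
Proof.
move=> A0 B0 AL BL.
apply: (@schur_test_form nu a reg2 (fun n k => `|a n|) (fun n k => `|a n|)) => //.
- by move=> n k n0 _; rewrite gtr0_norm ?a_pos.
- move=> k; case: k => [|k].
    rewrite big_nat_cond big1 // => n /andP[/andP[n0 _] /andP[h _]].
    by have := far_gt0 n0 h.
  rewrite -[leRHS]mulr1.
  apply: (@ler_sum_telescope _ _ (fun n => S n / (S n + k.+1%:R))) => //.
  + by move=> n; exact: psi_mono.
  + move=> n nX /andP[/andP[/= f1 f2] hS].
    have := @psi_incr k.+1 n isT; rewrite {1}SS addrAC subrr add0r.
    have an := a_pos (ltn0Sn n); rewrite (gtr0_norm an).
    move: (_ / _ - _ / _) => D hD.
    have s0 := S_ge0 n.+1.
    have nk : (k.+1)%:R * 2 <= (nu n.+1)%:R :> R by rewrite -natrM ler_nat; lia.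
    have k0 : 0 < k.+1%:R :> R by rewrite ltr0n.
    move: hS; rewrite natrM.
    move: (S n.+1) (a n.+1) ((nu n.+1)%:R) (k.+1%:R) s0 nk k0 an hD => s b v x s0 vx x0 b0 hD hS.
    have h1 : (s + x) ^+ 2 <= 4 * x * v.
      have : (s + x) ^+ 2 <= 2 * s ^+ 2 + 2 * x ^+ 2 by have := sqr_ge0 (s - x); lra.
      nra.
    have D0 : 0 <= D.
      have p : 0 < (s + x) ^+ 2 by rewrite exprn_gt0 //; lra.
      rewrite -(pmulr_lge0 _ p); apply: le_trans hD; rewrite !mulr_ge0 //; lra.
    have h2 : x * (b * v) <= D * (4 * x * v) by apply: le_trans hD _; rewrite ler_wpM2l.
    have xv : 0 < x * v by rewrite mulr_gt0 //; lra.
    rewrite -(ler_pM2r xv); nra.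
- move=> j; case: j => [|j].
    rewrite big_nat_cond big1 // => n /andP[/andP[n0 _] /andP[_ /andP[/andP[_]]]].
    by rewrite subn0; have := nu_gt0 n0; lia.
  rewrite -[leRHS]mulr1.
  apply: (@ler_sum_telescope _ _ (fun n => S n / (S n + j.+1%:R))) => //.
  + by move=> n; exact: psi_mono.
  + move=> n nX /andP[jn /andP[/andP[/= f1 f2] hS]].
    have := @psi_incr j.+1 n isT; rewrite {1}SS addrAC subrr add0r.
    have an := a_pos (ltn0Sn n); rewrite (gtr0_norm an).
    move: (_ / _ - _ / _) => D hD.
    have s0 := S_ge0 n.+1.
    have nj : (j.+1)%:R <= (nu n.+1)%:R :> R by rewrite ler_nat.
    have k0 : 0 < j.+1%:R :> R by rewrite ltr0n.
    have sj : S n.+1 <= 2 * j.+1%:R.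
      rewrite -ler_sqr ?nnegrE ?mulr_ge0 // (le_trans (ltW hS)) // exprMn -!natrX -natrM ler_nat.
      have : (nu n.+1 - j.+1 <= j.+1)%N by lia.
      have : (nu n.+1 <= 2 * j.+1)%N by lia.
      by move=> h1 h2; rewrite (leq_trans (leq_mul h2 h1)) //; nia.
    move: (S n.+1) (a n.+1) ((nu n.+1)%:R) (j.+1%:R) s0 sj nj k0 an hD => s b v x s0 sj vx x0 b0 hD.
    have h1 : (s + x) ^+ 2 <= 9 * x ^+ 2.
      by have := sqr_ge0 (s - x); nra.
    have D0 : 0 <= D.
      have p : 0 < (s + x) ^+ 2 by rewrite exprn_gt0 //; lra.
      rewrite -(pmulr_lge0 _ p); apply: le_trans hD; rewrite !mulr_ge0 //; lra.
    have h2 : x * (b * v) <= D * (9 * x ^+ 2) by apply: le_trans hD _; rewrite ler_wpM2l.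
    have xx : 0 < x ^+ 2 by rewrite exprn_gt0.
    have h3 : 0 <= b * (x * (v - x)) by rewrite !mulr_ge0 ?subr_ge0 // ltW.
    rewrite -(ler_pM2r xx); lra.
Qed.

(** The regions [near], [reg1], [reg2] partition the half, and the constants add up as
    [(E + 1) + (2 * C + 4) + (4 + 9)]. *)
Lemma half_form A B (L : R) X :
  (forall k, 0 <= A k) -> (forall k, 0 <= B k) ->
  (forall K, \sum_(0 <= k < K) A k ^+ 2 <= L) ->
  (forall K, \sum_(0 <= k < K) B k ^+ 2 <= L) ->
  \sum_(1 <= n < X) \sum_(0 <= k < (nu n).+1 | (k.*2 <= nu n)%N)
    a n * (B k * A (nu n - k)%N) <= (E + 2 * C + 18) / 2 * L.
Proof.
move=> A0 B0 AL BL.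
have := near_form X A0 B0 AL BL; have := far_form1 X A0 B0 AL BL.
have := far_form2 X A0 B0 AL BL.
set s2 := (X in X <= _ -> _); set s1 := (X in _ -> X <= _ -> _); set s0 := (X in _ -> _ -> X <= _ -> _).
have -> : \sum_(1 <= n < X) \sum_(0 <= k < (nu n).+1 | (k.*2 <= nu n)%N)
    a n * (B k * A (nu n - k)%N) = s0 + s1 + s2.
  rewrite -!big_split /=; apply: eq_bigr => n _.
  rewrite big_mkcond [in RHS]big_mkcond [X in _ + X + _]big_mkcond [X in _ + X]big_mkcond -!big_split /=.
  apply: eq_bigr => k _; rewrite /near /reg1 /reg2 /far.
  case: (k.*2 <= nu n)%N; rewrite ?andbF ?addr0 //=.
  rewrite !andbT; case: ltnP => _ /=; rewrite ?addr0 //.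
  by case: lerP => _ /=; rewrite ?addr0 ?add0r.
lra.
Qed.

(** The pairs with [2 k > nu n] are carried by [k -> nu n - k] into the half already treated, with
    [A] and [B] exchanged. *)
Lemma positive_hankel_form A B (L : R) X :
  (forall k, 0 <= A k) -> (forall k, 0 <= B k) ->
  (forall K, \sum_(0 <= k < K) A k ^+ 2 <= L) ->
  (forall K, \sum_(0 <= k < K) B k ^+ 2 <= L) ->
  \sum_(1 <= n < X) a n * (\sum_(0 <= k < (nu n).+1) A k * B (nu n - k)%N)
    <= (E + 2 * C + 18) * L.
Proof.
move=> A0 B0 AL BL.
have h1 := half_form X A0 B0 AL BL; have h2 := half_form X B0 A0 BL AL.
have -> : (E + 2 * C + 18) * L = (E + 2 * C + 18) / 2 * L + (E + 2 * C + 18) / 2 * L by field.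
apply: le_trans (lerD h1 h2); rewrite -big_split /=.
rewrite big_nat_cond [leRHS]big_nat_cond.
apply: ler_sum => n; rewrite andbT => /andP[n0 _].
have an := ltW (a_pos n0).
rewrite mulr_sumr (bigID (fun k => (k.*2 <= nu n)%N)) /= addrC; apply: lerD => //.
rewrite big_mkord (reindex_inj rev_ord_inj) /= big_mkord.
rewrite big_mkcond [leRHS]big_mkcond; apply: ler_sum => i _ /=.
rewrite subSS; have := ltn_ord i; rewrite ltnS => ilt.
rewrite subKn //; case: ifP => h1'; case: ifP => h2'; rewrite ?mulr_ge0 //.
  by rewrite [A _ * _]mulrC.
by exfalso; lia.
Qed.

End HalfForm.

End PositiveHankelForms.

(** * The modulus on [R[i]] and its topology *)

Section Modulus.
Local Open Scope classical_set_scope.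
Local Open Scope ring_scope.
Context {R : realType}.
Local Notation C := (R[i]).
Local Notation Re := (@complex.Re R).
Local Notation Im := (@complex.Im R).
Implicit Types z w : C.

Lemma cmod_ge0 z : 0 <= cmod z.
Proof. by case: z => x y; rewrite sqrtr_ge0. Qed.

Lemma cmod_sqr z : cmod z ^+ 2 = Re z ^+ 2 + Im z ^+ 2.
Proof. by case: z => x y /=; rewrite sqr_sqrtr // addr_ge0 ?sqr_ge0. Qed.

Lemma cmodM z w : cmod (z * w) = cmod z * cmod w.
Proof. exact: ComplexField.Normc.normcM. Qed.

Lemma cmodN z : cmod (- z) = cmod z.
Proof. exact: normcN. Qed.

Lemma cmodD z w : cmod (z + w) <= cmod z + cmod w.
Proof. exact: le_normcD. Qed.

Lemma cmodB z w : cmod (z - w) <= cmod z + cmod w.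
Proof. by rewrite -(cmodN w) cmodD. Qed.

Lemma cmod_distrC z w : cmod (z - w) = cmod (w - z).
Proof. by rewrite -cmodN opprB. Qed.

Lemma cmod_dist_triangle z w v : cmod (z - v) <= cmod (z - w) + cmod (w - v).
Proof. by rewrite (le_trans _ (cmodD _ _)) // addrA subrK. Qed.

Lemma cmod0 : cmod (0 : C) = 0. Proof. exact: ComplexField.Normc.normc0. Qed.

Lemma cmod1 : cmod (1 : C) = 1. Proof. exact: ComplexField.Normc.normc1. Qed.

Lemma cmodV z : cmod z^-1 = (cmod z)^-1.
Proof. exact: ComplexField.Normc.normcV. Qed.

Lemma cmodX z n : cmod (z ^+ n) = cmod z ^+ n.
Proof. by elim: n => [|n IH]; rewrite ?expr0 ?cmod1 // !exprS cmodM IH. Qed.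

Lemma cmod_real (x : R) : cmod x%:C%C = `|x|.
Proof. by rewrite /cmod /= expr0n addr0 sqrtr_sqr. Qed.

Lemma cmod_eq0 z : (cmod z == 0) = (z == 0).
Proof.
by apply/eqP/eqP => [/ComplexField.Normc.eq0_normc|->] //; rewrite cmod0.
Qed.

Lemma cmod_gt0 z : (0 < cmod z) = (z != 0).
Proof. by rewrite lt_neqAle eq_sym cmod_ge0 andbT cmod_eq0. Qed.

Lemma cmod_conj z : cmod z^*%C = cmod z.
Proof. by case: z => x y; rewrite /cmod /= sqrrN. Qed.

Lemma ler_Re_cmod z : `|Re z| <= cmod z.
Proof.
rewrite -ler_sqr ?nnegrE ?cmod_ge0 // -normrX ger0_norm ?sqr_ge0 // cmod_sqr.
by rewrite lerDl sqr_ge0.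
Qed.

Lemma ler_Im_cmod z : `|Im z| <= cmod z.
Proof.
rewrite -ler_sqr ?nnegrE ?cmod_ge0 // -normrX ger0_norm ?sqr_ge0 // cmod_sqr.
by rewrite lerDr sqr_ge0.
Qed.

Lemma cmod_le_ReIm z : cmod z <= `|Re z| + `|Im z|.
Proof.
rewrite -ler_sqr ?nnegrE ?cmod_ge0 ?addr_ge0 // cmod_sqr.
rewrite -(normr_idP (sqr_ge0 (Re z))) -(normr_idP (sqr_ge0 (Im z))) !normrX.
have := normr_ge0 (Re z); have := normr_ge0 (Im z); nra.
Qed.

Lemma cmod_sum (I : Type) (s : seq I) (P : pred I) (f : I -> C) :
  cmod (\sum_(i <- s | P i) f i) <= \sum_(i <- s | P i) cmod (f i).
Proof.
elim/big_rec2: _ => [|i x y _ xy]; first by rewrite cmod0.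
by rewrite (le_trans (cmodD _ _)) // lerD2l.
Qed.

Lemma Re_sum (I : Type) (s : seq I) (P : pred I) (f : I -> C) :
  Re (\sum_(i <- s | P i) f i) = \sum_(i <- s | P i) Re (f i).
Proof. by elim/big_rec2: _ => // i x y _ <-; case: (f i) => ? ?; case: y. Qed.

Lemma ReD z w : Re (z + w) = Re z + Re w. Proof. by case: z; case: w. Qed.
Lemma ImD z w : Im (z + w) = Im z + Im w. Proof. by case: z; case: w. Qed.
Lemma ReB z w : Re (z - w) = Re z - Re w. Proof. by case: z; case: w. Qed.
Lemma ImB z w : Im (z - w) = Im z - Im w. Proof. by case: z; case: w. Qed.
Lemma ReM z w : Re (z * w) = Re z * Re w - Im z * Im w.
Proof. by case: z; case: w. Qed.
Lemma ImM z w : Im (z * w) = Re z * Im w + Im z * Re w.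
Proof. by case: z; case: w. Qed.
Lemma complex_eqP z w : Re z = Re w -> Im z = Im w -> z = w.
Proof. by case: z => ? ?; case: w => ? ? /= -> ->. Qed.

Lemma conjcM z w : (z * w)^*%C = z^*%C * w^*%C.
Proof. exact: rmorphM. Qed.

Lemma conjc_sum (I : Type) (s : seq I) (P : pred I) (f : I -> C) :
  (\sum_(i <- s | P i) f i)^*%C = \sum_(i <- s | P i) (f i)^*%C.
Proof. exact: rmorph_sum. Qed.

Lemma mul_conjc z : z * z^*%C = (cmod z ^+ 2)%:C%C.
Proof.
by rewrite cmod_sqr; apply: complex_eqP; case: z => x y /=; ring.
Qed.

(** A rotation turning a modulus into a real part; it reduces complex estimates to real integrals
    and real maxima. *)
Lemma exists_unit_multiplier z : exists2 u : C, cmod u = 1 & Re (u * z) = cmod z.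
Proof.
have [->|z0] := eqVneq z 0; first by exists 1; rewrite ?cmod1 // mul1r cmod0.
have z0' : cmod z != 0 by rewrite cmod_eq0.
exists (z^*%C / (cmod z)%:C%C).
  by rewrite cmodM cmodV cmod_conj cmod_real ger0_norm ?cmod_ge0 // divff.
rewrite mulrAC [_ * z]mulrC mul_conjc -fmorphV -rmorphM /= expr2.
by rewrite mulfK.
Qed.

(** The norm of [R[i]] takes values in [R[i]], where positive elements have zero imaginary part;
    this brings convergence back to real [e]. *)
Lemma cvg_cmodP (T : Type) (F : set_system T) {FF : Filter F} (g : T -> C) (l : C) :
  (g x : C^o) @[x --> F] --> (l : C^o) <->
  forall e : R, 0 < e -> \forall x \near F, cmod (l - g x) < e.
Proof.
have n2c (z : C) : `|z| = (cmod z)%:C%C by [].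
split=> [/cvgrPdist_lt gl e e0|gl].
  have /gl : 0 < e%:C%C by rewrite ltcR.
  by apply: filterS => x; rewrite n2c ltcR.
apply/cvgrPdist_lt => -[e e'] /=; rewrite ltcE /= => /andP[/eqP -> /gl].
by apply: filterS => x; rewrite n2c (_ : (e +i* 0)%C = e%:C%C) // ltcR.
Qed.

End Modulus.

(** * The exponentials [cexp] and [e1] *)

Section Exponential.
Local Open Scope classical_set_scope.
Local Open Scope ring_scope.
Context {R : realType}.
Local Notation C := (R[i]).
Implicit Types x y t : R.

Lemma cexpD x y : cexp (x + y) = cexp x * cexp y.
Proof. by apply: complex_eqP; rewrite /= ?cosD ?sinD //; ring. Qed.

Lemma cexp0 : cexp 0 = 1 :> C.
Proof. by rewrite /cexp cos0 sin0. Qed.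

Lemma cmod_cexp x : cmod (cexp x) = 1.
Proof. by rewrite /cmod /= cos2Dsin2 sqrtr1. Qed.

Lemma e1D x y : e1 (x + y) = e1 x * e1 y.
Proof. by rewrite /e1 mulrDr cexpD. Qed.

Lemma e10 : e1 0 = 1 :> C.
Proof. by rewrite /e1 mulr0 cexp0. Qed.

Lemma cmod_e1 x : cmod (e1 x) = 1.
Proof. exact: cmod_cexp. Qed.

Lemma e1_1 : e1 1 = 1 :> C.
Proof. by rewrite /e1 mulr1 mulrC mulr_natr /cexp cos2pi sin2pi. Qed.

Lemma e1N x : e1 (- x) = (e1 x)^*%C.
Proof. by rewrite /e1 mulrN /cexp cosN sinN. Qed.

Lemma e1_natM (n : nat) x : e1 (n%:R * x) = e1 x ^+ n.
Proof.
elim: n => [|n IH]; first by rewrite mul0r e10.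
by rewrite -natr1 mulrDl mul1r e1D IH exprSr.
Qed.

Lemma e1_nat (n : nat) : e1 n%:R = 1 :> C.
Proof. by rewrite -[n%:R]mulr1 e1_natM e1_1 expr1n. Qed.

Lemma e1_int (k : int) : e1 k%:~R = 1 :> C.
Proof.
case: k => n; first exact: e1_nat.
by rewrite NegzE mulrNz e1N e1_nat conjc1.
Qed.

Lemma e1_intM_periodic (k : int) x : e1 (k%:~R * (x + 1)) = e1 (k%:~R * x).
Proof. by rewrite mulrDr mulr1 e1D e1_int mulr1. Qed.

Lemma e1_periodic : periodic1 (@e1 R).
Proof. by move=> x; rewrite e1D e1_1 mulr1. Qed.

Lemma lipschitz_of_derive (f f' : R -> R) x y :
  (forall t, is_derive t (1 : R) f (f' t)) -> (forall t, `|f' t| <= 1) ->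
  `|f x - f y| <= `|x - y|.
Proof.
move=> df f1; wlog xy : x y / x <= y => [h|].
  by have [/h //|/ltW/h] := leP x y; rewrite distrC [leRHS]distrC.
move: xy; rewrite le_eqVlt => /orP[/eqP ->|xy]; first by rewrite !subrr.
have cf : {within `[x, y], continuous f}.
  apply: continuous_subspaceT => t.
  apply: differentiable_continuous; apply/derivable1_diffP.
  by have [] := df t.
have [c _ /eqP] := MVT xy (fun t _ => df t) cf.
rewrite distrC [`|x - y|]distrC => /eqP ->; rewrite normrM ler_piMl //.
Qed.

Lemma cmod_cexpB x y : cmod (cexp x - cexp y) <= 2 * `|x - y|.
Proof.
apply: le_trans (cmod_le_ReIm _) _; rewrite /= mulr_natl mulr2n lerD //.
- apply: (@lipschitz_of_derive _ (fun t => - sin t)) => t.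
  by rewrite normrN sin_max.
- by apply: (@lipschitz_of_derive _ cos) => t; rewrite cos_max.
Qed.

(** The constant comes from [2 * (2 * pi)] and [pi < 4]. Its square reappears in the large sieve
    constant. *)
Lemma cmod_e1B x y : cmod (e1 x - e1 y) <= 16 * `|x - y|.
Proof.
apply: le_trans (cmod_cexpB _ _) _; rewrite -mulrBr normrM.
have p4 : pi < 4 :> R by have := @pihalf_lt2 R; lra.
have p0 := @pi_gt0 R.
rewrite mulrA ler_wpM2r // ger0_norm; lra.
Qed.

End Exponential.

(** * Integrals of complex functions through real and imaginary parts *)

Section ComplexIntegrals.
Local Open Scope classical_set_scope.
Local Open Scope ring_scope.
Context {R : realType}.
Local Notation C := (R[i]).
Local Notation mu := (@lebesgue_measure R).
Local Notation Re := (@complex.Re R).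
Local Notation Im := (@complex.Im R).
Local Notation RI D f := (Rintegral mu D f).
Local Notation rI D f := (mu.-integrable D (EFin \o f)).
Implicit Types (f g h : R -> R) (F G H : R -> C) (D : set R).

Lemma EFin_Rintegral D f : measurable D -> rI D f ->
  (\int[mu]_(x in D) (f x)%:E)%E = (RI D f)%:E.
Proof. by move=> mD fi; rewrite /Rintegral fineK // integrable_fin_num. Qed.

Lemma ge0_Rintegrable D f : measurable D -> measurable_fun D f ->
  (forall x, D x -> 0 <= f x) ->
  (\int[mu]_(x in D) (f x)%:E < +oo)%E -> rI D f.
Proof.
move=> mD mf f0 fi; apply/integrableP; split; first exact/measurable_EFinP.
apply: le_lt_trans fi; apply: ge0_le_integral => //.
- by apply: measurableT_comp => //; exact/measurable_EFinP.
- exact/measurable_EFinP.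
- by move=> x Dx /=; rewrite lee_fin ger0_norm // f0.
Qed.

Lemma le_Rintegrable D f g : measurable D -> measurable_fun D f ->
  (forall x, D x -> `|f x| <= g x) -> rI D g -> rI D f.
Proof.
move=> mD mf fg; apply: le_integrable => //; first exact/measurable_EFinP.
by move=> x Dx /=; rewrite lee_fin (le_trans (fg _ Dx)) // ler_norm.
Qed.

Lemma RintegrableD D f g : measurable D -> rI D f -> rI D g -> rI D (f \+ g).
Proof.
move=> mD fi gi; rewrite (_ : EFin \o _ = (EFin \o f) \+ (EFin \o g))%E; last by [].
exact: integrableD.
Qed.

Lemma RintegrableB D f g : measurable D -> rI D f -> rI D g -> rI D (f \- g).
Proof.
move=> mD fi gi; rewrite (_ : EFin \o _ = (EFin \o f) \- (EFin \o g))%E; last by [].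
exact: integrableB.
Qed.

Lemma RintegrableZl D f (k : R) : measurable D -> rI D f -> rI D (fun x => k * f x).
Proof.
move=> mD fi; rewrite (_ : EFin \o _ = (fun x => k%:E * (EFin \o f) x)%E); last by [].
exact: integrableZl.
Qed.

Lemma Rintegrable_measurable D f : rI D f -> measurable_fun D f.
Proof. by move=> /integrableP[/measurable_EFinP]. Qed.

Lemma continuous_Rintegrable s t f : continuous f -> rI `[s, t] f.
Proof.
move=> cf; apply: continuous_compact_integrable; first exact: segment_compact.
exact: continuous_subspaceT.
Qed.

Lemma Rintegral_itv_cst s t (k : R) : s <= t -> RI `[s, t] (fun=> k) = k * (t - s).
Proof.
move=> st; rewrite Rintegral_cst //= lebesgue_measure_itv /= lte_fin.
case: ltP => // ts; have -> : s = t by apply/eqP; rewrite eq_le st ts.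
by rewrite subrr /= .
Qed.

Lemma cst_Rintegrable s t (k : R) : rI `[s, t] (fun=> k).
Proof. by apply: continuous_Rintegrable => x; exact: cvg_cst. Qed.

Lemma measurable_cmod D F :
  measurable_fun D (Re \o F) -> measurable_fun D (Im \o F) ->
  measurable_fun D (fun x => cmod (F x)).
Proof.
move=> mr mi.
have -> : (fun x => cmod (F x)) =
  (fun x => Num.sqrt ((Re \o F) x ^+ 2 + (Im \o F) x ^+ 2)).
  by apply/funext => x /=; case: (F x).
apply: (measurableT_comp (f := @Num.sqrt R)).
  by apply: continuous_measurable_fun => x; exact: sqrt_continuous.
by apply: measurable_funD; exact: measurable_funX.
Qed.

Lemma cintegrable_measurable D F : cintegrable D F ->
  measurable_fun D (Re \o F) /\ measurable_fun D (Im \o F).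
Proof. by move=> [/Rintegrable_measurable ? /Rintegrable_measurable ?]. Qed.

Lemma cintegrable_cmod D F : measurable D -> cintegrable D F ->
  rI D (fun x => cmod (F x)).
Proof.
move=> mD FI; have [mr mi] := cintegrable_measurable FI; case: FI => ri ii.
apply: (@le_Rintegrable _ _ (fun x => `|Re (F x)| + `|Im (F x)|)) => //.
- exact: measurable_cmod.
- by move=> x _; rewrite ger0_norm ?cmod_ge0 // cmod_le_ReIm.
- by apply: RintegrableD => //; exact: integrable_norm.
Qed.

Lemma cintegrable_le D F g : measurable D ->
  measurable_fun D (Re \o F) -> measurable_fun D (Im \o F) ->
  (forall x, D x -> cmod (F x) <= g x) -> rI D g -> cintegrable D F.
Proof.
move=> mD mr mi Fg gi; split; apply: (@le_Rintegrable _ _ g) => // x Dx.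
- exact: le_trans (ler_Re_cmod _) (Fg _ Dx).
- exact: le_trans (ler_Im_cmod _) (Fg _ Dx).
Qed.

Lemma eq_cintegral D F G : {in D, F =1 G} -> cintegral D F = cintegral D G.
Proof. by move=> FG; congr (_ +i* _)%C; apply: eq_Rintegral => x /FG ->. Qed.

Lemma cintegrableD D F G : measurable D ->
  cintegrable D F -> cintegrable D G -> cintegrable D (fun x => F x + G x).
Proof.
move=> mD [a b] [c d]; split.
- rewrite (_ : (fun x => _) = EFin \o ((Re \o F) \+ (Re \o G))); first exact: RintegrableD.
  by apply/funext => x /=; rewrite ReD.
- rewrite (_ : (fun x => _) = EFin \o ((Im \o F) \+ (Im \o G))); first exact: RintegrableD.
  by apply/funext => x /=; rewrite ImD.
Qed.

Lemma cintegralD D F G : measurable D ->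
  cintegrable D F -> cintegrable D G ->
  cintegral D (fun x => F x + G x) = cintegral D F + cintegral D G.
Proof.
move=> mD [a b] [c d]; apply: complex_eqP; rewrite ?ReD ?ImD /= -RintegralD //.
- by apply: eq_Rintegral => x _; rewrite ReD.
- by apply: eq_Rintegral => x _; rewrite ImD.
Qed.

Lemma cintegrableZ D F (k : C) : measurable D ->
  cintegrable D F -> cintegrable D (fun x => k * F x).
Proof.
move=> mD [a b]; split.
- rewrite (_ : (fun x => _) = EFin \o
    ((fun x => Re k * (Re \o F) x) \- (fun x => Im k * (Im \o F) x))).
    by apply: RintegrableB => //; exact: RintegrableZl.
  by apply/funext => x /=; rewrite ReM.
- rewrite (_ : (fun x => _) = EFin \o
    ((fun x => Re k * (Im \o F) x) \+ (fun x => Im k * (Re \o F) x))).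
    by apply: RintegrableD => //; exact: RintegrableZl.
  by apply/funext => x /=; rewrite ImM.
Qed.

Lemma cintegralZ D F (k : C) : measurable D -> cintegrable D F ->
  cintegral D (fun x => k * F x) = k * cintegral D F.
Proof.
move=> mD [a b]; apply: complex_eqP; rewrite ?ReM ?ImM /= -!RintegralZl //.
- rewrite -RintegralB //; try exact: RintegrableZl.
  by apply: eq_Rintegral => x _; rewrite ReM.
- rewrite -RintegralD //; try exact: RintegrableZl.
  by apply: eq_Rintegral => x _; rewrite ImM.
Qed.

Lemma cintegrableB D F G : measurable D ->
  cintegrable D F -> cintegrable D G -> cintegrable D (fun x => F x - G x).
Proof.
move=> mD FI GI; rewrite (_ : (fun x => _) = (fun x => F x + (-1) * G x)); last first.
  by apply/funext => x; rewrite mulN1r.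
by apply: cintegrableD => //; exact: cintegrableZ.
Qed.

Lemma cintegralB D F G : measurable D ->
  cintegrable D F -> cintegrable D G ->
  cintegral D (fun x => F x - G x) = cintegral D F - cintegral D G.
Proof.
move=> mD FI GI; rewrite -(mulN1r (cintegral D G)) -cintegralZ // -cintegralD //; last exact: cintegrableZ.
by apply: eq_cintegral => x _; rewrite mulN1r.
Qed.

Lemma cintegrable0 D : cintegrable D (fun=> 0).
Proof. by split; exact: integrable0. Qed.

Lemma cintegral0 D : cintegral D (fun=> 0) = 0.
Proof.
by apply: complex_eqP => /=; rewrite /Rintegral integral0.
Qed.

Lemma cintegrable_sum D (I : Type) (s : seq I) (P : pred I) (F : I -> R -> C) :
  measurable D -> (forall i, P i -> cintegrable D (F i)) ->
  cintegrable D (fun x => \sum_(i <- s | P i) F i x).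
Proof.
move=> mD FI; elim: s => [|i s IH].
  by rewrite (_ : (fun x => _) = (fun=> 0)); [exact: cintegrable0|apply/funext => x; rewrite big_nil].
case Pi: (P i); last first.
  by rewrite (_ : (fun x => _) = (fun x => \sum_(i <- s | P i) F i x)) //; apply/funext => x; rewrite big_cons Pi.
rewrite (_ : (fun x => _) = (fun x => F i x + \sum_(i <- s | P i) F i x)).
  by apply: cintegrableD => //; exact: FI.
by apply/funext => x; rewrite big_cons Pi.
Qed.

Lemma cintegral_sum D (I : Type) (s : seq I) (P : pred I) (F : I -> R -> C) :
  measurable D -> (forall i, P i -> cintegrable D (F i)) ->
  cintegral D (fun x => \sum_(i <- s | P i) F i x) =
  \sum_(i <- s | P i) cintegral D (F i).
Proof.
move=> mD FI; elim: s => [|i s IH].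
  rewrite big_nil; transitivity (cintegral D (fun=> 0)); last exact: cintegral0.
  by apply: eq_cintegral => x _; rewrite big_nil.
rewrite big_cons -IH; case: ifP => Pi.
  rewrite -cintegralD //; last by apply: cintegrable_sum.
    by apply: eq_cintegral => x _; rewrite big_cons Pi.
  exact: FI.
by apply: eq_cintegral => x _; rewrite big_cons Pi.
Qed.

Lemma cintegral_cst s t (k : C) : s <= t ->
  cintegral `[s, t] (fun=> k) = k * (t - s)%:C%C.
Proof.
by move=> st; apply: complex_eqP; rewrite ?ReM ?ImM /= Rintegral_itv_cst //; ring.
Qed.

Lemma cintegrable_cst s t (k : C) : cintegrable `[s, t] (fun=> k).
Proof. by split; exact: cst_Rintegrable. Qed.

(** A unit [u] that makes the integral real and nonnegative reduces the claim to the real integral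
    of [Re (u * F)]. *)
Lemma cmod_cintegral_le D F : measurable D -> cintegrable D F ->
  cmod (cintegral D F) <= RI D (fun x => cmod (F x)).
Proof.
move=> mD FI; have [u u1 <-] := exists_unit_multiplier (cintegral D F).
rewrite -cintegralZ //=; apply: le_Rintegral => //.
- by have [] := cintegrableZ u mD FI.
- exact: cintegrable_cmod.
- move=> x _; apply: le_trans (ler_norm _) _; apply: le_trans (ler_Re_cmod _) _.
  by rewrite cmodM u1 mul1r.
Qed.

Lemma measurable_Re_mul D F G :
  measurable_fun D (Re \o F) -> measurable_fun D (Im \o F) ->
  measurable_fun D (Re \o G) -> measurable_fun D (Im \o G) ->
  measurable_fun D (Re \o (fun x => F x * G x)) /\
  measurable_fun D (Im \o (fun x => F x * G x)).
Proof.
move=> a b c d; split.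
- rewrite (_ : _ \o _ = (Re \o F) \* (Re \o G) \- (Im \o F) \* (Im \o G)).
    by apply: measurable_funB; exact: measurable_funM.
  by apply/funext => x /=; rewrite ReM.
- rewrite (_ : _ \o _ = (Re \o F) \* (Im \o G) \+ (Im \o F) \* (Re \o G)).
    by apply: measurable_funD; exact: measurable_funM.
  by apply/funext => x /=; rewrite ImM.
Qed.

Lemma cintegrableM_bounded D F G (M : R) : measurable D ->
  measurable_fun D (Re \o F) -> measurable_fun D (Im \o F) ->
  (forall x, D x -> cmod (F x) <= M) -> cintegrable D G ->
  cintegrable D (fun x => F x * G x).
Proof.
move=> mD a b FM GI; have [c d] := cintegrable_measurable GI.
have [e f] := measurable_Re_mul a b c d.
apply: (cintegrable_le mD e f (g := fun x => M * cmod (G x))).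
- by move=> x Dx; rewrite cmodM ler_wpM2r ?cmod_ge0 // FM.
- by apply: RintegrableZl => //; exact: cintegrable_cmod.
Qed.

(** Stated on the parts so that integrability of real continuous functions applies to each;
    [ccontinuousP] is the form with the modulus. *)
Definition ccontinuous F := continuous (Re \o F) /\ continuous (Im \o F).

Lemma ccontinuous_measurable D F : measurable D -> ccontinuous F ->
  measurable_fun D (Re \o F) /\ measurable_fun D (Im \o F).
Proof.
move=> mD [a b]; split.
- exact: (measurable_funS measurableT (@subsetT _ _) (continuous_measurable_fun a)).
- exact: (measurable_funS measurableT (@subsetT _ _) (continuous_measurable_fun b)).
Qed.

Lemma ccontinuous_cintegrable s t F : ccontinuous F -> cintegrable `[s, t] F.
Proof. by move=> [a b]; split; exact: continuous_Rintegrable. Qed.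

Lemma ccontinuous_cst (k : C) : ccontinuous (fun=> k).
Proof. by split => x; exact: cvg_cst. Qed.

Lemma ccontinuousD F G : ccontinuous F -> ccontinuous G ->
  ccontinuous (fun x => F x + G x).
Proof.
move=> [a b] [c d]; split.
- rewrite (_ : _ \o _ = (Re \o F) \+ (Re \o G)); last by apply/funext => x /=; rewrite ReD.
  by move=> x; apply: cvgD; [exact: a|exact: c].
- rewrite (_ : _ \o _ = (Im \o F) \+ (Im \o G)); last by apply/funext => x /=; rewrite ImD.
  by move=> x; apply: cvgD; [exact: b|exact: d].
Qed.

Lemma ccontinuousM F G : ccontinuous F -> ccontinuous G ->
  ccontinuous (fun x => F x * G x).
Proof.
move=> [a b] [c d]; split.
- rewrite (_ : _ \o _ = (Re \o F) \* (Re \o G) \- (Im \o F) \* (Im \o G)); last first.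
    by apply/funext => x /=; rewrite ReM.
  move=> x; apply: cvgB; apply: cvgM; [exact: a|exact: c|exact: b|exact: d].
- rewrite (_ : _ \o _ = (Re \o F) \* (Im \o G) \+ (Im \o F) \* (Re \o G)); last first.
    by apply/funext => x /=; rewrite ImM.
  move=> x; apply: cvgD; apply: cvgM; [exact: a|exact: d|exact: b|exact: c].
Qed.

Lemma ccontinuousB F G : ccontinuous F -> ccontinuous G ->
  ccontinuous (fun x => F x - G x).
Proof.
move=> a b; rewrite (_ : (fun x => _) = (fun x => F x + (-1) * G x)); last first.
  by apply/funext => x; rewrite mulN1r.
by apply: ccontinuousD => //; apply: ccontinuousM => //; exact: ccontinuous_cst.
Qed.

Lemma ccontinuous_sum (I : Type) (s : seq I) (P : pred I) (F : I -> R -> C) :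
  (forall i, P i -> ccontinuous (F i)) ->
  ccontinuous (fun x => \sum_(i <- s | P i) F i x).
Proof.
move=> FI; elim: s => [|i s IH].
  by rewrite (_ : (fun x => _) = (fun=> 0)); [exact: ccontinuous_cst|apply/funext => x; rewrite big_nil].
case Pi: (P i); last first.
  by rewrite (_ : (fun x => _) = (fun x => \sum_(i <- s | P i) F i x)) //; apply/funext => x; rewrite big_cons Pi.
rewrite (_ : (fun x => _) = (fun x => F i x + \sum_(i <- s | P i) F i x)).
  by apply: ccontinuousD => //; exact: FI.
by apply/funext => x; rewrite big_cons Pi.
Qed.

Lemma ccontinuousP F : ccontinuous F <->
  forall x (e : R), 0 < e -> \forall y \near x, cmod (F x - F y) < e.
Proof.
split=> [[a b] x e e0|h].
  have e2 : 0 < e / 2 by rewrite divr_gt0.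
  have /cvgrPdist_lt/(_ _ e2) ha := a x; have /cvgrPdist_lt/(_ _ e2) hb := b x.
  near=> y; apply: le_lt_trans (cmod_le_ReIm _) _.
  rewrite ReB ImB [e]splitr ltrD //; first by near: y.
  by near: y.
split=> x; apply/cvgrPdist_lt => e e0; apply: filterS (h x e e0) => y hy /=.
- by rewrite -ReB (le_lt_trans (ler_Re_cmod _)).
- by rewrite -ImB (le_lt_trans (ler_Im_cmod _)).
Unshelve. all: by end_near. Qed.

Lemma ccontinuous_e1M (k : R) : ccontinuous (fun x => e1 (k * x)).
Proof.
apply/ccontinuousP => x e e0; near=> y.
apply: le_lt_trans (cmod_e1B _ _) _; rewrite -mulrBr normrM mulrA.
have k0 : 0 < 16 * `|k| + 1 by have := normr_ge0 k; lra.
apply: (@le_lt_trans _ _ ((16 * `|k| + 1) * `|x - y|)).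
  by rewrite ler_wpM2r // lerDl.
rewrite mulrC -ltr_pdivlMr //; near: y.
by apply: cvgr_dist_lt => //; rewrite divr_gt0.
Unshelve. all: by end_near. Qed.

Lemma ccontinuous_e1 : ccontinuous (@e1 R).
Proof.
rewrite (_ : e1 = (fun x => e1 (1 * x))); first exact: ccontinuous_e1M.
by apply/funext => x; rewrite mul1r.
Qed.

Lemma ccontinuous_cmod F : ccontinuous F -> continuous (fun x => cmod (F x)).
Proof.
move=> /ccontinuousP cF x; apply/cvgrPdist_lt => e e0; apply: filterS (cF x e e0) => y.
apply: le_lt_trans; rewrite ler_norml; apply/andP; split.
  by have := cmodD (F y - F x) (F x); rewrite subrK cmod_distrC; lra.
by have := cmodD (F x - F y) (F y); rewrite subrK; lra.
Qed.

End ComplexIntegrals.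

(** * Orthogonality, Parseval and Bessel for trigonometric sums *)

Section TrigonometricSums.
Local Open Scope classical_set_scope.
Local Open Scope ring_scope.
Context {R : realType}.
Local Notation C := (R[i]).
Local Notation mu := (@lebesgue_measure R).
Local Notation Re := (@complex.Re R).
Local Notation RI D f := (Rintegral mu D f).
Local Notation rI D f := (mu.-integrable D (EFin \o f)).

Definition echar (k : int) (x : R) : C := e1 (k%:~R * x).

Lemma echarD k l x : echar (k + l) x = echar k x * echar l x.
Proof. by rewrite /echar intrD mulrDl e1D. Qed.

Lemma echarN k x : echar (- k) x = (echar k x)^*%C.
Proof. by rewrite /echar mulrNz mulNr e1N. Qed.

Lemma echar0 x : echar 0 x = 1.
Proof. by rewrite /echar mul0r e10. Qed.

Lemma cmod_echar k x : cmod (echar k x) = 1.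
Proof. exact: cmod_e1. Qed.

Lemma ccontinuous_echar k : ccontinuous (echar k).
Proof. exact: ccontinuous_e1M. Qed.

Lemma echar_nat (n : nat) x : echar n x = e1 x ^+ n.
Proof. by rewrite /echar -e1_natM. Qed.

Lemma Rintegral_derive (f F : R -> R) s t : s < t -> continuous f ->
  (forall x, is_derive x (1 : R) F (f x)) -> RI `[s, t] f = F t - F s.
Proof.
move=> st cf dF.
have cF x : {for x, continuous F}.
  apply: differentiable_continuous; apply/derivable1_diffP.
  by have [] := dF x.
rewrite /Rintegral (@continuous_FTC2 _ f F) //.
- exact: continuous_subspaceT.
- split => [x _||]; first by have [] := dF x.
  + apply: cvg_at_right_filter; exact: cF.
  + apply: cvg_at_left_filter; exact: cF.
- by move=> x _; rewrite derive1E; have [] := dF x.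
Qed.

Lemma cintegral_echar k s : cintegral `[s, s + 1] (echar k) = (k == 0)%:R.
Proof.
have [->|k0] := eqVneq k 0.
  rewrite (@eq_cintegral _ _ _ (fun=> 1)) => [|x _]; last exact: echar0.
  by rewrite cintegral_cst ?lerDl // addrAC subrr add0r mul1r.
pose c : R := 2 * pi * k%:~R.
have c0 : c != 0.
  by rewrite !mulf_neq0 ?intr_eq0 ?pnatr_eq0 // gt_eqF // pi_gt0.
have eE x : echar k x = (cos (c * x) +i* sin (c * x))%C.
  by rewrite /echar /e1 /cexp /c mulrA.
have per : echar k (s + 1) = echar k s by exact: e1_intM_periodic.
have : complex.Re (echar k (s + 1)) = complex.Re (echar k s) by rewrite per.
have : complex.Im (echar k (s + 1)) = complex.Im (echar k s) by rewrite per.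
rewrite !eE /= => hs hc.
have ss : s < s + 1 by rewrite ltrDl.
have cl x : {for x, continuous (fun y : R => c * y)}.
  by apply: cvgM; [exact: cvg_cst|exact: cvg_id].
apply: complex_eqP => /=.
- transitivity (RI `[s, s + 1] (fun x => cos (c * x))).
    by apply: eq_Rintegral => x _; rewrite -[RHS]/(complex.Re (cos (c * x) +i* sin (c * x))%C) -eE.
  have cf : continuous (fun x : R => cos (c * x)).
    by move=> x; apply: continuous_comp; [exact: cl|exact: continuous_cos].
  have dF x : is_derive x (1 : R) (fun x => c^-1 * sin (c * x)) (cos (c * x)).
    apply: is_derive_eq; rewrite /GRing.scale /=; field.
    exact: c0.
  by rewrite (Rintegral_derive ss cf dF) hs subrr.
- transitivity (RI `[s, s + 1] (fun x => sin (c * x))).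
    by apply: eq_Rintegral => x _; rewrite -[RHS]/(complex.Im (cos (c * x) +i* sin (c * x))%C) -eE.
  have cf : continuous (fun x : R => sin (c * x)).
    by move=> x; apply: continuous_comp; [exact: cl|exact: continuous_sin].
  have dF x : is_derive x (1 : R) (fun x => - c^-1 * cos (c * x)) (sin (c * x)).
    apply: is_derive_eq; rewrite /GRing.scale /=; field.
    exact: c0.
  by rewrite (Rintegral_derive ss cf dF) hc subrr.
Qed.

Definition trigsum (I : Type) (r : seq I) (kappa : I -> int) (c : I -> C) (x : R) : C :=
  \sum_(i <- r) c i * echar (kappa i) x.

Lemma ccontinuous_trigsum I r kappa c : ccontinuous (@trigsum I r kappa c).
Proof.
apply: ccontinuous_sum => i _; apply: ccontinuousM; first exact: ccontinuous_cst.
exact: ccontinuous_echar.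
Qed.

Lemma cintegral_trigsum_echar (I : eqType) (r : seq I) (kappa : I -> int) c (l : int) s :
  cintegral `[s, s + 1] (fun x => trigsum r kappa c x * echar (- l) x) =
  \sum_(i <- r | kappa i == l) c i.
Proof.
rewrite (@eq_cintegral _ _ _ (fun x => \sum_(i <- r) c i * echar (kappa i - l) x)) => [|x _]; last first.
  by rewrite mulr_suml; apply: eq_bigr => i _; rewrite echarD mulrA.
have ci i : cintegrable `[s, s + 1] (fun x => echar (kappa i - l) x).
  by apply: ccontinuous_cintegrable; exact: ccontinuous_echar.
rewrite cintegral_sum //; last by move=> i _; exact: cintegrableZ.
rewrite [RHS]big_mkcond; apply: eq_bigr => i _.
rewrite cintegralZ // cintegral_echar subr_eq0.
by case: eqVneq => _; rewrite ?mulr1 ?mulr0.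
Qed.

Lemma Rintegral_Re D (F : R -> C) : RI D (fun x => Re (F x)) = Re (cintegral D F).
Proof. by []. Qed.

Lemma cmod_sqr_Re (z : C) : cmod z ^+ 2 = Re (z * z^*%C).
Proof. by rewrite mul_conjc. Qed.

Lemma continuous_cmod_sqr (F : R -> C) : ccontinuous F -> continuous (fun x => cmod (F x) ^+ 2).
Proof.
move=> cF x.
rewrite (_ : (fun _ => _) = (fun x => cmod (F x) * cmod (F x))); last by apply/funext.
by apply: cvgM; exact: ccontinuous_cmod.
Qed.

Lemma trigsum_parseval (I : eqType) (r : seq I) (kappa : I -> int) c s :
  uniq r -> {in r &, injective kappa} ->
  RI `[s, s + 1] (fun x => cmod (trigsum r kappa c x) ^+ 2) =
  \sum_(i <- r) cmod (c i) ^+ 2.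
Proof.
move=> ur ik; set T := trigsum r kappa c.
have cT : ccontinuous T by exact: ccontinuous_trigsum.
have TE x : T x * (T x)^*%C = \sum_(i <- r) (c i)^*%C * (T x * echar (- kappa i) x).
  rewrite {2}/T /trigsum conjc_sum mulr_sumr; apply: eq_bigr => i _.
  by rewrite conjcM -echarN; ring.
have ci i : cintegrable `[s, s + 1] (fun x => T x * echar (- kappa i) x).
  apply: ccontinuous_cintegrable; apply: ccontinuousM => //; exact: ccontinuous_echar.
transitivity (Re (cintegral `[s, s + 1] (fun x => \sum_(i <- r) (c i)^*%C * (T x * echar (- kappa i) x)))).
  by apply: eq_Rintegral => x _; rewrite cmod_sqr_Re TE.
rewrite cintegral_sum //; last by move=> i _; exact: cintegrableZ.
rewrite Re_sum; apply: eq_big_seq => i ir.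
rewrite cintegralZ // cintegral_trigsum_echar cmod_sqr_Re mulrC; congr (Re (_ * _)).
rewrite big_mkcond (bigD1_seq i) //= eqxx big_seq_cond big1 ?addr0 // => j /andP[jr ji].
case: eqP => // kj; by move: ji; rewrite (ik _ _ jr ir kj) eqxx.
Qed.

(** Expand [cmod (F - T) ^+ 2 >= 0], where [T] has the coefficients [phi i]. The cross term is
    exactly the sum of squares, and the square of [T] over [[s, t]] is at most its Parseval value
    over a full period, which is where [t <= s + 1] enters. *)
Lemma trigsum_bessel (I : eqType) (r : seq I) (kappa : I -> int) (F : R -> C) s t :
  uniq r -> {in r &, injective kappa} -> s <= t <= s + 1 -> ccontinuous F ->
  \sum_(i <- r) cmod (cintegral `[s, t] (fun x => F x * echar (- kappa i) x)) ^+ 2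
  <= RI `[s, t] (fun x => cmod (F x) ^+ 2).
Proof.
move=> ur ik /andP[st ts] cF.
pose phi i := cintegral `[s, t] (fun x => F x * echar (- kappa i) x).
pose T := trigsum r kappa phi.
have cT : ccontinuous T by exact: ccontinuous_trigsum.
have ci i : cintegrable `[s, t] (fun x => F x * echar (- kappa i) x).
  apply: ccontinuous_cintegrable; apply: ccontinuousM => //; exact: ccontinuous_echar.
have FTE x : F x * (T x)^*%C = \sum_(i <- r) (phi i)^*%C * (F x * echar (- kappa i) x).
  rewrite /T /trigsum conjc_sum mulr_sumr; apply: eq_bigr => i _.
  by rewrite conjcM -echarN; ring.
have crossE : cintegral `[s, t] (fun x => F x * (T x)^*%C) = (\sum_(i <- r) cmod (phi i) ^+ 2)%:C%C.
  rewrite (@eq_cintegral _ _ _ (fun x => \sum_(i <- r) (phi i)^*%C * (F x * echar (- kappa i) x))) => [|x _]; last exact: FTE.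
  rewrite cintegral_sum //; last by move=> i _; exact: cintegrableZ.
  rewrite rmorph_sum; apply: eq_bigr => i _.
  by rewrite cintegralZ // mulrC mul_conjc.
have crossI : cintegrable `[s, t] (fun x => F x * (T x)^*%C).
  rewrite (_ : (fun x => _) = (fun x => \sum_(i <- r) (phi i)^*%C * (F x * echar (- kappa i) x))); last first.
    by apply/funext => x; exact: FTE.
  by apply: cintegrable_sum => // i _; exact: cintegrableZ.
have cF2 := continuous_cmod_sqr cF; have cT2 := continuous_cmod_sqr cT.
have F2 : rI `[s, t] (fun x => cmod (F x) ^+ 2) by exact: continuous_Rintegrable.
have T2 : rI `[s, t] (fun x => cmod (T x) ^+ 2) by exact: continuous_Rintegrable.
have XI : rI `[s, t] (fun x => 2 * Re (F x * (T x)^*%C)).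
  by apply: (@RintegrableZl _ _ (fun x => Re (F x * (T x)^*%C))) => //; case: crossI.
have TS : RI `[s, t] (fun x => cmod (T x) ^+ 2) <= \sum_(i <- r) cmod (phi i) ^+ 2.
  rewrite -(trigsum_parseval phi s ur ik) -lee_fin -!EFin_Rintegral //; last first.
    by apply: continuous_Rintegrable => //.
  apply: ge0_subset_integral => //=.
  - by apply/measurable_EFinP; exact: measurable_funS (continuous_measurable_fun cT2).
  - by move=> x _; rewrite lee_fin sqr_ge0.
  - by move=> x /=; rewrite !in_itv /= => /andP[-> /le_trans -> //].
have FTge0 : 0 <= RI `[s, t] (fun x => cmod (F x - T x) ^+ 2).
  by apply: Rintegral_ge0 => x _; rewrite sqr_ge0.
have FTE2 : RI `[s, t] (fun x => cmod (F x - T x) ^+ 2) =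
    RI `[s, t] (fun x => (cmod (F x) ^+ 2 - 2 * Re (F x * (T x)^*%C)) + cmod (T x) ^+ 2).
  apply: eq_Rintegral => x _.
  by rewrite !cmod_sqr; case: (F x) => a b; case: (T x) => c d /=; ring.
move: FTge0; rewrite FTE2 RintegralD //; last exact: (RintegrableB _ F2 XI).
rewrite RintegralB // RintegralZl //; last by case: crossI.
rewrite Rintegral_Re crossE /=.
move: TS; rewrite /phi; lra.
Qed.

End TrigonometricSums.

(** * Large sieve inequality and oscillation of lacunary partial sums *)

Section LacunarySumsBMO.
Local Open Scope classical_set_scope.
Local Open Scope ring_scope.
Context {R : realType}.
Local Notation C := (R[i]).
Local Notation mu := (@lebesgue_measure R).
Local Notation Re := (@complex.Re R).
Local Notation RI D f := (Rintegral mu D f).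
Local Notation rI D f := (mu.-integrable D (EFin \o f)).

Lemma sum_sqr_le (h : nat) (x : nat -> R) :
  (\sum_(0 <= l < h) x l) ^+ 2 <= h%:R * \sum_(0 <= l < h) x l ^+ 2.
Proof.
rewrite expr2 mulr_suml.
apply: (@le_trans _ _ (\sum_(0 <= i < h) \sum_(0 <= j < h) (x i ^+ 2 + x j ^+ 2) / 2)).
  apply: ler_sum => i _; rewrite mulr_sumr; apply: ler_sum => j _.
  by have := sqr_ge0 (x i - x j); lra.
under eq_bigr do rewrite -mulr_suml big_split /= sumr_const_nat subn0.
rewrite -mulr_suml big_split /= sumr_const_nat subn0.
under eq_bigr do rewrite -mulr_natl.
by rewrite -mulr_sumr -mulr_natl; lra.
Qed.

(** The difference of the sides is [(k z - q y) ^+ 2 / (2 k q)]. The parameter [k] decides how much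
    weight falls on each square. *)
Lemma weighted_amgm (k q y z : R) : 0 < k -> 0 < q ->
  z * y <= k / 2 * (z ^+ 2 / q) + q * y ^+ 2 / (2 * k).
Proof.
move=> k0 q0.
have -> : k / 2 * (z ^+ 2 / q) + q * y ^+ 2 / (2 * k) =
    z * y + (k * z - q * y) ^+ 2 / (2 * k * q).
  by field; rewrite !gt_eqF.
by rewrite lerDl divr_ge0 ?sqr_ge0 // !mulr_ge0 // ltW.
Qed.

Lemma sum_disjoint_blocks (nu h : nat -> nat) (w : nat -> R) (N J : nat) :
  (forall k, 0 <= w k) -> (forall n, (nu n + h n <= nu n.+1)%N) -> (N <= J)%N ->
  \sum_(N <= n < J) \sum_(0 <= i < h n) w (nu n + i)%N <= \sum_(nu N <= k < nu J) w k.
Proof.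
move=> w0 hn NJ; rewrite -(subnKC NJ); elim: (J - N)%N => [|d IH].
  by rewrite addn0 !big_geq.
have mono i : (nu N <= nu (N + i))%N.
  elim: i => [|i hi]; first by rewrite addn0.
  by rewrite addnS (leq_trans hi) // (leq_trans _ (hn _)) // leq_addr.
rewrite addnS big_nat_recr ?leq_addr //=.
have le1 : (nu (N + d) <= nu (N + d).+1)%N by rewrite (leq_trans _ (hn _)) // leq_addr.
rewrite (big_cat_nat (mono d) le1) /= lerD //.
have le2 : (nu (N + d) <= nu (N + d) + h (N + d))%N by rewrite leq_addr.
rewrite (big_cat_nat le2 (hn _)) /= -[leLHS]addr0 lerD //; last exact: sumr_ge0.
rewrite -{2}[nu (N + d)%N]add0n big_addn addKn.
by apply: ler_sum => i _; rewrite addnC.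
Qed.

(** The coefficient at [nu n] is compared with those on the block of [h n] integers starting there.
    Consecutive coefficients of [F] differ by a coefficient of [G], and
    [cmod G <= 16 * (t - s) * cmod F] on the interval. The blocks are disjoint, so Bessel bounds the
    contributions of [F] and of [G]. As [m * (t - s) <= 1], the constant is
    [2 + 2 * 16 ^+ 2 = 514]. *)
Lemma gallagher_inequality (nu h : nat -> nat) (m : nat) (F : R -> C) (s t : R) (N J : nat) :
  (forall n, (nu n + h n <= nu n.+1)%N) -> (forall n, (h n <= m)%N) ->
  s < t -> t <= s + 1 -> m%:R * (t - s) <= 1 -> ccontinuous F -> (N <= J)%N ->
  \sum_(N <= n < J) (h n)%:R * cmod (cintegral `[s, t] (fun x => F x * echar (- (nu n)%:Z) x)) ^+ 2
  <= 514 * RI `[s, t] (fun x => cmod (F x) ^+ 2).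
Proof.
move=> hn hm st ts mL cF NJ.
pose psi (G : R -> C) (k : nat) := cintegral `[s, t] (fun x => G x * echar (- k%:Z) x).
(* Phases measured from [s], so that [1 - echar (-1) (x - s)] is small on [[s, t]]; the moduli of
   the coefficients do not change. *)
pose phi (G : R -> C) (k : nat) := cintegral `[s, t] (fun x => G x * echar (- k%:Z) (x - s)).
have cs (k : int) : ccontinuous (fun x => echar k (x - s)).
  rewrite (_ : (fun x => _) = (fun x => echar k (- s) * echar k x)).
    by apply: ccontinuousM; [exact: ccontinuous_cst|exact: ccontinuous_echar].
  by apply/funext => x; rewrite /echar -e1D; congr e1; ring.
have phi_psi G k : ccontinuous G -> cmod (phi G k) = cmod (psi G k).
  move=> cG; rewrite /phi (@eq_cintegral _ _ _ (fun x => echar (- k%:Z) (- s) * (G x * echar (- k%:Z) x))).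
    rewrite cintegralZ ?cmodM ?cmod_echar ?mul1r //.
    by apply: ccontinuous_cintegrable; apply: ccontinuousM => //; exact: ccontinuous_echar.
  move=> x _; rewrite mulrCA; congr (_ * _); rewrite /echar -e1D; congr e1; ring.
have bessel G K1 K2 : ccontinuous G ->
    \sum_(K1 <= k < K2) cmod (phi G k) ^+ 2 <= RI `[s, t] (fun x => cmod (G x) ^+ 2).
  move=> cG; under eq_bigr do rewrite phi_psi //.
  apply: (@trigsum_bessel _ _ (index_iota K1 K2) (fun k : nat => k%:Z)) => //.
  - exact: iota_uniq.
  - by move=> i j _ _ [].
  - by rewrite ltW.
pose G x := F x * (1 - echar (-1) (x - s)).
have cG : ccontinuous G.
  apply: ccontinuousM => //; apply: ccontinuousB; [exact: ccontinuous_cst|exact: cs].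
have phiI k : cintegrable `[s, t] (fun x => F x * echar (- k%:Z) (x - s)).
  by apply: ccontinuous_cintegrable; apply: ccontinuousM => //; exact: cs.
have delta k : phi F k - phi F k.+1 = phi G k.
  rewrite /phi -cintegralB //; apply: eq_cintegral => x _.
  have -> : - k.+1%:Z = -1 + - k%:Z by lia.
  by rewrite echarD /G; ring.
have G2 : RI `[s, t] (fun x => cmod (G x) ^+ 2) <= (16 * (t - s)) ^+ 2 * RI `[s, t] (fun x => cmod (F x) ^+ 2).
  have c2 := continuous_cmod_sqr cF; have c3 := continuous_cmod_sqr cG.
  rewrite -RintegralZl //; last exact: continuous_Rintegrable.
  apply: le_Rintegral => //.
  - exact: continuous_Rintegrable.
  - by apply: RintegrableZl => //; exact: continuous_Rintegrable.
  - move=> x /=; rewrite in_itv /= => /andP[sx xt].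
    rewrite cmodM exprMn mulrC ler_wpM2r ?sqr_ge0 // ler_sqr ?nnegrE ?cmod_ge0 //; last first.
      by rewrite mulr_ge0 // subr_ge0 ltW.
    rewrite -(echar0 (x - s)) /echar (le_trans (cmod_e1B _ _)) // ler_wpM2l //.
    by rewrite mul0r sub0r mulrNz mulN1r opprK ger0_norm; lra.
have tele i k : phi F k - phi F (k + i)%N = \sum_(0 <= l < i) phi G (k + l)%N.
  elim: i => [|i IH]; first by rewrite addn0 subrr big_geq.
  by rewrite big_nat_recr //= -IH -delta addnS; ring.
have pointwise n : (h n)%:R * cmod (psi F (nu n)) ^+ 2 <=
    2 * \sum_(0 <= i < h n) cmod (phi F (nu n + i)%N) ^+ 2 +
    2 * m%:R ^+ 2 * \sum_(0 <= l < h n) cmod (phi G (nu n + l)%N) ^+ 2.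
  rewrite -phi_psi //; set D := \sum_(0 <= l < h n) cmod (phi G _) ^+ 2.
  have D0 : 0 <= D by rewrite sumr_ge0 // => l _; rewrite sqr_ge0.
  apply: (@le_trans _ _ (\sum_(0 <= i < h n) (2 * cmod (phi F (nu n + i)%N) ^+ 2 + 2 * ((h n)%:R * D)))).
    rewrite mulr_natl -[X in _ *+ X]subn0 -sumr_const_nat big_nat_cond [leRHS]big_nat_cond.
    apply: ler_sum => i; rewrite andbT => /andP[_ ih].
    have E : phi F (nu n) = phi F (nu n + i)%N + \sum_(0 <= l < i) phi G (nu n + l)%N.
      by rewrite -tele; ring.
    have B : cmod (\sum_(0 <= l < i) phi G (nu n + l)%N) <= \sum_(0 <= l < h n) cmod (phi G (nu n + l)%N).
      apply: le_trans (cmod_sum _ _ _) _.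
      by rewrite (big_cat_nat (leq0n i) (ltnW ih)) /= lerDl sumr_ge0 // => l _; exact: cmod_ge0.
    have B2 := sum_sqr_le (h n) (fun l => cmod (phi G (nu n + l)%N)).
    have := cmodD (phi F (nu n + i)%N) (\sum_(0 <= l < i) phi G (nu n + l)%N); rewrite -E.
    have := cmod_ge0 (phi F (nu n)); have := cmod_ge0 (\sum_(0 <= l < i) phi G (nu n + l)%N).
    have := cmod_ge0 (phi F (nu n + i)%N).
    rewrite -/D in B2; move: B B2.
    move: (cmod (phi F (nu n))) (cmod (phi F _)) (cmod (\sum_(0 <= l < i) _)) (\sum_(0 <= l < h n) cmod _) ((h n)%:R * D).
    move=> x y z w v zw wv y0 z0 x0 xyz.
    have h1 : x ^+ 2 <= (y + z) ^+ 2 by rewrite ler_sqr ?nnegrE // addr_ge0.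
    have h2 : z ^+ 2 <= w ^+ 2 by rewrite ler_sqr ?nnegrE // (le_trans z0).
    have := sqr_ge0 (y - z); lra.
  rewrite big_split /= -mulr_sumr lerD // sumr_const_nat subn0 -[_ *+ h n]mulr_natl.
  rewrite (_ : _ * (2 * _) = 2 * (h n)%:R ^+ 2 * D); last by ring.
  by rewrite ler_wpM2r // ler_wpM2l // ler_sqr ?nnegrE // ler_nat.
apply: le_trans (ler_sum _ (fun n _ => pointwise n)) _.
rewrite big_split /= -!mulr_sumr.
have := @sum_disjoint_blocks nu h (fun k => cmod (phi F k) ^+ 2) N J (fun k => sqr_ge0 _) hn NJ.
have := @sum_disjoint_blocks nu h (fun k => cmod (phi G k) ^+ 2) N J (fun k => sqr_ge0 _) hn NJ.
move: G2; have := bessel F (nu N) (nu J) cF; have := bessel G (nu N) (nu J) cG.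
set P1 := \sum_(nu N <= k < nu J) _; set P2 := \sum_(nu N <= k < nu J) _.
set Q1 := \sum_(N <= n < J) _; set Q2 := \sum_(N <= n < J) _.
set I1 := RI _ _; set I2 := RI _ _ => p1 p2 g2 q1 q2.
have I20 : 0 <= I2 by apply: Rintegral_ge0 => x _; rewrite sqr_ge0.
have Q10 : 0 <= Q1 by apply: sumr_ge0 => n _; apply: sumr_ge0 => i _; rewrite sqr_ge0.
have m2 : m%:R ^+ 2 * Q1 <= 256 * I2.
  have h1 : Q1 <= (16 * (t - s)) ^+ 2 * I2 by lra.
  apply: le_trans (ler_wpM2l (sqr_ge0 _) h1) _.
  have -> : m%:R ^+ 2 * ((16 * (t - s)) ^+ 2 * I2) = (m%:R * (t - s)) ^+ 2 * (256 * I2) by ring.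
  rewrite ler_piMl ?mulr_ge0 // expr_le1 // mulr_ge0 // subr_ge0 ltW //.
lra.
Qed.

(** Duality: the integral of [cmod v ^+ 2] is the real part of the sum of [conj (b n) * psi n]. The
    weighted mean inequality splits it into [k / 2] times the sum of [a n ^+ 2 / h n] plus
    [1 / (2 k)] times the Gallagher sum; for [k = 514] the latter is at most half the integral and
    is absorbed. *)
Lemma lacunary_tail_sq (nu : nat -> nat) (a : nat -> R) (b : nat -> C) (s t : R) (N J : nat) :
  (forall n, (nu n < nu n.+1)%N) -> (forall n, (N <= n)%N -> cmod (b n) <= a n) ->
  s < t -> t <= s + 1 -> (N <= J)%N ->
  RI `[s, t] (fun x => cmod (trigsum (index_iota N J) (fun n => (nu n)%:Z) b x) ^+ 2) <=
  514 * (\sum_(N <= n < J) a n ^+ 2 / gap nu n.+1 + 2 * (t - s) * \sum_(N <= n < J) a n ^+ 2).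
Proof.
move=> nu_incr ba st ts NJ; set v := trigsum _ _ _.
have cv : ccontinuous v by exact: ccontinuous_trigsum.
have L0 : 0 < t - s by rewrite subr_gt0.
(* Nearly the longest blocks that Gallagher's inequality allows. With [h n] the smaller of [m] and
   the gap above [nu n], [1 / h n] is at most the inverse gap plus [2 * (t - s)]. *)
pose m := Num.truncn (t - s)^-1.
have /andP[m1 m2] : m%:R <= (t - s)^-1 < m.+1%:R by apply: truncn_itv; rewrite invr_ge0 ltW.
have mL : m%:R * (t - s) <= 1 by rewrite -ler_pdivlMr // div1r.
have m0 : (0 < m)%N.
  rewrite -(ltr_nat R) -(ltrD2r 1) add0r natr1 (le_lt_trans _ m2) // invf_ge1 //; lra.
have m_inv : m%:R^-1 <= 2 * (t - s).
  have mm : 0 < m%:R :> R by rewrite ltr0n.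
  rewrite -[leLHS]div1r ler_pdivrMr //.
  have : 1 <= (m.+1)%:R * (t - s) by rewrite -ler_pdivrMr // div1r ltW.
  have : 1 <= m%:R :> R by rewrite ler1n.
  rewrite -natr1; nra.
pose h n := minn (nu n.+1 - nu n) m.
have h_gt0 n : (0 < h n)%N by rewrite /h leq_min m0 subn_gt0 nu_incr.
have hn n : (nu n + h n <= nu n.+1)%N by rewrite /h; have := nu_incr n; lia.
have hm n : (h n <= m)%N by rewrite geq_minr.
have h_inv n : (h n)%:R^-1 <= (gap nu n.+1)^-1 + 2 * (t - s) :> R.
  have g0 : 0 <= (gap nu n.+1)^-1 :> R by rewrite invr_ge0 /gap subr_ge0 ler_nat ltnW.
  rewrite /h /minn; case: ifP => _; last by apply: le_trans m_inv _; rewrite lerDr.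
  by rewrite (natrB _ (ltnW (nu_incr n))) /gap lerDl mulr_ge0 // ltW.
set K := \sum_(N <= n < J) a n ^+ 2 / gap nu n.+1 + _.
pose psi n := cintegral `[s, t] (fun x => v x * echar (- (nu n)%:Z) x).
have gal := gallagher_inequality hn hm st ts mL cv NJ; rewrite -/(psi _) in gal.
set Iv := RI _ _ in gal *.
have psiI n : cintegrable `[s, t] (fun x => v x * echar (- (nu n)%:Z) x).
  by apply: ccontinuous_cintegrable; apply: ccontinuousM => //; exact: ccontinuous_echar.
have vv x : v x * (v x)^*%C = \sum_(N <= n < J) (b n)^*%C * (v x * echar (- (nu n)%:Z) x).
  rewrite {2}/v /trigsum conjc_sum mulr_sumr; apply: eq_bigr => i _.
  by rewrite conjcM -echarN; ring.
have IvE : Iv = Re (\sum_(N <= n < J) (b n)^*%C * psi n).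
  transitivity (Re (cintegral `[s, t] (fun x => \sum_(N <= n < J) (b n)^*%C * (v x * echar (- (nu n)%:Z) x)))).
    by apply: eq_Rintegral => x _; rewrite cmod_sqr_Re vv.
  rewrite cintegral_sum //; last by move=> i _; exact: cintegrableZ.
  by congr (Re _); apply: eq_bigr => n _; rewrite cintegralZ.
have [k kE] : exists k : R, k = 514 by exists 514.
have k0 : 0 < k by rewrite kE ltr0n.
have Iv_le : Iv <= \sum_(N <= n < J) (k / 2 * (a n ^+ 2 / (h n)%:R) + (h n)%:R * cmod (psi n) ^+ 2 / (2 * k)).
  rewrite IvE; apply: le_trans (ler_norm _) _; apply: le_trans (ler_Re_cmod _) _.
  apply: le_trans (cmod_sum _ _ _) _; rewrite big_nat_cond [leRHS]big_nat_cond.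
  apply: ler_sum => n; rewrite andbT => /andP[Nn _].
  rewrite cmodM cmod_conj.
  have hp : 0 < (h n)%:R :> R by rewrite ltr0n.
  have := ba _ Nn; have := cmod_ge0 (b n); have := cmod_ge0 (psi n).
  move: (cmod (b n)) (cmod (psi n)) (a n) => x y z y0 x0 xz.
  apply: (@le_trans _ _ (z * y)); first by rewrite ler_wpM2r.
  exact: weighted_amgm.
have hK : \sum_(N <= n < J) a n ^+ 2 / (h n)%:R <= K.
  apply: (@le_trans _ _ (\sum_(N <= n < J) (a n ^+ 2 / gap nu n.+1 + a n ^+ 2 * (2 * (t - s))))).
    by apply: ler_sum => n _; rewrite -mulrDr; apply: ler_wpM2l => //; exact: sqr_ge0.
  by rewrite big_split /= -mulr_suml /K [X in _ <= _ + X]mulrC.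
move: Iv_le; rewrite big_split /= -mulr_sumr -mulr_suml => Iv_le.
clearbody K Iv; move: gal hK Iv_le; rewrite kE.
set X := \sum_(N <= n < J) _; set Y := \sum_(N <= n < J) _; clearbody X Y.
move=> h1 h2 h3; lra.
Qed.

(** Frequencies up to [N] vary on [[s, t]] by at most [16 * (t - s) * S N <= 16]. For the others,
    [cmod v <= 1/2 + cmod v ^+ 2 / 2] and half of the tail estimate give [257 * C1 + 514 * E]. The
    sum [16 + 1/2] is rounded up to 17, and nothing depends on [J]. *)
Lemma lacunary_sum_oscillation (nu : nat -> nat) (a : nat -> R) (b : nat -> C) (C1 E : R) :
  nu 0%N = 0%N -> (forall n, (nu n < nu n.+1)%N) ->
  (forall n, (0 < n)%N -> cmod (b n) <= a n) ->
  (forall N X, Ssum nu a N.+1 * \sum_(N.+1 <= n < X) a n ^+ 2 / gap nu n.+1 <= C1) ->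
  (forall X, \sum_(1 <= n < X) a n ^+ 2 <= E) ->
  forall (J : nat) (s t : R), s < t -> t <= s + 1 ->
  exists c : C, RI `[s, t] (fun x => cmod (trigsum (index_iota 1 J.+1) (fun n => (nu n)%:Z) b x - c))
     <= (17 + 257 * C1 + 514 * E) * (t - s).
Proof.
move=> nu0 nu_incr ba tail_bound sq_bound J s t st ts.
pose S n := Ssum nu a n.
have a0 n : (0 < n)%N -> 0 <= a n by move=> /ba; apply: le_trans; exact: cmod_ge0.
have L0 : 0 < t - s by rewrite subr_gt0.
have E0 : 0 <= E by have := sq_bound 0%N; rewrite big_geq.
have C10 : 0 <= C1 by have := tail_bound 0%N 0%N; rewrite big_geq ?mulr0.
(* [N] is the first index below [J] for which [S N.+1 * (t - s)] exceeds 1, or [J] if there is none.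
   In the first case [S N.+1 > 1 / (t - s)] makes the tail at most [C1 * (t - s)]; in the second the
   tail is empty. *)
have [N [NJ SN tailN]] : exists N, [/\ (N <= J)%N, S N * (t - s) <= 1 &
    \sum_(N.+1 <= n < J.+1) a n ^+ 2 / gap nu n.+1 <= C1 * (t - s)].
  have [|/negP hex] := boolP [exists N : 'I_J, S N.+1 * (t - s) > 1].
    move=> /existsP ex.
    have ex' : exists N, (N < J)%N && (S N.+1 * (t - s) > 1).
      by case: ex => i hi; exists i; rewrite ltn_ord.
    case: (ex_minnP ex') => N /andP[NJ SN1] Nmin; exists N; split; first exact: ltnW.
      case: N NJ SN1 Nmin => [|N] NJ SN1 Nmin; first by rewrite /S /Ssum big_geq // mul0r.
      rewrite leNgt; apply/negP => h; have := Nmin N; rewrite h (ltn_trans _ NJ) //.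
      by rewrite ltnn => /(_ isT).
    have := tail_bound N J.+1; rewrite -/(S _).
    set T := \sum_(_ <= n < _) _.
    have T0 : 0 <= T.
      rewrite sumr_ge0 // => n _; rewrite divr_ge0 ?sqr_ge0 // /gap subr_ge0 ler_nat /=.
      exact: ltnW.
    move=> h; have : T * 1 <= T * (S N.+1 * (t - s)) by rewrite ler_wpM2l // ltW.
    have : S N.+1 * T * (t - s) <= C1 * (t - s) by rewrite ler_wpM2r // ltW.
    lra.
  exists J; split=> //; last by rewrite big_geq // mulr_ge0 // ltW.
  case: J hex => [|J] hex; first by rewrite /S /Ssum big_geq // mul0r.
  by rewrite leNgt; apply/negP => h; apply: hex; apply/existsP; exists ord_max.
pose u := trigsum (index_iota 1 N.+1) (fun n => (nu n)%:Z) b.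
pose v := trigsum (index_iota N.+1 J.+1) (fun n => (nu n)%:Z) b.
have cu : ccontinuous u by exact: ccontinuous_trigsum.
have cv : ccontinuous v by exact: ccontinuous_trigsum.
have uvE x : trigsum (index_iota 1 J.+1) (fun n => (nu n)%:Z) b x = u x + v x.
  by rewrite /u /v /trigsum -big_cat_nat.
exists (u s).
have cB : continuous (fun x => cmod (u x + v x - u s)).
  by apply: ccontinuous_cmod; apply: ccontinuousB; [exact: ccontinuousD|exact: ccontinuous_cst].
have uL x : s <= x <= t -> cmod (u x - u s) <= 16.
  move=> /andP[sx xt]; rewrite /u /trigsum -sumrB.
  apply: le_trans (cmod_sum _ _ _) _.
  apply: (@le_trans _ _ (\sum_(1 <= n < N.+1) 16 * (t - s) * (a n * (nu n)%:R))).
    rewrite big_nat_cond [leRHS]big_nat_cond; apply: ler_sum => n; rewrite andbT => /andP[n0 _].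
    rewrite -mulrBr cmodM.
    have h1 : cmod (echar (nu n) x - echar (nu n) s) <= 16 * ((nu n)%:R * (t - s)).
      apply: le_trans (cmod_e1B _ _) _; rewrite ler_wpM2l // -mulrBr normrM.
      by rewrite ger0_norm // ler_wpM2l // ger0_norm; lra.
    apply: le_trans (ler_pM (cmod_ge0 _) (cmod_ge0 _) (ba _ n0) h1) _.
    by rewrite le_eqVlt; apply/orP; left; apply/eqP; ring.
  rewrite -mulr_sumr -/(Ssum nu a N) -/(S N); move: SN; lra.
have vI : rI `[s, t] (fun x => cmod (v x) ^+ 2).
  by apply: continuous_Rintegrable; exact: continuous_cmod_sqr.
have v2 := lacunary_tail_sq nu_incr (fun n Nn => ba n (leq_ltn_trans (leq0n N) Nn)) st ts (NJ : (N.+1 <= J.+1)%N).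
apply: (@le_trans _ _ (RI `[s, t] (fun x => 33 / 2 + 2^-1 * cmod (v x) ^+ 2))).
  apply: le_Rintegral => //.
  - rewrite (_ : EFin \o _ = EFin \o (fun x => cmod (u x + v x - u s))); first exact: continuous_Rintegrable.
    by apply/funext => x /=; rewrite uvE.
  - by apply: RintegrableD => //; [exact: cst_Rintegrable|exact: RintegrableZl].
  - move=> x /=; rewrite in_itv /= => xst; rewrite uvE.
    have -> : u x + v x - u s = (u x - u s) + v x by ring.
    have := cmodD (u x - u s) (v x); have := uL x xst; have := sqr_ge0 (cmod (v x) - 1); lra.
rewrite RintegralD //; last first.
- exact: RintegrableZl.
- exact: cst_Rintegrable.
rewrite Rintegral_itv_cst ?ltW // RintegralZl //.
have sqN : \sum_(N.+1 <= n < J.+1) a n ^+ 2 <= E.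
  apply: le_trans (sq_bound J.+1); rewrite [leRHS](@big_cat_nat _ _ _ N.+1) //= lerDr.
  by rewrite sumr_ge0 // => n _; rewrite sqr_ge0.
move: v2; rewrite -/v; set Iv := RI _ _ => v2.
have h : (t - s) * \sum_(N.+1 <= n < J.+1) a n ^+ 2 <= (t - s) * E by rewrite ler_wpM2l // ltW.
move: tailN v2 h; lra.
Qed.

End LacunarySumsBMO.

(** * Riesz-Fischer theorem for continuous periodic approximants *)

Section RieszFischer.
Local Open Scope classical_set_scope.
Local Open Scope ring_scope.
Context {R : realType}.
Local Notation C := (R[i]).
Local Notation mu := (@lebesgue_measure R).
Local Notation Re := (@complex.Re R).
Local Notation Im := (@complex.Im R).
Local Notation RI D f := (Rintegral mu D f).
Local Notation rI D f := (mu.-integrable D (EFin \o f)).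

Lemma limn_einf_le_near (u : (\bar R)^nat) (e : \bar R) (N : nat) :
  (forall n, (N <= n)%N -> (u n <= e)%E) -> (limn_einf u <= e)%E.
Proof.
move=> ue; rewrite limn_einf_lim; apply: lime_le; first exact: is_cvg_einfs.
exists N => // n /= Nn; apply: le_trans (ue n Nn).
by apply: ereal_inf_lbound; exists n => /=.
Qed.

Lemma limn_e_EFin (u : R^nat) (l : R) : u @ \oo --> l ->
  limn_einf (fun n => (u n)%:E) = l%:E /\ limn_esup (fun n => (u n)%:E) = l%:E.
Proof.
move=> ul; have h : (u n)%:E @[n --> \oo] --> l%:E.
  by apply: cvg_EFin => //; exact: nearW.
by have [-> ->] := cvg_limn_einf_sup h.
Qed.

Lemma cvg_of_summable_increments (u d : R^nat) :
  (forall n, `|u n.+1 - u n| <= d n) -> cvgn (series d) -> cvgn u.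
Proof.
move=> ud cd.
have c1 : cvgn (series (fun n => `|u n.+1 - u n|)).
  by apply: series_le_cvg cd => // n; apply: le_trans (ud n).
have c2 : cvgn (series (fun n => u n.+1 - u n)) := normed_cvg c1.
rewrite (_ : u = (fun n => u 0%N + series (fun n => u n.+1 - u n) n)).
  by apply: is_cvgD => //; exact: is_cvg_cst.
by apply/funext => n; rewrite /series /= telescope_sumr // addrC subrK.
Qed.

Lemma half_pow_sum_le2 (n : nat) : \sum_(0 <= i < n) (2^-1) ^+ i <= 2 :> R.
Proof.
have -> : \sum_(0 <= i < n) (2^-1) ^+ i = 2 - 2 * (2^-1) ^+ n :> R.
  elim: n => [|n IH]; first by rewrite big_geq // expr0; ring.
  by rewrite big_nat_recr //= IH exprS; field.
by rewrite gerBl mulr_ge0 // exprn_ge0 // invr_ge0.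
Qed.

(** With [r = 2 ^ -i], the inequality [d <= r / 2 + d ^+ 2 / (2 r)] turns the L2 bounds into L1
    norms at most [r] of the increments. Their sum is integrable, hence finite almost everywhere,
    and absolute convergence follows. *)
Lemma ae_cvg_of_fast_cauchy (q : nat -> R -> C) (s t : R) : s <= t ->
  (forall i, ccontinuous (q i)) -> t - s <= 1 ->
  (forall i, RI `[s, t] (fun x => cmod (q i.+1 x - q i x) ^+ 2) <= ((2^-1) ^+ i) ^+ 2) ->
  {ae mu, forall x, `[s, t]%classic x ->
    cvgn (fun i => Re (q i x)) /\ cvgn (fun i => Im (q i x))}.
Proof.
move=> st cq ts q2.
pose d i x := cmod (q i.+1 x - q i x).
have cd i : continuous (d i) by apply: ccontinuous_cmod; exact: ccontinuousB.
have d0 i x : 0 <= d i x by exact: cmod_ge0.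
have dm i : measurable_fun `[s, t] (EFin \o d i).
  by apply/measurable_EFinP; apply: measurable_funS (continuous_measurable_fun (cd i)).
have d1 i : (\int[mu]_(x in `[s, t]) (d i x)%:E <= ((2^-1) ^+ i)%:E)%E.
  have di : rI `[s, t] (d i) by exact: continuous_Rintegrable.
  have d2i : rI `[s, t] (fun x => d i x ^+ 2).
    apply: continuous_Rintegrable; apply: continuous_cmod_sqr; exact: ccontinuousB.
  rewrite EFin_Rintegral // lee_fin.
  set r := (2^-1) ^+ i; have r0 : 0 < r by rewrite exprn_gt0 // invr_gt0.
  apply: (@le_trans _ _ (RI `[s, t] (fun x => r / 2 + (2 * r)^-1 * d i x ^+ 2))).
    apply: le_Rintegral => //.
    - by apply: RintegrableD => //; [exact: cst_Rintegrable|exact: RintegrableZl].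
    - move=> x _; have := sqr_ge0 (r - d i x).
      have -> : (r - d i x) ^+ 2 = (2 * r) * (r / 2 + (2 * r)^-1 * d i x ^+ 2 - d i x).
        by field; rewrite gt_eqF.
      by rewrite pmulr_rge0 ?subr_ge0 // mulr_gt0.
  rewrite RintegralD //; last first.
  - exact: RintegrableZl.
  - exact: cst_Rintegrable.
  rewrite Rintegral_itv_cst // RintegralZl //.
  have h1 : r / 2 * (t - s) <= r / 2 by rewrite ler_piMr // divr_ge0 // ltW.
  have h2 : (2 * r)^-1 * RI `[s, t] (fun x => d i x ^+ 2) <= (2 * r)^-1 * r ^+ 2.
    by rewrite ler_wpM2l ?q2 // invr_ge0 mulr_ge0 // ltW.
  apply: le_trans (lerD h1 h2) _; rewrite le_eqVlt; apply/orP; left; apply/eqP.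
  by field; rewrite gt_eqF.
pose D x := (\sum_(0 <= i <oo) (d i x)%:E)%E.
have Dm : measurable_fun `[s, t] D.
  apply: ge0_emeasurable_sum => [i x _ _|i _]; [by rewrite lee_fin|exact: dm].
have D0 x : (0 <= D x)%E by apply: nneseries_ge0 => i _ _; rewrite lee_fin.
have DI : mu.-integrable `[s, t] D.
  apply/integrableP; split => //.
  have -> : (\int[mu]_(x in `[s, t]) `|D x| = \int[mu]_(x in `[s, t]) D x)%E.
    by apply: eq_integral => x _; rewrite gee0_abs.
  rewrite integral_nneseries //; last by move=> i x _; rewrite lee_fin.
  apply: (@le_lt_trans _ _ 2%:E); last exact: ltry.
  apply: lime_le; first by apply: is_cvg_nneseries => i _ _; apply: integral_ge0 => x _; rewrite lee_fin.
  apply: nearW => n; apply: (@le_trans _ _ (\sum_(0 <= i < n) ((2^-1) ^+ i)%:E)%E).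
    by apply: lee_sum => i _; exact: d1.
  by rewrite sumEFin lee_fin half_pow_sum_le2.
apply: filterS (integrable_ae _ DI) => // x hx xst.
have {}hx := hx xst.
have cds : cvgn (series (fun i => d i x)).
  apply: nondecreasing_is_cvgn.
    by apply/nondecreasing_seqP => n; rewrite /series /= big_nat_recr //= lerDl.
  exists (fine (D x)) => _ [n _ <-].
  rewrite -lee_fin fineK // /series /= -sumEFin.
  by apply: nneseries_lim_ge => i _ _; rewrite lee_fin.
split; apply: (@cvg_of_summable_increments _ (fun i => d i x)) => // i.
- by rewrite -ReB ler_Re_cmod.
- by rewrite -ImB ler_Im_cmod.
Qed.

(** The limit is the pointwise limsup, on real and imaginary parts, of a rapidly convergent
    subsequence: it is defined everywhere, so it is measurable and exactly periodic. Fatou's lemma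
    gives the norm estimates. All bounds are uniform in [s], so that later arguments may use the
    period centred at any point. *)
Lemma riesz_fischer (p : nat -> R -> C) :
  (forall j, ccontinuous (p j)) -> (forall j, periodic1 (p j)) ->
  (forall e : R, 0 < e -> exists N, forall j k (s : R), (N <= j)%N -> (j <= k)%N ->
     RI `[s, s + 1] (fun x => cmod (p k x - p j x) ^+ 2) <= e) ->
  exists g : R -> C,
    [/\ periodic1 g, cmeasurable g,
        forall j s, rI `[s, s + 1] (fun x => cmod (g x - p j x) ^+ 2) &
        forall e : R, 0 < e -> exists N, forall j (s : R), (N <= j)%N ->
          RI `[s, s + 1] (fun x => cmod (g x - p j x) ^+ 2) <= e].
Proof.
move=> cp pp cauchy.
have pow_gt0 i : 0 < ((2^-1) ^+ i) ^+ 2 :> R by rewrite !exprn_gt0 // invr_gt0.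
have [NN hNN] := choice (fun i => cauchy _ (pow_gt0 i)).
(* Partial sums of the thresholds [NN]: nondecreasing, and at least both [NN i] and [i]. *)
pose J i := (\sum_(0 <= l < i.+1) (NN l).+1)%N.
have NJ i : (NN i <= J i)%N by rewrite /J big_nat_recr //= (leq_trans (leqnSn _)) // leq_addl.
have JJ i : (J i <= J i.+1)%N by rewrite /J [leqRHS]big_nat_recr //= leq_addr.
have iJ i : (i <= J i)%N.
  elim: i => // i IH; rewrite /J big_nat_recr //= -/(J i); lia.
pose q i := p (J i).
have cq i : ccontinuous (q i) by exact: cp.
pose gr x := fine (limn_esup (fun i => (Re (q i x))%:E)).
pose gi x := fine (limn_esup (fun i => (Im (q i x))%:E)).
pose g x : C := (gr x +i* gi x)%C.
have gm : cmeasurable g.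
  split; apply: (measurableT_comp (f := fine)) => //; apply: measurable_fun_limn_esup => i;
    apply/measurable_EFinP; apply: continuous_measurable_fun; by have [] := cq i.
have g_cvg (s : R) : {ae mu, forall x, `[s, s + 1]%classic x -> forall j,
    limn_einf (fun i => (cmod (q i x - p j x) ^+ 2)%:E) = (cmod (g x - p j x) ^+ 2)%:E}.
  have := @ae_cvg_of_fast_cauchy q s (s + 1) _ cq _ (fun i => hNN i _ _ s (NJ i) (JJ i)).
  rewrite lerDl addrAC subrr add0r => /(_ ler01 (lexx _)) ae.
  apply: (@filterS _ _ (ae_filter_ringOfSetsType mu) _ _ _ ae) => x h xs j; have [/cvg_ex[/= lr hr] /cvg_ex[/= li hi]] := h xs.
  have gE : g x = (lr +i* li)%C.
    rewrite /g /gr /gi.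
    by have [_ ->] := limn_e_EFin hr; have [_ ->] := limn_e_EFin hi.
  have c2 : (fun i => cmod (q i x - p j x) ^+ 2) @ \oo --> cmod (g x - p j x) ^+ 2.
    rewrite (_ : (fun i => _) = (fun i => (Re (q i x) - Re (p j x)) * (Re (q i x) - Re (p j x)) + (Im (q i x) - Im (p j x)) * (Im (q i x) - Im (p j x)))).
      rewrite cmod_sqr ReB ImB gE /=.
      by apply: cvgD; apply: cvgM; apply: cvgB => //; exact: cvg_cst.
    by apply/funext => i; rewrite cmod_sqr ReB ImB.
  by have [-> _] := limn_e_EFin c2.
have dm j (D : set R) : measurable D -> measurable_fun D (fun x => cmod (g x - p j x) ^+ 2).
  move=> mD; apply: measurable_funX; apply: measurable_cmod.
  - rewrite (_ : _ \o _ = (Re \o g) \- (Re \o p j)); last by apply/funext => x /=; rewrite ReB.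
    apply: measurable_funB; first exact: measurable_funS gm.1.
    by have [] := ccontinuous_measurable mD (cp j).
  - rewrite (_ : _ \o _ = (Im \o g) \- (Im \o p j)); last by apply/funext => x /=; rewrite ImB.
    apply: measurable_funB; first exact: measurable_funS gm.2.
    by have [] := ccontinuous_measurable mD (cp j).
(* Fatou along the subsequence: a bound on [p k - p j] for all large [k] passes to [g - p j]. *)
have fatouE j (s : R) (e : R) N : (forall k, (N <= k)%N ->
      RI `[s, s + 1] (fun x => cmod (p k x - p j x) ^+ 2) <= e) ->
    (\int[mu]_(x in `[s, (s + 1)%R]) (cmod (g x - p j x) ^+ 2)%:E <= e%:E)%E.
  move=> he.
  have c2 i : continuous (fun x => cmod (q i x - p j x) ^+ 2).
    by apply: continuous_cmod_sqr; exact: ccontinuousB.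
  have m2 i : measurable_fun `[s, s + 1] (fun x => (cmod (q i x - p j x) ^+ 2)%:E).
    by apply/measurable_EFinP; apply: measurable_funS (continuous_measurable_fun (c2 i)).
  have -> : (\int[mu]_(x in `[s, (s + 1)%R]) (cmod (g x - p j x) ^+ 2)%:E =
     \int[mu]_(x in `[s, (s + 1)%R]) limn_einf (fun i => (cmod (q i x - p j x) ^+ 2)%:E))%E.
    apply: ae_eq_integral => //.
    - by apply/measurable_EFinP; exact: dm.
    - rewrite (_ : (fun x => _) = (fun x => - limn_esup (fun i => - (cmod (q i x - p j x) ^+ 2)%:E)))%E.
        apply: measurableT_comp => //; apply: measurable_fun_limn_esup => i.
        exact: (measurableT_comp (@oppe_measurable R setT) (m2 i)).
      by apply/funext => x; rewrite (limn_esupN (fun i => (cmod (q i x - p j x) ^+ 2)%:E)) oppeK.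
    - by apply: (@filterS _ _ (ae_filter_ringOfSetsType mu) _ _ _ (g_cvg s)) => x h xs; rewrite h.
  have f0 (i : nat) x : `[s, s + 1]%classic x -> (0 <= (cmod (q i x - p j x) ^+ 2)%:E)%E.
    by move=> _; rewrite lee_fin sqr_ge0.
  apply: (le_trans (@fatou _ _ _ mu _ _ (fun i x => (cmod (q i x - p j x) ^+ 2)%:E) m2 f0)) => //.
  apply: (@limn_einf_le_near _ _ N) => i Ni.
  rewrite EFin_Rintegral //; last exact: continuous_Rintegrable.
  rewrite lee_fin; apply: he.
  exact: leq_trans Ni (iJ i).
exists g; split => //.
- move=> x; rewrite /g /gr /gi; congr (fine _ +i* fine _)%C; congr limn_esup;
  by apply/funext => i; rewrite /q pp.
- move=> j s; have [N hN] := cauchy 1 ltr01.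
  have ci k l : rI `[s, s + 1] (fun x => cmod (p k x - p l x) ^+ 2).
    by apply: continuous_Rintegrable; apply: continuous_cmod_sqr; exact: ccontinuousB.
  apply: ge0_Rintegrable => //.
  - exact: dm.
  - by move=> x _; rewrite sqr_ge0.
  (* For arbitrary [j] the Cauchy property compares [p k] only with [p N]; the distance from [p N]
     to [p j] is a finite constant. *)
  - apply: (@le_lt_trans _ _ (2 + 2 * RI `[s, s + 1] (fun x => cmod (p N x - p j x) ^+ 2))%:E); last exact: ltry.
    apply: (fatouE _ _ _ N) => k Nk.
    apply: (@le_trans _ _ (RI `[s, s + 1] (fun x => 2 * cmod (p k x - p N x) ^+ 2 + 2 * cmod (p N x - p j x) ^+ 2))).
      apply: le_Rintegral => //.
      - by apply: RintegrableD => //; exact: RintegrableZl.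
      - move=> x _; have := cmod_dist_triangle (p k x) (p N x) (p j x).
        have := cmod_ge0 (p k x - p j x).
        move: (cmod _) (cmod _) (cmod _) => w v u u0 uvw.
        have h : u ^+ 2 <= (v + w) ^+ 2 by rewrite ler_sqr ?nnegrE // (le_trans u0).
        have := sqr_ge0 (v - w); lra.
    rewrite RintegralD //; try exact: RintegrableZl.
    rewrite !RintegralZl // lerD2r; have := hN N k s (leqnn _) Nk; lra.
- move=> e e0; have [N hN] := cauchy e e0; exists N => j s Nj.
  rewrite /Rintegral -lee_fin fineK.
    by apply: (fatouE _ _ _ j) => k jk; exact: hN.
  have h := fatouE j s e j (fun k jk => hN j k s Nj jk).
  rewrite ge0_fin_numE; first exact: le_lt_trans h (ltry _).
  by apply: integral_ge0 => x _; rewrite lee_fin sqr_ge0.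
Qed.

End RieszFischer.

(** * The lacunary series as an L2 function in BMO *)

Section LacunarySums.
Local Open Scope classical_set_scope.
Local Open Scope ring_scope.
Context {R : realType}.
Local Notation C := (R[i]).
Local Notation mu := (@lebesgue_measure R).
Local Notation Re := (@complex.Re R).
Local Notation Im := (@complex.Im R).
Local Notation RI D f := (Rintegral mu D f).
Local Notation rI D f := (mu.-integrable D (EFin \o f)).

Lemma bounded_sums_cauchy (u : nat -> R) (E : R) : (forall n, 0 <= u n) ->
  (forall n, \sum_(0 <= i < n) u i <= E) ->
  forall e : R, 0 < e -> exists N, forall j k, (N <= j)%N -> (j <= k)%N ->
    \sum_(j <= i < k) u i <= e.
Proof.
move=> u0 uE e e0.
have cs : cvgn (series u).
  apply: nondecreasing_is_cvgn; last by exists E => _ [n _ <-]; exact: uE.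
  by apply/nondecreasing_seqP => n; rewrite /series /= big_nat_recr //= lerDl.
have e2 : 0 < e / 2 by rewrite divr_gt0.
have [l hl] := (cvg_ex _).1 cs.
have /cvgrPdist_lt/(_ _ e2)[N _ hN] := hl.
exists N => j k Nj jk.
have := hN j Nj; have := hN k (leq_trans Nj jk); rewrite /= /series /=.
rewrite (big_cat_nat (leq0n j) jk) /= !ltr_norml => /andP[a b] /andP[c d].
lra.
Qed.

Lemma cmeasurable_L2_integrable (D : set R) (s t : R) (F : R -> C) : D `<=` `[s, t] ->
  measurable D ->
  measurable_fun D (Re \o F) -> measurable_fun D (Im \o F) ->
  rI D (fun x => cmod (F x) ^+ 2) -> cintegrable D F.
Proof.
move=> Dst mD mr mi F2.
apply: (cintegrable_le mD mr mi (g := fun x => 1 + cmod (F x) ^+ 2)).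
  by move=> x _; have := sqr_ge0 (cmod (F x) - 1); have := sqr_ge0 (cmod (F x)); lra.
by apply: RintegrableD => //; apply: integrableS (cst_Rintegrable s t 1).
Qed.

(** Linearized Cauchy-Schwarz: [eta] is taken equal to the wanted L1 bound, the L2 square being then
    at most [eta ^+ 2]. *)
Lemma L1_le_L2 (s t eta : R) (F : R -> C) : s <= t -> 0 < eta ->
  cintegrable `[s, t] F -> rI `[s, t] (fun x => cmod (F x) ^+ 2) ->
  RI `[s, t] (fun x => cmod (F x)) <=
    eta / 2 * (t - s) + (2 * eta)^-1 * RI `[s, t] (fun x => cmod (F x) ^+ 2).
Proof.
move=> st e0 FI F2; have en : eta != 0 by rewrite gt_eqF.
apply: (@le_trans _ _ (RI `[s, t] (fun x => eta / 2 + (2 * eta)^-1 * cmod (F x) ^+ 2))).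
  apply: le_Rintegral => //.
  - exact: cintegrable_cmod.
  - by apply: RintegrableD => //; [exact: cst_Rintegrable|exact: RintegrableZl].
  - move=> x _; have := sqr_ge0 (eta - cmod (F x)).
    have -> : (eta - cmod (F x)) ^+ 2 =
        (2 * eta) * (eta / 2 + (2 * eta)^-1 * cmod (F x) ^+ 2 - cmod (F x)) by field.
    by rewrite pmulr_rge0 ?subr_ge0 // mulr_gt0.
rewrite RintegralD //; first by rewrite Rintegral_itv_cst // RintegralZl.
- exact: cst_Rintegrable.
- exact: RintegrableZl.
Qed.

Lemma le_Rintegral_subset (A B : set R) (f : R -> R) : measurable A -> measurable B ->
  A `<=` B -> (forall x, 0 <= f x) -> rI B f -> RI A f <= RI B f.
Proof.
move=> mA mB AB f0 fB; rewrite -lee_fin -!EFin_Rintegral //; last exact: integrableS fB.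
apply: ge0_subset_integral => //.
- by apply/measurable_EFinP; exact: Rintegrable_measurable.
- by move=> x _; rewrite lee_fin.
Qed.

Lemma eq_of_cmod_le (z w : C) : (forall e : R, 0 < e -> cmod (z - w) <= e) -> z = w.
Proof.
move=> h; apply/eqP; rewrite -subr_eq0 -cmod_eq0 eq_le cmod_ge0 andbT.
by apply/ler_addgt0Pr => e /h; rewrite add0r.
Qed.

(* The average is within a factor 2 of the best constant. *)
Lemma oscillation_le (s t K : R) (g : R -> C) (c : C) : s < t ->
  cintegrable `[s, t] g ->
  RI `[s, t] (fun x => cmod (g x - c)) <= K * (t - s) ->
  (oscillation s t g <= (2 * K)%:E)%E.
Proof.
move=> st gI gc; have L0 : 0 < t - s by rewrite subr_gt0.
have cI k : cintegrable `[s, t] (fun x => g x - k) by apply: cintegrableB => //; exact: cintegrable_cst.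
have nI k : rI `[s, t] (fun x => cmod (g x - k)) by exact: cintegrable_cmod.
rewrite /oscillation EFin_Rintegral // -EFinM lee_fin.
set A := caverage s t g.
have AE : A - c = (t - s)^-1%:C%C * cintegral `[s, t] (fun x => g x - c).
  rewrite cintegralB //; last exact: cintegrable_cst.
  rewrite cintegral_cst ?ltW // mulrBr /A /caverage; congr (_ - _).
  rewrite mulrCA -rmorphM /= mulVf ?gt_eqF // mulr1 //.
have Ac : cmod (A - c) <= K.
  rewrite AE cmodM cmod_real ger0_norm ?invr_ge0 ?(ltW L0) //.
  rewrite mulrC ler_pdivrMr //.
  exact: le_trans (cmod_cintegral_le _ (cI c)) gc.
rewrite mulrC ler_pdivrMr //.
apply: (@le_trans _ _ (RI `[s, t] (fun x => cmod (g x - c) + K))).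
  apply: le_Rintegral => //.
  - by apply: RintegrableD => //; exact: cst_Rintegrable.
  - move=> x _; apply: le_trans (cmod_dist_triangle _ c _) _.
    by rewrite lerD2l cmod_distrC.
rewrite RintegralD //; last exact: cst_Rintegrable.
rewrite Rintegral_itv_cst ?(ltW st) //; lra.
Qed.

(** The partial sums [p J] converge to [g] in L2 on every period, hence in L1. Fourier coefficients
    pass to the limit because those of [p J] at a given frequency are eventually constant;
    oscillations pass to the limit because their bound is uniform in [J]. *)
Lemma exists_lacunary_sum_BMO (nu : nat -> nat) (a : nat -> R) (b : nat -> C) (C1 E : R) :
  nu 0%N = 0%N -> (forall n, (nu n < nu n.+1)%N) ->
  (forall n, (0 < n)%N -> cmod (b n) <= a n) ->
  (forall N X, Ssum nu a N.+1 * \sum_(N.+1 <= n < X) a n ^+ 2 / gap nu n.+1 <= C1) ->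
  (forall X, \sum_(1 <= n < X) a n ^+ 2 <= E) ->
  exists g : R -> C, is_lacunary_sum nu b g /\ BMO g.
Proof.
move=> nu0 nu_incr ba tail_bound sq_bound.
pose p J := trigsum (index_iota 1 J.+1) (fun n => (nu n)%:Z) b.
have nu_mono : {homo nu : m n / (m < n)%N} by apply: homo_ltn => //; exact: ltn_trans.
have nu_inj m n : nu m = nu n -> m = n.
  by case: (ltngtP m n) => // /nu_mono; lia.
have cp J : ccontinuous (p J) by exact: ccontinuous_trigsum.
have pp J : periodic1 (p J).
  by move=> x; apply: eq_bigr => n _; rewrite /echar e1_intM_periodic.
have pB j k x : (j <= k)%N -> p k x - p j x = trigsum (index_iota j.+1 k.+1) (fun n => (nu n)%:Z) b x.
  move=> jk; rewrite /p /trigsum (@big_cat_nat _ _ _ j.+1 1 k.+1) //=.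
  by rewrite addrAC subrr add0r.
have cauchy (e : R) : 0 < e -> exists N, forall j k (s : R), (N <= j)%N -> (j <= k)%N ->
     RI `[s, s + 1] (fun x => cmod (p k x - p j x) ^+ 2) <= e.
  move=> e0; have [||N hN] := @bounded_sums_cauchy (fun n => a n.+1 ^+ 2) E _ _ e e0.
  - by move=> n; rewrite sqr_ge0.
  - by move=> n; have := sq_bound n.+1; rewrite big_add1.
  exists N => j k s Nj jk.
  have -> : RI `[s, s + 1] (fun x => cmod (p k x - p j x) ^+ 2) =
      RI `[s, s + 1] (fun x => cmod (trigsum (index_iota j.+1 k.+1) (fun n => (nu n)%:Z) b x) ^+ 2).
    by apply: eq_Rintegral => x _; rewrite pB.
  rewrite trigsum_parseval ?iota_uniq //; last by move=> m n _ _ [] /nu_inj.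
  apply: le_trans (hN _ _ Nj jk).
  rewrite big_add1 /= big_nat_cond [leRHS]big_nat_cond; apply: ler_sum => n _.
  have h := ba _ (ltn0Sn n).
  by rewrite ler_sqr ?nnegrE ?cmod_ge0 // (le_trans (cmod_ge0 _) h).
have [g [gp gm gi gc]] := riesz_fischer cp pp cauchy.
(* Thanks to this, facts about [g - p J] at [J = 0] are facts about [g]. *)
have p0 x : p 0%N x = 0 by rewrite /p /trigsum big_geq.
have mgp j (D : set R) : measurable D ->
    measurable_fun D (Re \o (fun x => g x - p j x)) /\ measurable_fun D (Im \o (fun x => g x - p j x)).
  move=> mD; have [m1 m2] := ccontinuous_measurable mD (cp j); split.
  - rewrite (_ : _ \o _ = (Re \o g) \- (Re \o p j)); last by apply/funext => x /=; rewrite ReB.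
    by apply: measurable_funB => //; exact: measurable_funS gm.1.
  - rewrite (_ : _ \o _ = (Im \o g) \- (Im \o p j)); last by apply/funext => x /=; rewrite ImB.
    by apply: measurable_funB => //; exact: measurable_funS gm.2.
have gpI j (s t : R) : t <= s + 1 -> rI `[s, t] (fun x => cmod (g x - p j x) ^+ 2).
  move=> ts; apply: integrableS (gi j s) => //.
  by move=> x /=; rewrite !in_itv /= => /andP[-> /le_trans -> //].
have gpC j (s t : R) : t <= s + 1 -> cintegrable `[s, t] (fun x => g x - p j x).
  move=> ts; have [m1 m2] := mgp j `[s, t]%classic (measurable_itv _).
  by apply: (@cmeasurable_L2_integrable _ s t) => //; exact: gpI.
have gI (s t : R) : t <= s + 1 -> cintegrable `[s, t] g.
  move=> ts; have := gpC 0%N s t ts.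
  by rewrite (_ : (fun x => _) = g) //; apply/funext => x; rewrite p0 subr0.
have L1small (e s t : R) : 0 < e -> s <= t -> t <= s + 1 ->
    exists N, forall j, (N <= j)%N -> RI `[s, t] (fun x => cmod (g x - p j x)) <= e.
  move=> e0 st ts; have [N hN] := gc (e ^+ 2) (exprn_gt0 2%N e0).
  exists N => j /(hN j s) h; apply: le_trans (L1_le_L2 st e0 (gpC j s t ts) (gpI j s t ts)) _.
  have h1 : RI `[s, t] (fun x => cmod (g x - p j x) ^+ 2) <= e ^+ 2.
    apply: le_trans h; apply: le_Rintegral_subset => //.
    - by move=> x /=; rewrite !in_itv /= => /andP[-> /le_trans -> //].
    - by move=> x; rewrite sqr_ge0.
  have h2 : (2 * e)^-1 * RI `[s, t] (fun x => cmod (g x - p j x) ^+ 2) <= e / 2.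
    rewrite mulrC ler_pdivrMr ?mulr_gt0 //; apply: le_trans h1 _.
    by rewrite le_eqVlt; apply/orP; left; apply/eqP; field.
  have h3 : e / 2 * (t - s) <= e / 2 by rewrite ler_piMr ?divr_ge0 ?(ltW e0) //; move: ts; clear; lra.
  by apply: le_trans (lerD h3 h2) _; rewrite -splitr.
have coefE (k : int) (z : C) (N : nat) :
    (forall J, (N <= J)%N -> \sum_(n <- index_iota 1 J.+1 | (nu n)%:Z == k) b n = z) ->
    fourier_coef g k = z.
  move=> hz; apply: eq_of_cmod_le => e e0.
  have [N' hN'] := L1small e 0 1 e0 ler01 ltac:(by rewrite add0r).
  pose J := maxn N N'.
  rewrite -(hz J) ?leq_maxl // -(cintegral_trigsum_echar _ _ _ _ 0) add0r /fourier_coef -/(p J).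
  have eC : ccontinuous (fun x : R => e1 (- k%:~R * x)) by exact: ccontinuous_e1M.
  have [em1 em2] := ccontinuous_measurable (measurable_itv `[0, 1]) eC.
  have -> : cintegral `[0, 1] (fun x => p J x * echar (- k) x) =
            cintegral `[0, 1] (fun x => e1 (- k%:~R * x) * p J x).
    by apply: eq_cintegral => x _; rewrite mulrC /echar mulrNz.
  have I1 : cintegrable `[0, 1] (fun x => e1 (- k%:~R * x) * g x).
    apply: (@cintegrableM_bounded _ _ _ _ 1) => //; first by move=> x _; rewrite cmod_e1.
    by apply: gI; rewrite add0r.
  have I2 : cintegrable `[0, 1] (fun x => e1 (- k%:~R * x) * p J x).
    by apply: ccontinuous_cintegrable; exact: ccontinuousM.
  rewrite -cintegralB //; apply: le_trans (cmod_cintegral_le _ (cintegrableB _ I1 I2)) _ => //.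
  apply: le_trans (hN' J (leq_maxr _ _)); rewrite le_eqVlt; apply/orP; left; apply/eqP.
  by apply: eq_Rintegral => x _; rewrite -mulrBr cmodM cmod_e1 mul1r.
exists g; split; split.
- split => //; have h := gi 0%N 0; rewrite add0r in h.
  have {}h : rI `[0, 1] (fun x => cmod (g x) ^+ 2).
    by apply: eq_integrable h => // x _ /=; rewrite p0 subr0.
  by rewrite EFin_Rintegral // ltry.
- move=> m m0; apply: (coefE _ _ m) => J mJ.
  rewrite big_mkcond (bigD1_seq m) ?iota_uniq //=; last by rewrite mem_index_iota; lia.
  rewrite eqxx big1 ?addr0 // => n nm; case: eqP => // -[] /nu_inj e.
  by rewrite e eqxx in nm.
- move=> k hk; apply: (coefE _ _ 0%N) => J _.
  rewrite big_seq_cond big1 // => n /andP[]; rewrite mem_index_iota => /andP[n0 _] /eqP e.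
  by have := hk n n0; rewrite e eqxx.
- exact: gp.
- by apply: gI; rewrite add0r.
- pose K := 17 + 257 * C1 + 514 * E.
  apply: (@le_lt_trans _ _ (2 * (1 + K))%:E); last exact: ltry.
  apply: ge_ereal_sup => _ [[s t] /= /andP[st ts] <-].
  have L0 : 0 < t - s by rewrite subr_gt0.
  (* An L1 error of [t - s] adds 1 to the oscillation bound. [N] depends on the interval, the bound
     does not. *)
  have [N hN] := L1small (t - s) s t L0 (ltW st) ts.
  have [c hc] := lacunary_sum_oscillation nu0 nu_incr ba tail_bound sq_bound N st ts.
  apply: (oscillation_le st (gI s t ts) (c := c)).
  apply: (@le_trans _ _ (RI `[s, t] (fun x => cmod (g x - p N x) + cmod (p N x - c)))).
    have cc : cintegrable `[s, t] (fun x => p N x - c).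
      apply: ccontinuous_cintegrable; apply: ccontinuousB => //; exact: ccontinuous_cst.
    apply: le_Rintegral => //.
    - apply: cintegrable_cmod => //; apply: cintegrableB => //; [exact: gI|exact: cintegrable_cst].
    - by apply: RintegrableD => //; apply: cintegrable_cmod => //; exact: gpC.
    - by move=> x _; exact: cmod_dist_triangle.
  rewrite RintegralD //; first last.
  - apply: cintegrable_cmod => //; apply: ccontinuous_cintegrable; apply: ccontinuousB => //; exact: ccontinuous_cst.
  - by apply: cintegrable_cmod => //; exact: gpC.
  by rewrite [(1 + K) * _]mulrDl mul1r lerD // hN.
Qed.

End LacunarySums.

(** * Approximate factorization of polynomials on the unit circle *)

Section ApproximateFactorization.
Local Open Scope classical_set_scope.
Local Open Scope ring_scope.
Context {R : realType}.
Local Notation C := (R[i]).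

(** Polynomial iterates for the fixed point [y = 1 - sqrt (1 - x)] of [y = (x + y ^+ 2) / 2];
    [sqrt_iter] is the real sequence of their values at [x = 1]. *)
Fixpoint sqrt_poly (n : nat) : {poly C} :=
  if n is m.+1 then 2^-1 *: ('X + sqrt_poly m ^+ 2) else 0.

Fixpoint sqrt_iter (n : nat) : R :=
  if n is m.+1 then (1 + sqrt_iter m ^+ 2) / 2 else 0.

Lemma sqrt_iter_bounds n : 0 <= sqrt_iter n <= 1.
Proof.
elim: n => [|n /andP[h0 h1]] /=; first by rewrite lexx ler01.
have h2 : sqrt_iter n ^+ 2 <= 1 by rewrite expr_le1.
by have h3 := sqr_ge0 (sqrt_iter n); apply/andP; split; lra.
Qed.

Lemma sqrt_polyS n (x : C) :
  (sqrt_poly n.+1).[x] = 2^-1 * (x + (sqrt_poly n).[x] ^+ 2).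
Proof. by rewrite /= !hornerE. Qed.

Lemma cmod_half : cmod (2^-1 : C) = 2^-1.
Proof.
by rewrite -(_ : (2^-1)%:C%C = 2^-1) ?cmod_real ?ger0_norm ?invr_ge0 // fmorphV rmorph_nat.
Qed.

Lemma cmod_sqrt_poly n (x : C) : cmod x <= 1 -> cmod (sqrt_poly n).[x] <= sqrt_iter n.
Proof.
move=> x1; elim: n => [|n IH]; first by rewrite /= horner0 cmod0.
rewrite sqrt_polyS cmodM cmod_half /= mulrC ler_wpM2r ?invr_ge0 //.
apply: le_trans (cmodD _ _) _; rewrite lerD // cmodX ler_pXn2r ?nnegrE ?cmod_ge0 //.
by have /andP[] := sqrt_iter_bounds n.
Qed.

(** The next increment is half the product of the current increment and the sum of the two iterates;
    each factor is majorized by its value at 1. *)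
Lemma cmod_sqrt_poly_increment n (x : C) : cmod x <= 1 ->
  cmod ((sqrt_poly n.+1).[x] - (sqrt_poly n).[x]) <= sqrt_iter n.+1 - sqrt_iter n.
Proof.
move=> x1; elim: n => [|n IH].
  rewrite sqrt_polyS /= horner0 subr0 expr0n addr0 cmodM cmod_half expr0n /= addr0 subr0 mul1r.
  by rewrite ler_piMr ?invr_ge0.
rewrite sqrt_polyS [X in cmod (_ - X)]sqrt_polyS.
have -> : 2^-1 * (x + (sqrt_poly n.+1).[x] ^+ 2) - 2^-1 * (x + (sqrt_poly n).[x] ^+ 2) =
    2^-1 * (((sqrt_poly n.+1).[x] - (sqrt_poly n).[x]) * ((sqrt_poly n.+1).[x] + (sqrt_poly n).[x])).
  by ring.
rewrite !cmodM cmod_half.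
have h2 := cmod_sqrt_poly n.+1 x1; have h3 := cmod_sqrt_poly n x1.
have h4 : cmod ((sqrt_poly n.+1).[x] + (sqrt_poly n).[x]) <= sqrt_iter n.+1 + sqrt_iter n.
  by apply: le_trans (cmodD _ _) _; rewrite lerD.
have h5 := ler_pM (cmod_ge0 _) (cmod_ge0 _) IH h4.
rewrite [sqrt_iter n.+2]/= [X in _ <= _ - X]/=.
set u := cmod _ * cmod _ in h5 *.
move: h5; rewrite -[sqrt_iter n.+1]/((1 + sqrt_iter n ^+ 2) / 2).
move: (sqrt_iter n) u => e u; lra.
Qed.

(** Otherwise the iterates would grow at least linearly and pass their bound 1. *)
Lemma sqrt_iter_small_increment (d : R) : 0 < d -> exists n, sqrt_iter n.+1 - sqrt_iter n <= d.
Proof.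
move=> d0; apply: contrapT => /forallNP h.
have grow n : n%:R * d <= sqrt_iter n.
  elim: n => [|n IH]; first by rewrite mul0r.
  have := h n; move/negP; rewrite -ltNge -natr1 mulrDl mul1r => hn; lra.
have := grow (Num.truncn d^-1).+1; have /andP[_] := sqrt_iter_bounds (Num.truncn d^-1).+1.
have : d^-1 < (Num.truncn d^-1).+1%:R by exact: truncnS_gt.
rewrite -(ltr_pM2r d0) mulVf ?gt_eqF //; lra.
Qed.

(* The iteration y <- (x + y^2)/2 has nonnegative coefficients in x, so its
   increments on the closed disc are controlled by those at x = 1. *)
Lemma approximate_sqrt (d : R) : 0 < d ->
  exists H : {poly C}, forall x, cmod x <= 1 -> cmod (H.[x] ^+ 2 - (1 - x)) <= d.
Proof.
move=> d0; have d2 : 0 < d / 2 by rewrite divr_gt0.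
have [n hn] := sqrt_iter_small_increment d2.
exists (1 - sqrt_poly n) => x x1.
have := cmod_sqrt_poly_increment n x1.
(* The error of [1 - y] as a square root of [1 - x] is exactly twice the next increment, so one
   small increment suffices and no limit is taken. *)
have -> : (1 - sqrt_poly n).[x] ^+ 2 - (1 - x) = 2 * ((sqrt_poly n.+1).[x] - (sqrt_poly n).[x]).
  by rewrite sqrt_polyS !hornerE; field.
rewrite cmodM => h.
have -> : cmod (2 : C) = 2 by rewrite -(rmorph_nat (real_complex R)) cmod_real ger0_norm.
lra.
Qed.

Lemma poly_bounded (P : {poly C}) : exists2 K : R, 0 <= K &
  forall z, cmod z <= 1 -> cmod P.[z] <= K.
Proof.
exists (\sum_(i < size P) cmod P`_i); first by apply: sumr_ge0 => i _; exact: cmod_ge0.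
move=> z z1; rewrite horner_coef; apply: le_trans (cmod_sum _ _ _) _.
apply: ler_sum => i _; rewrite cmodM cmodX ler_piMr ?cmod_ge0 // exprn_ile1 ?cmod_ge0 //.
Qed.

(** One-sided bounds on the squared moduli are enough, since the goal is to control the L2 norms of
    both factors on the circle by the L1 norm of [P]. *)
Definition approx_factorable (P : {poly C}) := forall e : R, 0 < e ->
  exists F G : {poly C}, forall z, cmod z = 1 ->
    [/\ cmod (P.[z] - F.[z] * G.[z]) <= e, cmod F.[z] ^+ 2 <= cmod P.[z] + e &
        cmod G.[z] ^+ 2 <= cmod P.[z] + e].

(** With accuracy [d <= 1] for each factor all errors are at most [d * (K + L + 1)], where [K] and
    [L] bound [P] and [Q] on the disc. This reduces the problem to constants and linear factors. *)
Lemma approx_factorableM P Q :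
  approx_factorable P -> approx_factorable Q -> approx_factorable (P * Q).
Proof.
move=> hP hQ e e0.
have [K K0 hK] := poly_bounded P; have [L L0 hL] := poly_bounded Q.
pose d := Num.min 1 (e / (K + L + 1)).
have s0 : 0 < K + L + 1 by lra.
have d0 : 0 < d by rewrite lt_min ltr01 divr_gt0.
have d1 : d <= 1 by rewrite ge_min lexx.
have de : d * (K + L + 1) <= e by rewrite -ler_pdivlMr // ge_min lexx orbT.
have [F1 [G1 h1]] := hP d d0; have [F2 [G2 h2]] := hQ d d0.
exists (F1 * F2), (G1 * G2) => z z1.
have [a1 b1 c1] := h1 z z1; have [a2 b2 c2] := h2 z z1.
have Kz := hK z; have Lz := hL z; rewrite z1 lexx in Kz Lz.
have {}Kz := Kz isT; have {}Lz := Lz isT.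
have P0 := cmod_ge0 P.[z]; have Q0 := cmod_ge0 Q.[z].
have prod_le u v : 0 <= u -> 0 <= v -> u <= cmod P.[z] + d -> v <= cmod Q.[z] + d ->
    u * v <= cmod P.[z] * cmod Q.[z] + e.
  move=> u0 v0 hu hv; apply: le_trans (ler_pM u0 v0 hu hv) _.
  apply: (@le_trans _ _ (cmod P.[z] * cmod Q.[z] + d * (K + L + 1))); last by rewrite lerD2l.
  have : d * d <= d * 1 by rewrite ler_wpM2l // ltW.
  have : d * cmod P.[z] <= d * K by rewrite ler_wpM2l // ltW.
  have : d * cmod Q.[z] <= d * L by rewrite ler_wpM2l // ltW.
  lra.
rewrite !hornerM !cmodM; split.
- have -> : P.[z] * Q.[z] - F1.[z] * F2.[z] * (G1.[z] * G2.[z]) =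
      P.[z] * (Q.[z] - F2.[z] * G2.[z]) + (P.[z] - F1.[z] * G1.[z]) * (F2.[z] * G2.[z]) by ring.
  apply: le_trans (cmodD _ _) _; rewrite !cmodM -[cmod F2.[z] * _]cmodM.
  have h3 : cmod (F2.[z] * G2.[z]) <= L + 1.
    have a2' : cmod (F2.[z] * G2.[z] - Q.[z]) <= d by rewrite cmod_distrC.
    by have := cmodD (F2.[z] * G2.[z] - Q.[z]) Q.[z]; rewrite subrK; lra.
  have h4 := ler_pM (cmod_ge0 _) (cmod_ge0 _) Kz a2.
  have h5 := ler_pM (cmod_ge0 _) (cmod_ge0 _) a1 h3.
  move: h4 h5 de; lra.
- by rewrite exprMn prod_le // sqr_ge0.
- by rewrite exprMn prod_le // sqr_ge0.
Qed.

Lemma approx_factorableC (c : C) : approx_factorable c%:P.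
Proof.
move=> e e0; exists (sqrtC c)%:P, (sqrtC c)%:P => z _; rewrite !hornerC.
by rewrite -expr2 sqrtCK subrr cmod0 -cmodX sqrtCK !lerDl ltW.
Qed.

(** Here [z - w = - w * (1 - z / w)] with [z / w] in the closed disc, so the approximate square root
    applies and the two factors can be equal. *)
Lemma approx_factorable_outer (w : C) : 1 <= cmod w -> approx_factorable ('X - w%:P).
Proof.
move=> w1; have w0 : w != 0 by rewrite -cmod_gt0 (lt_le_trans _ w1).
have wp : 0 < cmod w by rewrite cmod_gt0.
move=> e e0; have d0 : 0 < e / cmod w by rewrite divr_gt0.
have [H hH] := approximate_sqrt d0.
pose F := sqrtC (- w) *: (H \Po (w^-1 *: 'X)).
have F2 z : F.[z] ^+ 2 = - w * H.[w^-1 * z] ^+ 2.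
  by rewrite /F hornerZ horner_comp hornerZ hornerX exprMn sqrtCK.
have near z : cmod z = 1 -> cmod (z - w - F.[z] ^+ 2) <= e.
  move=> z1; have x1 : cmod (w^-1 * z) <= 1 by rewrite cmodM cmodV z1 mulr1 invf_le1.
  rewrite F2 (_ : z - w - _ = w * (H.[w^-1 * z] ^+ 2 - (1 - w^-1 * z))); last by field.
  by rewrite cmodM -ler_pdivlMl // [_ * e]mulrC hH.
exists F, F => z z1; rewrite -expr2.
have -> : ('X - w%:P).[z] = z - w by rewrite !hornerE.
have h : cmod F.[z] ^+ 2 <= cmod (z - w) + e.
  have := cmodB (z - w) (z - w - F.[z] ^+ 2); rewrite subKr cmodX => h.
  by apply: le_trans h _; rewrite lerD2l near.
by split; rewrite ?near.
Qed.

(* A zero w inside the disc is reflected to the outside: |z - w| = |1 - w^* z|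
   on the unit circle. *)
Lemma cmod_reflect (w z : C) : cmod z = 1 -> cmod (1 - w^*%C * z) = cmod (z - w).
Proof.
move=> z1; have zz : z * z^*%C = 1 by rewrite mul_conjc z1 expr1n.
have -> : 1 - w^*%C * z = z * (z - w)^*%C.
  by rewrite -zz rmorphB /=; ring.
by rewrite cmodM cmod_conj z1 mul1r.
Qed.

(** [F ^+ 2] is close to [1 - v z] with [v = conj w], and [G] is close to [F] times the Blaschke
    factor [(z - w) / (1 - v z)], whose denominator is replaced by the truncated geometric series
    [geo n] to stay polynomial. Then [F * G] is close to [z - w], and by reflection both squares
    have modulus close to [cmod (z - w)]. *)
Lemma approx_factorable_inner (w : C) : cmod w < 1 -> approx_factorable ('X - w%:P).
Proof.
move=> w1 e e0; set v := w^*%C.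
have v1 : cmod v < 1 by rewrite cmod_conj.
have v0 := cmod_ge0 v.
pose K := (1 - cmod v)^-1.
have K1 : 1 <= K by rewrite /K invf_ge1; lra.
have K0 : 0 < K by lra.
pose geo n := \sum_(i < n) (v *: 'X) ^+ i : {poly C}.
have geoE n z : (geo n).[z] * (1 - v * z) = 1 - (v * z) ^+ n.
  have h := subrX1 (v * z) n.
  have -> : (geo n).[z] = \sum_(i < n) (v * z) ^+ i.
    by rewrite /geo horner_sum; apply: eq_bigr => i _; rewrite horner_exp hornerZ hornerX.
  have -> : 1 - (v * z) ^+ n = - ((v * z) ^+ n - 1) by ring.
  by rewrite h; ring.
have geo_le n z : cmod z = 1 -> cmod (geo n).[z] <= K + K.
  move=> z1; have x1 : cmod (v * z) = cmod v by rewrite cmodM z1 mulr1.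
  have h1 : 1 - cmod v <= cmod (1 - v * z).
    by have := cmodD (1 - v * z) (v * z); rewrite subrK cmod1 x1; lra.
  have h2 : cmod (geo n).[z] * cmod (1 - v * z) <= 2.
    rewrite -cmodM geoE (le_trans (cmodB _ _)) // cmod1 cmodX x1.
    by have := exprn_ile1 n v0 (ltW v1); lra.
  have h3 : cmod (geo n).[z] * (1 - cmod v) <= 2.
    by apply: le_trans h2; rewrite ler_wpM2l ?cmod_ge0.
  by rewrite -ler_pdivlMr in h3; [move: h3; rewrite -/K; lra|lra].
(* [geo n] is bounded by [2 K] uniformly in [n], so an error [t / (2 K)] in [F ^+ 2] costs at most
   [t] after multiplication. Each of the three required errors stays below [12 * t]. *)
pose t := Num.min (e / 12) (1 / 2).
have t0 : 0 < t by rewrite lt_min !divr_gt0.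
have te : 12 * t <= e by rewrite mulrC -ler_pdivlMr // ge_min lexx.
have t1 : 2 * t <= 1 by rewrite mulrC -ler_pdivlMr // ge_min lexx orbT.
have [n hn] : exists n, cmod v ^+ n <= t.
  have : geometric 1 (cmod v) @ \oo --> (0 : R).
    by apply: cvg_geometric; rewrite ger0_norm.
  move=> /cvgrPdist_lt/(_ _ t0)[N _ hN]; exists N.
  have := hN N (leqnn _); rewrite /geometric /= sub0r normrN mul1r => /ltW.
  by rewrite ger0_norm // exprn_ge0.
have d0 : 0 < t / (K + K) by rewrite divr_gt0 // addr_gt0.
have [H hH] := approximate_sqrt d0.
pose F := H \Po (v *: 'X).
pose G := ('X - w%:P) * geo n * F.
exists F, G => z z1.
have x1 : cmod (v * z) = cmod v by rewrite cmodM z1 mulr1.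
have FE : F.[z] = H.[v * z] by rewrite /F horner_comp !hornerE.
have GE : G.[z] = (z - w) * (geo n).[z] * F.[z] by rewrite /G !hornerE.
pose eta := F.[z] ^+ 2 - (1 - v * z).
have etaT : cmod eta <= t / (K + K) by rewrite /eta FE hH // x1 ltW.
have Teta : cmod ((geo n).[z] * eta) <= t.
  rewrite cmodM; apply: le_trans (ler_pM (cmod_ge0 _) (cmod_ge0 _) (geo_le n z z1) etaT) _.
  by rewrite mulrCA divff ?mulr1 // gt_eqF // addr_gt0.
have q1 : cmod ((v * z) ^+ n) <= t by rewrite cmodX x1.
have F2E : F.[z] ^+ 2 = (1 - v * z) + eta by rewrite /eta; ring.
have geoF2 : (geo n).[z] * F.[z] ^+ 2 = 1 - (v * z) ^+ n + (geo n).[z] * eta.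
  by rewrite F2E mulrDr geoE.
have refl := cmod_reflect w z1; rewrite -/v in refl.
have zw2 : cmod (z - w) <= 2 by have := cmodB z w; rewrite z1; lra.
have zw0 := cmod_ge0 (z - w).
have XE : ('X - w%:P).[z] = z - w by rewrite !hornerE.
rewrite XE; split.
- rewrite (_ : z - w - F.[z] * G.[z] = (z - w) * ((v * z) ^+ n - (geo n).[z] * eta)); last first.
    have -> : F.[z] * G.[z] = (z - w) * ((geo n).[z] * F.[z] ^+ 2) by rewrite GE; ring.
    by rewrite geoF2; ring.
  rewrite cmodM; have h := cmodB ((v * z) ^+ n) ((geo n).[z] * eta).
  have h' : cmod ((v * z) ^+ n - (geo n).[z] * eta) <= t + t by lra.
  apply: le_trans (ler_pM zw0 (cmod_ge0 _) zw2 h') _; lra.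
- rewrite -cmodX F2E; apply: le_trans (cmodD _ _) _; rewrite refl lerD2l.
  apply: le_trans etaT _; rewrite ler_pdivrMr; last by rewrite addr_gt0.
  have : e * 1 <= e * (K + K) by rewrite ler_wpM2l ?(ltW e0) //; lra.
  lra.
- have -> : cmod G.[z] ^+ 2 = cmod (z - w) * (cmod (z - w) * cmod (geo n).[z]) * cmod ((geo n).[z] * F.[z] ^+ 2).
    by rewrite GE !cmodM; ring.
  have h1 : cmod (z - w) * cmod (geo n).[z] <= 1 + t.
    rewrite -refl mulrC -cmodM geoE; apply: le_trans (cmodB _ _) _.
    by rewrite cmod1 lerD2l.
  have h2 : cmod ((geo n).[z] * F.[z] ^+ 2) <= 1 + 2 * t.
    rewrite geoF2; apply: le_trans (cmodD _ _) _.
    by have := cmodB 1 ((v * z) ^+ n); rewrite cmod1; lra.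
  have h3 := ler_pM (mulr_ge0 zw0 (cmod_ge0 _)) (cmod_ge0 _) h1 h2.
  rewrite -[leLHS]mulrA; apply: le_trans (ler_wpM2l zw0 h3) _.
  have h4 : (1 + t) * (1 + 2 * t) <= 1 + 4 * t.
    by have : (2 * t) * t <= 1 * t; [rewrite ler_wpM2r // ltW|lra].
  apply: le_trans (ler_wpM2l zw0 h4) _.
  have : cmod (z - w) * (4 * t) <= 2 * (4 * t) by rewrite ler_wpM2r // mulr_ge0 // ltW.
  lra.
Qed.

Lemma poly_approx_factorable (P : {poly C}) : approx_factorable P.
Proof.
have [r ->] := closed_field_poly_normal P.
rewrite -mul_polyC; apply: approx_factorableM; first exact: approx_factorableC.
elim: r => [|w r IH]; first by rewrite big_nil -polyC1; exact: approx_factorableC.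
rewrite big_cons; apply: approx_factorableM => //.
by case: (ltP (cmod w) 1) => h; [exact: approx_factorable_inner|exact: approx_factorable_outer].
Qed.

End ApproximateFactorization.

(** * The Poisson kernel: size, series and dyadic majorant *)

Section PoissonKernel.
Local Open Scope classical_set_scope.
Local Open Scope ring_scope.
Context {R : realType}.
Local Notation C := (R[i]).

Definition poisson (r t : R) : R := (1 - r ^+ 2) / cmod (1 - r%:C%C * e1 t) ^+ 2.

(** On [[0, 1]] the mean value theorem applies with derivative at least [cos 1]; on [[1, pi / 2]]
    sine increases and [s <= 2] accounts for the factor 1/2. *)
Lemma sin_lower_bound (s : R) : 0 <= s <= pi / 2 -> cos 1 / 2 * s <= sin s.
Proof.
move=> /andP[s0 sp].
have c1 := @cos1_gt0 R; have p1 := @pihalf_ge1 R; have p2 := @pihalf_lt2 R.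
have small (u : R) : 0 <= u <= 1 -> cos 1 * u <= sin u.
  move=> /andP[u0 u1]; move: u0; rewrite le_eqVlt => /orP[/eqP <-|u0].
    by rewrite mulr0 sin0.
  have cf : {within `[0, u], continuous (@sin R)}.
    by apply: continuous_subspaceT; exact: continuous_sin.
  have [c] := MVT u0 (fun t _ => is_derive_sin t) cf.
  rewrite in_itv /= => /andP[c0 cu]; rewrite sin0 !subr0 => ->.
  rewrite ler_wpM2r ?(ltW u0) //.
  have [->//|c1'] := eqVneq c 1.
  by rewrite ltW // ltr_cos ?in_itv /=; lra.
have [s1|s1] := leP s 1.
  apply: le_trans (small s _); last by rewrite s0.
  by rewrite ler_wpM2r //; lra.
apply: (@le_trans _ _ (sin 1)).
  apply: le_trans (small 1 _); last by rewrite ler01 lexx.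
  have : cos 1 * s <= cos 1 * 2 by rewrite ler_wpM2l ?(ltW c1) //; lra.
  lra.
have [//|_] := ltP (sin 1) (sin s); first exact: ltW.
by rewrite ltW // ltr_sin ?in_itv /=; lra.
Qed.

Lemma poisson_denominator (r t : R) :
  cmod (1 - r%:C%C * e1 t) ^+ 2 = (1 - r) ^+ 2 + 4 * r * sin (pi * t) ^+ 2.
Proof.
rewrite cmod_sqr /= /e1 /cexp /=.
have -> : 2 * pi * t = (pi * t) *+ 2 by rewrite mulr2n; ring.
rewrite cos_mulr2n sin_mulr2n mulr2n.
have := sin2cos2 (pi * t); rewrite -mulr_natr.
move: (sin _) (cos _) => s c sc.
apply/eqP; rewrite -subr_eq0.
rewrite [X in X == 0](_ : _ = (s ^+ 2 - (1 - c ^+ 2)) * (4 * r ^+ 2 * c ^+ 2 - 4 * r)); last by ring.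
by rewrite sc subrr mul0r.
Qed.

Lemma poisson_denominator_ge (r t : R) : 2^-1 <= r -> `|t| <= 2^-1 ->
  (1 - r) ^+ 2 + 2 * cos 1 ^+ 2 * t ^+ 2 <= cmod (1 - r%:C%C * e1 t) ^+ 2.
Proof.
move=> r2 t2; rewrite poisson_denominator lerD2l.
have c1 := @cos1_gt0 R; have p2 := @pi_ge2 R.
have -> : t ^+ 2 = `|t| ^+ 2 by rewrite -normrX ger0_norm // sqr_ge0.
have -> : sin (pi * t) ^+ 2 = sin (pi * `|t|) ^+ 2.
  by case: (ger0P t) => // _; rewrite mulrN sinN sqrrN.
have t0 := normr_ge0 t; move: (`|t|) t0 t2 => u u0 u2.
have h : cos 1 * u <= sin (pi * u).
  apply: le_trans (sin_lower_bound _); last first.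
    apply/andP; split; first by rewrite mulr_ge0 // pi_ge0.
    by rewrite ler_wpM2l // pi_ge0.
  have : cos 1 / 2 * (2 * u) <= cos 1 / 2 * (pi * u).
    by rewrite ler_wpM2l ?divr_ge0 ?(ltW c1) // ler_wpM2r.
  lra.
have h2 : (cos 1 * u) ^+ 2 <= sin (pi * u) ^+ 2.
  rewrite ler_sqr ?nnegrE //; first by rewrite mulr_ge0 // ltW.
  by apply: le_trans h; rewrite mulr_ge0 // ltW.
have h3 := sqr_ge0 (sin (pi * u)).
rewrite exprMn in h2; rewrite -(mulrA 2); move: (sin (pi * u) ^+ 2) (cos 1 ^+ 2 * u ^+ 2) h2 h3 => a b ba a0.
have : 2 * a <= 4 * r * a by rewrite ler_wpM2r //; lra.
lra.
Qed.

Lemma poisson_denominator_gt0 (r t : R) : 0 <= r < 1 -> 0 < cmod (1 - r%:C%C * e1 t).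
Proof.
move=> /andP[r0 r1].
have := cmodD (1 - r%:C%C * e1 t) (r%:C%C * e1 t).
rewrite subrK cmod1 cmodM cmod_real cmod_e1 ger0_norm // mulr1; lra.
Qed.

Lemma poisson_denominator_ge_dist (r t : R) : 0 <= r < 1 -> 1 - r <= cmod (1 - r%:C%C * e1 t).
Proof.
move=> /andP[r0 r1].
have := cmodD (1 - r%:C%C * e1 t) (r%:C%C * e1 t).
rewrite subrK cmod1 cmodM cmod_real cmod_e1 ger0_norm // mulr1; lra.
Qed.

Lemma poisson_ge0 (r t : R) : 0 <= r < 1 -> 0 <= poisson r t.
Proof.
move=> /andP[r0 r1]; rewrite divr_ge0 ?sqr_ge0 // subr_ge0 expr_le1 // ltW //.
Qed.

Lemma poisson_le_max (r t : R) : 0 <= r < 1 -> poisson r t <= 2 / (1 - r).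
Proof.
move=> r01; have /andP[r0 r1] := r01.
have d0 := poisson_denominator_gt0 t r01; have d1 := poisson_denominator_ge_dist t r01.
rewrite ler_pdivrMr ?exprn_gt0 //.
have dd : (1 - r) ^+ 2 <= cmod (1 - r%:C%C * e1 t) ^+ 2.
  by rewrite ler_sqr ?nnegrE ?cmod_ge0 //; lra.
apply: (@le_trans _ _ (2 / (1 - r) * (1 - r) ^+ 2)); last first.
  by rewrite ler_wpM2l // divr_ge0 //; lra.
rewrite (_ : 2 / (1 - r) * (1 - r) ^+ 2 = 2 * (1 - r)); last by field; lra.
nra.
Qed.

(* The tail of the geometric series of the Herglotz kernel. *)
Lemma poisson_series (r t : R) (K : nat) : 0 <= r < 1 ->
  cmod ((poisson r t)%:C%C - (\sum_(k < K) (r%:C%C * e1 t) ^+ k +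
     (\sum_(k < K) (r%:C%C * e1 t) ^+ k)^*%C - 1)) <= 2 * r ^+ K / (1 - r).
Proof.
move=> r01; have /andP[r0 r1] := r01.
set w := r%:C%C * e1 t; have d0 := poisson_denominator_gt0 t r01; rewrite -/w in d0.
have w0 : 1 - w != 0 by rewrite -cmod_gt0.
have ww : cmod w = r by rewrite /w cmodM cmod_real cmod_e1 ger0_norm // mulr1.
have sumE : \sum_(k < K) w ^+ k = (1 - w ^+ K) / (1 - w).
  apply: (mulIf w0); rewrite divfK //.
  by have := subrX1 w K => h; rewrite -[RHS]opprB h; ring.
have w0' : (1 - w)^*%C != 0 by rewrite conjc_eq0.
have PE : (poisson r t)%:C%C = (1 - w)^-1 + ((1 - w)^-1)^*%C - 1.
  rewrite /poisson -/w.
  have -> : ((1 - r ^+ 2) / cmod (1 - w) ^+ 2)%:C%C = (1 - r ^+ 2)%:C%C / (cmod (1 - w) ^+ 2)%:C%C.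
    by rewrite rmorphM fmorphV.
  rewrite -mul_conjc conjc_inv.
  have -> : (1 - r ^+ 2)%:C%C = 1 - w * w^*%C by rewrite mul_conjc ww rmorphB rmorph1.
  have cE : w^*%C = 1 - (1 - w)^*%C by rewrite rmorphB rmorph1 opprB addrC subrK.
  rewrite cE; move: ((1 - w)^*%C) w0' => v v0; field.
  by rewrite w0 v0.
rewrite PE sumE.
have -> : (1 - w)^-1 + ((1 - w)^-1)^*%C - 1 -
   ((1 - w ^+ K) / (1 - w) + ((1 - w ^+ K) / (1 - w))^*%C - 1) =
   w ^+ K / (1 - w) + (w ^+ K / (1 - w))^*%C.
  have -> : (1 - w ^+ K) / (1 - w) = (1 - w)^-1 - w ^+ K / (1 - w) by ring.
  by rewrite [((1 - w)^-1 - _)^*%C]rmorphB /=; ring.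
have h : cmod (w ^+ K / (1 - w)) <= r ^+ K / (1 - r).
  rewrite cmodM cmodX cmodV ww ler_wpM2l ?exprn_ge0 //.
  by rewrite lef_pV2 ?posrE ?subr_gt0 //; exact: poisson_denominator_ge_dist.
apply: le_trans (cmodD _ _) _; rewrite cmod_conj.
by apply: le_trans (lerD h h) _; rewrite le_eqVlt; apply/orP; left; apply/eqP; ring.
Qed.

Lemma poisson_measurable (r x : R) (D : set R) : measurable D -> 0 <= r < 1 ->
  measurable_fun D (fun y => poisson r (x - y)).
Proof.
move=> mD r01; apply: (measurable_funS measurableT) => //.
apply: continuous_measurable_fun => y.
have cc : ccontinuous (fun y : R => 1 - r%:C%C * e1 (x - y)).
  apply: ccontinuousB; first exact: ccontinuous_cst.
  apply: ccontinuousM; first exact: ccontinuous_cst.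
  rewrite (_ : (fun y => _) = (fun y => e1 x * e1 (-1 * y))).
    by apply: ccontinuousM; [exact: ccontinuous_cst|exact: ccontinuous_e1M].
  by apply/funext => z; rewrite -e1D mulN1r.
apply: cvgM; first exact: cvg_cst.
apply: cvgV; last exact: continuous_cmod_sqr cc y.
by rewrite expf_neq0 // gt_eqF // poisson_denominator_gt0.
Qed.

(** The kernel is of order [d / (d ^+ 2 + t ^+ 2)] with [d = 1 - r]. If [2 ^+ i * d] is the first
    dyadic radius above the modulus of [t], this is of order [2 ^- i] times the normalized indicator
    of the ball of that radius; beyond [eta] it is at most [d / eta ^+ 2]. Poisson averages are thus
    reduced to averages over balls. *)
Lemma poisson_dyadic : exists2 K : R, 0 < K & forall (r t eta : R) (I : nat),
  2^-1 <= r < 1 -> `|t| <= 2^-1 -> 0 < eta -> eta < 2 ^+ I * (1 - r) ->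
  poisson r t <= K * (\sum_(0 <= i < I.+1) 2^-1 ^+ i * ((2 ^+ i * (1 - r))^-1 *
      ((`|t| < 2 ^+ i * (1 - r))%R)%:R) + (1 - r) / eta ^+ 2).
Proof.
(* [k] is the smaller of the two coefficients in the lower bound of the denominator, which is
   therefore at least [k * (d ^+ 2 + t ^+ 2)]. *)
have c1 := @cos1_gt0 R; pose k := Num.min 1 (2 * cos 1 ^+ 2 : R).
have k0 : 0 < k by rewrite lt_min ltr01 mulr_gt0 // exprn_gt0.
have kn : k != 0 by rewrite gt_eqF.
exists (8 / k); first by rewrite divr_gt0.
move=> r t eta I /andP[r2 r1] t2 e0 eI.
set d := 1 - r; have d0 : 0 < d by rewrite /d; lra.
have dn : d != 0 by rewrite gt_eqF.
have t0 : 0 <= `|t| by [].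
have r01 : 0 <= r < 1 by apply/andP; split; lra.
have den : k * (d ^+ 2 + `|t| ^+ 2) <= cmod (1 - r%:C%C * e1 t) ^+ 2.
  apply: le_trans (poisson_denominator_ge r2 t2).
  rewrite -normrX (ger0_norm (sqr_ge0 t)) mulrDr -/d lerD //.
    by rewrite ler_piMl ?sqr_ge0 // ge_min lexx.
  by rewrite ler_wpM2r ?sqr_ge0 // ge_min lexx orbT.
have den0 : 0 < k * (d ^+ 2 + `|t| ^+ 2).
  by rewrite mulr_gt0 // ltr_pwDl ?sqr_ge0 // exprn_gt0.
have base : poisson r t <= 2 / k * (d / (d ^+ 2 + `|t| ^+ 2)).
  rewrite /poisson ler_pdivrMr; last by rewrite exprn_gt0 // poisson_denominator_gt0.
  have s0 : 0 < d ^+ 2 + `|t| ^+ 2 by rewrite -(pmulr_rgt0 _ k0).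
  have sn : d ^+ 2 + `|t| ^+ 2 != 0 by rewrite gt_eqF.
  apply: (@le_trans _ _ (2 / k * (d / (d ^+ 2 + `|t| ^+ 2)) * (k * (d ^+ 2 + `|t| ^+ 2)))).
    have -> : 2 / k * (d / (d ^+ 2 + `|t| ^+ 2)) * (k * (d ^+ 2 + `|t| ^+ 2)) = 2 * d.
      by field; rewrite kn sn.
    rewrite /d; nra.
  by rewrite ler_wpM2l // mulr_ge0 // ?divr_ge0 // ltW.
apply: le_trans base _.
have -> : 8 / k = 2 / k * 4 by field.
rewrite -[leRHS]mulrA ler_wpM2l ?divr_ge0 ?(ltW k0) //.
set T := \sum_(0 <= i < _) _.
have terms0 i : 0 <= 2^-1 ^+ i * ((2 ^+ i * d)^-1 * ((`|t| < 2 ^+ i * d)%R)%:R) :> R.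
  by rewrite mulr_ge0 ?exprn_ge0 ?invr_ge0 // mulr_ge0 // invr_ge0 mulr_ge0 ?exprn_ge0 // ltW.
have T0 : 0 <= T by apply: sumr_ge0 => i _; exact: terms0.
have de0 : 0 <= d / eta ^+ 2 by rewrite divr_ge0 ?sqr_ge0 // ltW.
have [te|te] := leP eta `|t|.
  apply: (@le_trans _ _ (d / eta ^+ 2)); last by lra.
  rewrite ler_wpM2l ?(ltW d0) // lef_pV2 ?posrE ?exprn_gt0 //.
    by rewrite ler_wpDl ?sqr_ge0 // ler_sqr ?nnegrE // ltW.
  by rewrite ltr_pwDl ?sqr_ge0 // exprn_gt0.
have ex : exists i, `|t| < 2 ^+ i * d by exists I; exact: lt_trans te eI.
(* The term of the least such [i] is enough: by minimality the modulus of [t] is at least half of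
   that radius, unless [i = 0], where [d ^+ 2] alone bounds the denominator from below. *)
case: (ex_minnP ex) => i ti imin.
have iI : (i <= I)%N by apply: imin; exact: lt_trans te eI.
apply: (@le_trans _ _ (4 * (2^-1 ^+ i * (2 ^+ i * d)^-1))); last first.
  rewrite ler_wpM2l //; apply: (@le_trans _ _ T); last by lra.
  have Ii : (i < I.+1)%N by [].
  rewrite /T big_mkord (bigD1 (Ordinal Ii)) //= ti mulr1 lerDl.
  by apply: sumr_ge0 => j _; exact: terms0.
have p2 : 2 ^+ i != 0 :> R by rewrite expf_neq0.
have -> : 4 * (2^-1 ^+ i * (2 ^+ i * d)^-1) = d / (2^-1 * 2 ^+ i * d) ^+ 2 :> R.
  by rewrite exprVn; field; rewrite p2 dn.
case: i ti imin {iI} p2 => [|i] ti imin p2.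
  rewrite expr0 mulr1 ler_wpM2l ?(ltW d0) // lef_pV2 ?posrE.
  - have := sqr_ge0 t; rewrite -normrX (ger0_norm (sqr_ge0 t)) exprMn; have := sqr_ge0 d; nra.
  - by rewrite ltr_pwDl ?sqr_ge0 // exprn_gt0.
  - by rewrite exprn_gt0 // mulr_gt0 // invr_gt0.
have ti' : 2 ^+ i * d <= `|t|.
  by rewrite leNgt; apply/negP => /imin; rewrite ltnn.
have -> : 2^-1 * 2 ^+ i.+1 * d = 2 ^+ i * d by rewrite exprS; field.
have q0 : 0 < 2 ^+ i * d by rewrite mulr_gt0 // exprn_gt0.
rewrite ler_wpM2l ?(ltW d0) // lef_pV2 ?posrE.
- by rewrite ler_wpDl ?sqr_ge0 // ler_sqr ?nnegrE // ltW.
- by rewrite ltr_pwDl ?sqr_ge0 // exprn_gt0.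
- by rewrite exprn_gt0.
Qed.

End PoissonKernel.

(** * Poisson averages controlled by averages over small balls *)

Section PoissonIntegral.
Local Open Scope classical_set_scope.
Local Open Scope ring_scope.
Context {R : realType}.
Local Notation mu := (@lebesgue_measure R).
Local Notation RI D f := (Rintegral mu D f).
Local Notation rI D f := (mu.-integrable D (EFin \o f)).

(** One full period centred at [x], so that [x - y] stays in the range where the kernel estimates
    hold. *)
Definition window (x : R) : set R := `[x - 2^-1, x - 2^-1 + 1]%classic.

Lemma windowP x y : window x y -> `|x - y| <= 2^-1.
Proof. by rewrite /window /= in_itv /= ler_norml => /andP[a b]; apply/andP; lra. Qed.

Lemma measurable_window x : measurable (window x).
Proof. exact: measurable_itv. Qed.

Lemma ball_window x h : h <= 2^-1 -> ball x h `<=` window x.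
Proof.
move=> h2 y; rewrite /ball /= /ball_ /window /= in_itv /= => xy.
have : `|x - y| <= 2^-1 by apply: le_trans h2; exact: ltW.
by rewrite ler_norml => /andP[a b]; apply/andP; lra.
Qed.

Lemma Rintegral_sum D (I : Type) (s : seq I) (f : I -> R -> R) : measurable D ->
  (forall i, rI D (f i)) ->
  rI D (fun x => \sum_(i <- s) f i x) /\
  RI D (fun x => \sum_(i <- s) f i x) = \sum_(i <- s) RI D (f i).
Proof.
move=> mD fI; elim: s => [|i s [IH1 IH2]].
  rewrite (_ : (fun x => _) = (fun=> 0)); last by apply/funext => x; rewrite big_nil.
  split; first exact: integrable0.
  by rewrite big_nil /Rintegral integral0.
rewrite (_ : (fun x => _) = (fun x => f i x + \sum_(i <- s) f i x)); last first.
  by apply/funext => x; rewrite big_cons.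
split; first exact: RintegrableD.
by rewrite RintegralD // big_cons IH2.
Qed.

(** The dyadic majorant yields averages over balls of radius [2 ^+ i * d <= 2 * eta], each at most
    [eps] and weighted by [2 ^- i], plus the part beyond [eta]. The weights add up to at most 2, and
    [eta <= 1/4] keeps the balls inside the window. *)
Lemma poisson_average : exists2 K : R, 0 < K &
  forall (r eta eps x : R) (phi : R -> R), 2^-1 <= r < 1 -> 1 - r <= eta <= 4^-1 ->
  0 <= eps -> (forall y, 0 <= phi y) -> rI (window x) phi ->
  (forall h, 0 < h -> h <= 2 * eta -> RI (ball x h) phi <= eps * h) ->
  RI (window x) (fun y => poisson r (x - y) * phi y) <=
    K * (eps + (1 - r) / eta ^+ 2 * RI (window x) phi).
Proof.
have [K K0 hK] := @poisson_dyadic R.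
exists (2 * K); first by rewrite mulr_gt0.
move=> r eta eps x phi r01 /andP[re e4] eps0 phi0 phiI hball.
have /andP[r2 r1] := r01.
have r01' : 0 <= r < 1 by apply/andP; split; lra.
set d := 1 - r in re *; have d0 : 0 < d by rewrite /d; lra.
have e0 : 0 < eta by lra.
have mw := measurable_window x.
have ex : exists I, eta < 2 ^+ I * d.
  exists (Num.truncn (eta / d)).+1.
  rewrite -ltr_pdivrMr //; apply: lt_trans (truncnS_gt _) _.
  by rewrite -natrX ltr_nat ltn_expl.
(* Minimality of [I] keeps every radius used at most [2 * eta]. *)
case: (ex_minnP ex) => I eI Imin.
have I2 i : (i <= I)%N -> 2 ^+ i * d <= 2 * eta.
  case: I eI Imin => [|I] eI Imin.
    by rewrite leqn0 => /eqP ->; rewrite expr0; lra.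
  rewrite leq_eqVlt ltnS => /orP[/eqP ->|iI].
    rewrite exprS -mulrA ler_wpM2l // leNgt; apply/negP => /Imin; by rewrite ltnn.
  apply: (@le_trans _ _ (2 ^+ I * d)).
    by rewrite ler_wpM2r ?(ltW d0) // ler_weXn2l // ler1n.
  have : 2 ^+ I * d <= eta by rewrite leNgt; apply/negP => /Imin; rewrite ltnn.
  lra.
pose f i y := 2^-1 ^+ i * ((2 ^+ i * d)^-1 * (phi \_ (ball x (2 ^+ i * d))) y) : R.
have mb i : measurable (ball x (2 ^+ i * d)) by exact: measurable_ball.
have pI i : rI (window x) (phi \_ (ball x (2 ^+ i * d))).
  apply: (@le_Rintegrable _ _ _ phi) => //.
  - have /Rintegrable_measurable mphi := phiI.
    apply/measurable_restrict => //; first exact: measurable_funS mphi.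
  - by move=> y _; rewrite patchE; case: ifP => _; rewrite ?ger0_norm ?normr0.
have pE i : (i <= I)%N -> RI (window x) (phi \_ (ball x (2 ^+ i * d))) <= eps * (2 ^+ i * d).
  move=> iI; rewrite -Rintegral_mkcondr (_ : _ `&` _ = ball x (2 ^+ i * d)).
    by apply: hball; [rewrite mulr_gt0 // exprn_gt0|exact: I2].
  by rewrite setIC; apply/setIidl/ball_window; have := I2 _ iI; lra.
have fI i : rI (window x) (f i) by do 2 apply: RintegrableZl => //.
have fE i : (i <= I)%N -> RI (window x) (f i) <= 2^-1 ^+ i * eps.
  move=> iI; rewrite /f RintegralZl //; last exact: RintegrableZl.
  rewrite RintegralZl // ler_wpM2l ?exprn_ge0 // mulrC ler_pdivrMr ?pE //.
  by rewrite mulr_gt0 // exprn_gt0.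
have [SI SE] := Rintegral_sum (index_iota 0 I.+1) mw fI.
have gI : rI (window x) (fun y => K * (\sum_(i <- index_iota 0 I.+1) f i y + d / eta ^+ 2 * phi y)).
  by apply: RintegrableZl => //; apply: RintegrableD => //; exact: RintegrableZl.
apply: (@le_trans _ _ (RI (window x) (fun y => K * (\sum_(i <- index_iota 0 I.+1) f i y + d / eta ^+ 2 * phi y)))).
  have pw y : window x y -> poisson r (x - y) * phi y <=
      K * (\sum_(i <- index_iota 0 I.+1) f i y + d / eta ^+ 2 * phi y).
    move=> wy; have h := hK r (x - y) eta I r01 (windowP wy) e0 eI.
    apply: le_trans (ler_wpM2r (phi0 y) h) _; rewrite -/d -[leLHS]mulrA ler_wpM2l ?(ltW K0) //.
    rewrite mulrDl lerD // mulr_suml; apply: ler_sum => i _; rewrite /f -!mulrA.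
    rewrite ler_wpM2l ?exprn_ge0 // ler_wpM2l ?invr_ge0 ?mulr_ge0 ?exprn_ge0 ?(ltW d0) //.
    rewrite patchE /ball /= /ball_ /=; case: ifP; case: ltP => //=; rewrite ?mul1r ?mul0r //.
      by move=> h1 /negP[]; rewrite inE.
  have PphiI : rI (window x) (fun y => poisson r (x - y) * phi y).
    apply: (@le_Rintegrable _ _ _ (fun y => K * (\sum_(i <- index_iota 0 I.+1) f i y + d / eta ^+ 2 * phi y))) => //.
      apply: measurable_funM; first exact: poisson_measurable.
      exact: Rintegrable_measurable.
    by move=> y wy; rewrite ger0_norm ?pw // mulr_ge0 // poisson_ge0.
  apply: le_Rintegral; [exact: mw|exact: PphiI|exact: gI|exact: pw].
rewrite RintegralZl //; last by apply: RintegrableD => //; exact: RintegrableZl.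
rewrite RintegralD //; last exact: RintegrableZl.
rewrite SE RintegralZl // [2 * K]mulrC -[leRHS]mulrA ler_wpM2l ?(ltW K0) //.
have S2 : \sum_(i <- index_iota 0 I.+1) RI (window x) (f i) <= 2 * eps.
  apply: (@le_trans _ _ (\sum_(i <- index_iota 0 I.+1) 2^-1 ^+ i * eps)).
    by rewrite big_seq_cond [leRHS]big_seq_cond; apply: ler_sum => i; rewrite andbT mem_index_iota ltnS => /andP[_ /fE].
  by rewrite -mulr_suml ler_wpM2r // half_pow_sum_le2.
have : 0 <= d / eta ^+ 2 * RI (window x) phi.
  by rewrite mulr_ge0 ?divr_ge0 ?sqr_ge0 ?(ltW d0) //; apply: Rintegral_ge0.
lra.
Qed.

End PoissonIntegral.

(** * Poisson integrals and their Fourier expansion *)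

Section PoissonRepresentation.
Local Open Scope classical_set_scope.
Local Open Scope ring_scope.
Context {R : realType}.
Local Notation C := (R[i]).
Local Notation mu := (@lebesgue_measure R).
Local Notation Re := (@complex.Re R).
Local Notation Im := (@complex.Im R).
Local Notation RI D f := (Rintegral mu D f).

Definition poisson_integral (r : R) (g : R -> C) (x : R) : C :=
  cintegral (window x) (fun y => (poisson r (x - y))%:C%C * g y).

Lemma geometric_small (r M e : R) : 0 <= r < 1 -> 0 < e ->
  exists N, forall K, (N <= K)%N -> r ^+ K * M <= e.
Proof.
move=> /andP[r0 r1] e0; have M1 : 0 < `|M| + 1 by rewrite ltr_wpDl.
have t0 : 0 < e / (`|M| + 1) by rewrite divr_gt0.
have : geometric 1 r @ \oo --> (0 : R) by apply: cvg_geometric; rewrite ger0_norm.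
move=> /cvgrPdist_lt/(_ _ t0)[N _ hN]; exists N => K NK.
have := hN K NK; rewrite /geometric /= sub0r normrN mul1r => /ltW.
rewrite ger0_norm ?exprn_ge0 // ler_pdivlMr //; apply: le_trans.
by rewrite ler_wpM2l ?exprn_ge0 // (le_trans (ler_norm _)) // lerDl.
Qed.

Lemma measurable_poisson_complex (r x : R) : 0 <= r < 1 ->
  measurable_fun (window x) (Re \o (fun y => (poisson r (x - y))%:C%C)) /\
  measurable_fun (window x) (Im \o (fun y => (poisson r (x - y))%:C%C)).
Proof.
move=> r01; split; last exact: measurable_cst.
by apply: poisson_measurable => //; exact: measurable_window.
Qed.

Lemma poisson_integrable (r x : R) (g : R -> C) : 0 <= r < 1 ->
  cintegrable (window x) g ->
  cintegrable (window x) (fun y => (poisson r (x - y))%:C%C * g y).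
Proof.
move=> r01 gI; have [m1 m2] := measurable_poisson_complex x r01.
apply: (@cintegrableM_bounded _ _ _ _ (2 / (1 - r))) => //; first exact: measurable_window.
move=> y _; rewrite cmod_real ger0_norm ?poisson_ge0 //; exact: poisson_le_max.
Qed.

Definition window_coef (x : R) (g : R -> C) (k : int) : C :=
  cintegral (window x) (fun y => g y * echar (- k) y).

Lemma echar_integrable (x : R) (g : R -> C) (k : int) : cintegrable (window x) g ->
  cintegrable (window x) (fun y => g y * echar k y).
Proof.
move=> gI; rewrite (_ : (fun y => _) = (fun y => echar k y * g y)); last first.
  by apply/funext => y; rewrite mulrC.
have [m1 m2] := ccontinuous_measurable (measurable_window x) (ccontinuous_echar k).
apply: (@cintegrableM_bounded _ _ _ _ 1) => //; first exact: measurable_window.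
by move=> y _; rewrite cmod_echar.
Qed.

(** The truncated Herglotz series is integrated term by term: nonnegative frequencies of [g] go with
    powers of [r e(x)], nonpositive ones with their conjugates. The mean is subtracted because both
    sums contain [k = 0]. *)
Lemma poisson_integral_series (r x : R) (g : R -> C) (K : nat) : 0 <= r < 1 ->
  cintegrable (window x) g ->
  cmod (poisson_integral r g x -
    (\sum_(k < K) (r%:C%C * e1 x) ^+ k * window_coef x g k +
     \sum_(k < K) ((r%:C%C * e1 x) ^+ k)^*%C * window_coef x g (- k%:Z) -
     window_coef x g 0)) <= 2 * r ^+ K / (1 - r) * RI (window x) (fun y => cmod (g y)).
Proof.
move=> r01 gI; have mw := measurable_window x.
pose w y := r%:C%C * e1 (x - y).
pose T y := \sum_(k < K) w y ^+ k + (\sum_(k < K) w y ^+ k)^*%C - 1.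
have wE y k : w y ^+ k = (r%:C%C * e1 x) ^+ k * echar (- k%:Z) y.
  by rewrite /w e1D mulrA exprMn /echar mulrNz mulNr -mulrN e1_natM.
have TgE y : T y * g y = \sum_(k < K) (r%:C%C * e1 x) ^+ k * (g y * echar (- k%:Z) y) +
    \sum_(k < K) ((r%:C%C * e1 x) ^+ k)^*%C * (g y * echar k%:Z y) - g y * echar 0 y.
  rewrite /T mulrBl mulrDl mul1r echar0 mulr1 conjc_sum !mulr_suml.
  congr (_ + _ - _); apply: eq_bigr => k _; rewrite wE; first by ring.
  by rewrite conjcM echarN conjcK; ring.
have I1 k : cintegrable (window x) (fun y => g y * echar k y) := echar_integrable k gI.
have S1 : cintegrable (window x) (fun y => \sum_(k < K) (r%:C%C * e1 x) ^+ k * (g y * echar (- k%:Z) y)).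
  by apply: cintegrable_sum => // k _; exact: cintegrableZ.
have S2 : cintegrable (window x) (fun y => \sum_(k < K) ((r%:C%C * e1 x) ^+ k)^*%C * (g y * echar k%:Z y)).
  by apply: cintegrable_sum => // k _; exact: cintegrableZ.
have TI : cintegrable (window x) (fun y => T y * g y).
  rewrite (_ : (fun y => _) = (fun y => \sum_(k < K) (r%:C%C * e1 x) ^+ k * (g y * echar (- k%:Z) y) +
    \sum_(k < K) ((r%:C%C * e1 x) ^+ k)^*%C * (g y * echar k%:Z y) - g y * echar 0 y)).
    by apply: cintegrableB => //; exact: cintegrableD.
  by apply/funext.
have -> : \sum_(k < K) (r%:C%C * e1 x) ^+ k * window_coef x g k +
     \sum_(k < K) ((r%:C%C * e1 x) ^+ k)^*%C * window_coef x g (- k%:Z) -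
     window_coef x g 0 = cintegral (window x) (fun y => T y * g y).
  transitivity (cintegral (window x) (fun y => \sum_(k < K) (r%:C%C * e1 x) ^+ k * (g y * echar (- k%:Z) y) +
    \sum_(k < K) ((r%:C%C * e1 x) ^+ k)^*%C * (g y * echar k%:Z y) - g y * echar 0 y)).
    rewrite cintegralB //; last exact: cintegrableD.
    rewrite cintegralD // !cintegral_sum //; last 2 first.
    - by move=> k _; exact: cintegrableZ.
    - by move=> k _; exact: cintegrableZ.
    congr (_ + _ - _).
    - by apply: eq_bigr => k _; rewrite cintegralZ.
    - by apply: eq_bigr => k _; rewrite cintegralZ // /window_coef opprK.
  by apply: eq_cintegral => y _; rewrite TgE.
have PI1 := poisson_integrable r01 gI.
rewrite /poisson_integral -cintegralB //.
apply: le_trans (cmod_cintegral_le mw (cintegrableB mw PI1 TI)) _.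
have nI := cintegrable_cmod mw gI.
rewrite -RintegralZl //; apply: le_Rintegral => //.
- by apply: cintegrable_cmod => //; exact: cintegrableB.
- exact: RintegrableZl.
- by move=> y _; rewrite -mulrBl cmodM ler_wpM2r ?cmod_ge0 // /T; exact: poisson_series.
Qed.

Lemma cintegrable_window_continuous (x : R) (g : R -> C) : ccontinuous g -> cintegrable (window x) g.
Proof. exact: ccontinuous_cintegrable. Qed.

Lemma ccontinuous_poly_e1 (p : {poly C}) : ccontinuous (fun x => p.[e1 x]).
Proof.
rewrite (_ : (fun x => _) = (fun x => \sum_(i < size p) p`_i * echar i x)).
  by apply: ccontinuous_sum => i _; apply: ccontinuousM; [exact: ccontinuous_cst|exact: ccontinuous_echar].
by apply/funext => x; rewrite horner_coef; apply: eq_bigr => i _; rewrite echar_nat.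
Qed.

Lemma window_coef_echar (x : R) (m k : int) : window_coef x (echar m) k = (k == m)%:R.
Proof.
rewrite /window_coef (@eq_cintegral _ _ _ (echar (m - k))) => [|y _]; last by rewrite -echarD.
by rewrite cintegral_echar subr_eq0 eq_sym.
Qed.

(** Orthogonality leaves a single power in the first sum, the conjugate sum cancels against the
    subtracted mean, and the truncation error tends to 0. *)
Lemma poisson_integral_echar (r x : R) (m : nat) : 0 <= r < 1 ->
  poisson_integral r (echar m) x = (r%:C%C * e1 x) ^+ m.
Proof.
move=> r01; apply: eq_of_cmod_le => e e0.
have gI : cintegrable (window x) (echar m).
  by apply: cintegrable_window_continuous; exact: ccontinuous_echar.
set M := RI (window x) (fun y => cmod (echar m y)).
have [N hN] := geometric_small (2 / (1 - r) * M) r01 e0.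
have := @poisson_integral_series r x (echar m) (maxn N m.+1) r01 gI.
set K := maxn N m.+1.
have mK : (m < K)%N by rewrite leq_maxr.
rewrite (bigD1 (Ordinal mK)) //= window_coef_echar eqxx mulr1 big1 ?addr0; last first.
  move=> k km; rewrite window_coef_echar; case: eqP => [[] e'|_]; last by rewrite mulr0.
  by move: km; rewrite -val_eqE /= e' eqxx.
rewrite window_coef_echar.
have -> : \sum_(k < K) ((r%:C%C * e1 x) ^+ k)^*%C * window_coef x (echar m) (- k%:Z) = (0 == m%:Z)%:R.
  have K0 : (0 < K)%N by apply: leq_trans mK.
  rewrite (bigD1 (Ordinal K0)) // expr0 conjc1 mul1r oppr0 window_coef_echar big1 /= ?addr0 // => k k0.
  rewrite window_coef_echar; case: eqP => [e'|_]; last by rewrite mulr0.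
  by move: k0; rewrite -val_eqE /=; lia.
rewrite addrK => h; apply: le_trans h _; apply: le_trans (hN K (leq_maxl _ _)).
by rewrite le_eqVlt; apply/orP; left; apply/eqP; rewrite -/K -/M; clearbody M K; ring.
Qed.

Lemma poisson_integral_poly (r x : R) (p : {poly C}) : 0 <= r < 1 ->
  poisson_integral r (fun y => p.[e1 y]) x = p.[r%:C%C * e1 x].
Proof.
move=> r01; have mw := measurable_window x.
have eI (i : nat) : cintegrable (window x) (fun y => (poisson r (x - y))%:C%C * echar i y).
  by apply: poisson_integrable => //; apply: cintegrable_window_continuous; exact: ccontinuous_echar.
transitivity (cintegral (window x) (fun y => \sum_(i < size p) p`_i * ((poisson r (x - y))%:C%C * echar i y))).
  apply: eq_cintegral => y _; rewrite horner_coef mulr_sumr; apply: eq_bigr => i _.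
  by rewrite echar_nat; ring.
rewrite cintegral_sum //; last by move=> i _; exact: cintegrableZ.
rewrite horner_coef; apply: eq_bigr => i _.
by rewrite cintegralZ // -poisson_integral_echar.
Qed.

Lemma poisson_integral_cst (r x : R) (c : C) : 0 <= r < 1 ->
  poisson_integral r (fun=> c) x = c.
Proof.
move=> r01; rewrite -[RHS](hornerC c (r%:C%C * e1 x)) -poisson_integral_poly //.
by apply: eq_cintegral => y _; rewrite hornerC.
Qed.

Lemma poisson_integralB (r x : R) (g h : R -> C) : 0 <= r < 1 ->
  cintegrable (window x) g -> cintegrable (window x) h ->
  poisson_integral r (fun y => g y - h y) x = poisson_integral r g x - poisson_integral r h x.
Proof.
move=> r01 gI hI; have mw := measurable_window x.
rewrite /poisson_integral -cintegralB //; try exact: poisson_integrable.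
by apply: eq_cintegral => y _; rewrite mulrBr.
Qed.

Lemma cmod_poisson_integral_le (r x : R) (g : R -> C) : 0 <= r < 1 ->
  cintegrable (window x) g ->
  cmod (poisson_integral r g x) <= RI (window x) (fun y => poisson r (x - y) * cmod (g y)).
Proof.
move=> r01 gI; have mw := measurable_window x.
apply: le_trans (cmod_cintegral_le mw (poisson_integrable r01 gI)) _.
rewrite le_eqVlt; apply/orP; left; apply/eqP; apply: eq_Rintegral => y _.
by rewrite cmodM cmod_real ger0_norm // poisson_ge0.
Qed.

Lemma cmod_poisson_integral_le_L1 (r x : R) (g : R -> C) : 0 <= r < 1 ->
  cintegrable (window x) g ->
  cmod (poisson_integral r g x) <= 2 / (1 - r) * RI (window x) (fun y => cmod (g y)).
Proof.
move=> r01 gI; have mw := measurable_window x.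
have nI := cintegrable_cmod mw gI.
apply: le_trans (cmod_poisson_integral_le r01 gI) _; rewrite -RintegralZl //.
have pw y : poisson r (x - y) * cmod (g y) <= 2 / (1 - r) * cmod (g y).
  by rewrite ler_wpM2r ?cmod_ge0 // poisson_le_max.
apply: le_Rintegral => //; last exact: RintegrableZl.
apply: (@le_Rintegrable _ _ _ (fun y => 2 / (1 - r) * cmod (g y))) => //.
- apply: measurable_funM; first exact: poisson_measurable.
  exact: Rintegrable_measurable.
- by move=> y _; rewrite ger0_norm ?pw // mulr_ge0 ?cmod_ge0 // poisson_ge0.
- exact: RintegrableZl.
Qed.

(** Constants are reproduced, so [poisson_average] applies to [cmod (g - c)]. It serves continuous
    [g] for uniform approximation, and Lebesgue points for radial limits. *)
Lemma poisson_integral_approx : exists2 K : R, 0 < K &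
  forall (r eta eps x : R) (g : R -> C) (c : C), 2^-1 <= r < 1 -> 1 - r <= eta <= 4^-1 ->
  0 <= eps -> cintegrable (window x) g ->
  (forall h, 0 < h -> h <= 2 * eta -> RI (ball x h) (fun y => cmod (g y - c)) <= eps * h) ->
  cmod (poisson_integral r g x - c) <=
    K * (eps + (1 - r) / eta ^+ 2 * RI (window x) (fun y => cmod (g y - c))).
Proof.
have [K K0 hK] := @poisson_average R; exists K => // r eta eps x g c r01 hr eps0 gI hb.
have r01' : 0 <= r < 1 by have /andP[a b] := r01; apply/andP; split; lra.
have mw := measurable_window x.
have cI : cintegrable (window x) (fun=> c) by exact: cintegrable_cst.
have dI := cintegrableB mw gI cI.
rewrite -{1}(poisson_integral_cst x c r01') -poisson_integralB //.
apply: le_trans (cmod_poisson_integral_le r01' dI) _.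
have nI := cintegrable_cmod mw dI.
exact: (hK r eta eps x (fun y => cmod (g y - c)) r01 hr eps0 (fun y => cmod_ge0 _) nI hb).
Qed.

End PoissonRepresentation.

(** * Uniform approximation on the circle by harmonic polynomials *)

Section UniformApproximation.
Local Open Scope classical_set_scope.
Local Open Scope ring_scope.
Context {R : realType}.
Local Notation C := (R[i]).
Local Notation mu := (@lebesgue_measure R).
Local Notation RI D f := (Rintegral mu D f).
Local Notation rI D f := (mu.-integrable D (EFin \o f)).

(** Only [x] is confined to the compact interval; [y] may leave it, which spares a discussion of the
    endpoints. *)
Lemma heine_ccontinuous (U : R -> C) (a b e : R) : ccontinuous U -> 0 < e ->
  exists2 eta : R, 0 < eta & forall x y, a <= x <= b -> `|x - y| < eta -> cmod (U x - U y) <= e.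
Proof.
move=> /ccontinuousP cU e0.
pose P (i x : R) := forall y, `|x - y| < i -> cmod (U x - U y) <= e.
have /compact_near_coveringP cov := @segment_compact R a b.
have e2 : 0 < e / 2 by rewrite divr_gt0.
have := cov R (0 : R)^'+ P _.
case.
  move=> x _; have /nbhs_ballP[d /= d0 hd] := cU x _ e2.
  have d2 : 0 < d / 2 by rewrite divr_gt0.
  exists (ball x (d / 2), [set i : R | i < d / 2]) => /=.
    split; first exact: nbhsx_ballx.
    exact: nbhs_right_lt.
  move=> [x' i] /= [xx' id] y x'y.
  have bx : ball x d x' by apply: le_ball xx'; lra.
  have by' : ball x d y.
    rewrite /ball /= /ball_; have := ler_normD (x - x') (x' - y).
    rewrite addrA subrK; move: xx'; rewrite /ball /= /ball_; lra.
  have := hd _ bx; have := hd _ by'; have := cmod_dist_triangle (U x') (U x) (U y).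
  rewrite [cmod (U x' - U x)]cmod_distrC; lra.
move=> d /= d0 hd; exists (d / 2); first by rewrite divr_gt0.
move=> x y xab; apply: (hd (d / 2)) => //=.
- by rewrite sub0r normrN gtr0_norm; lra.
- by rewrite divr_gt0.
Qed.

Lemma ccontinuous_bounded (U : R -> C) (a b : R) : ccontinuous U ->
  exists2 M : R, 0 <= M & forall x, a <= x <= b -> cmod (U x) <= M.
Proof.
move=> cU; have [ab|ba] := leP a b; last first.
  by exists 0 => // x /andP[ax xb]; have := le_trans ax xb; rewrite leNgt ba.
have cM : {within `[a, b], continuous (fun x => cmod (U x))}.
  by apply: continuous_subspaceT; exact: ccontinuous_cmod.
have [c _ hc] := EVT_max ab cM.
by exists (cmod (U c)); [exact: cmod_ge0|move=> x xab; apply: hc; rewrite in_itv].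
Qed.

Lemma Rintegral_shift1 (f : R -> R) (a b : R) : a <= b -> continuous f ->
  (forall x, f (x + 1) = f x) -> RI `[a + 1, b + 1] f = RI `[a, b] f.
Proof.
move=> ab cf fp; pose F (x : R) := x + 1.
have dF x : is_derive x (1 : R) F 1.
  by apply: is_derive_eq; rewrite addr0.
have F1 : derive1 F = cst 1.
  by apply/funext => x; rewrite derive1E; have [_ ->] := dF x.
have cF x : {for x, continuous F} by apply: cvgD; [exact: cvg_id|exact: cvg_cst].
rewrite /Rintegral (@integration_by_substitution_increasing _ F f a b) //.
- by congr fine; apply: eq_integral => x _ /=; rewrite F1; congr EFin; rewrite -[RHS]mulr1; congr (_ * _); exact: fp.
- by move=> x y _ _ xy; rewrite /F ltrD2r.
- by move=> x _; rewrite F1; exact: cvg_cst.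
- by rewrite F1; exact: is_cvg_cst.
- by rewrite F1; exact: is_cvg_cst.
- split => [x _||]; first by have [] := dF x.
  + by apply: cvg_at_right_filter; exact: cF.
  + by apply: cvg_at_left_filter; exact: cF.
- exact: continuous_subspaceT.
Qed.

Lemma Rintegral_split (f : R -> R) (a b c : R) : a <= b -> b <= c -> continuous f ->
  RI `[a, c] f = RI `[a, b] f + RI `[b, c] f.
Proof.
move=> ab bc cf.
have fI s t : rI `[s, t] f by exact: continuous_Rintegrable.
have := @Rintegral_itvB _ f (BLeft a) (BRight c) b (fI a c).
rewrite !bnd_simp => /(_ ab bc) h.
rewrite -(@Rintegral_itv_obnd_cbnd _ b (BRight c) f); first by rewrite -h addrC subrK.
by apply: integrableS (fI b c) => //; apply: subset_itvr; rewrite bnd_simp.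
Qed.

Lemma Rintegral_period (f : R -> R) (s : R) : 0 <= s <= 1 -> continuous f ->
  (forall x, f (x + 1) = f x) -> RI `[s, s + 1] f = RI `[0, 1] f.
Proof.
move=> /andP[s0 s1] cf fp.
rewrite (@Rintegral_split f s 1 (s + 1)) //; last by lra.
rewrite (@Rintegral_split f 0 s 1) // addrC; congr (_ + _).
by rewrite -{1}[1]add0r Rintegral_shift1.
Qed.

(** The turn is parametrized from 1/2 to 3/2 so that the window around such an [x] lies in [[0, 2]],
    the interval on which bounds and uniform continuity are taken. *)
Lemma unit_circle_e1 (z : C) : cmod z = 1 -> exists2 x : R, 2^-1 <= x <= 1 + 2^-1 & z = e1 x.
Proof.
case: z => a b zz.
have ab : a ^+ 2 + b ^+ 2 = 1 by have := cmod_sqr (a +i* b)%C; rewrite zz expr1n.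
have a1 : -1 <= a <= 1.
  by rewrite -ler_norml -sqrtr_sqr -sqrtr1 ler_wsqrtr //; have := sqr_ge0 b; lra.
have t0 := acos_ge0 a1; have t1 := acos_lepi a1.
have ca : cos (acos a) = a by apply: acosK; rewrite in_itv.
have sa : sin (acos a) = `|b|.
  by rewrite sin_acos // (_ : 1 - a ^+ 2 = b ^+ 2) ?sqrtr_sqr //; lra.
have p0 := @pi_gt0 R; have pn : pi != 0 :> R by rewrite gt_eqF.
have hx : acos a / (2 * pi) <= 2^-1 by rewrite ler_pdivrMr ?mulr_gt0 //; lra.
have hx0 : 0 <= acos a / (2 * pi) by rewrite divr_ge0 // mulr_ge0 // ltW.
have [b0|b0] := leP 0 b.
- exists (acos a / (2 * pi) + 1); first by apply/andP; lra.
  rewrite e1D e1_1 mulr1 /e1 /cexp (_ : 2 * pi * (acos a / (2 * pi)) = acos a); last by rewrite mulrC divfK // mulf_neq0.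
  by rewrite ca sa ger0_norm.
- exists (- (acos a / (2 * pi)) + 1); first by apply/andP; lra.
  rewrite e1D e1_1 mulr1 /e1 /cexp (_ : 2 * pi * - (acos a / (2 * pi)) = - acos a); last by rewrite mulrN mulrC divfK // mulf_neq0.
  by rewrite cosN sinN ca sa ltr0_norm // opprK.
Qed.

(** [p] and the conjugate of [q] are the truncated analytic and antianalytic halves of the Poisson
    integral of [u] at a radius close to 1. The coefficients of [q] are multiples of conjugated
    moments against [echar k] with [k > 0], so vanishing moments leave a polynomial in [z] alone. *)
Lemma harmonic_poly_approx (u : C -> C) (e : R) :
  ccontinuous (fun x => u (e1 x)) -> 0 < e ->
  exists p q : {poly C}, [/\ q`_0 = 0,
    (forall k : nat, (0 < k)%N -> cintegral `[0, 1] (fun x => u (e1 x) * echar k x) = 0) -> q = 0 &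
    forall z, cmod z = 1 -> cmod (u z - (p.[z] + (q.[z])^*%C)) <= e].
Proof.
move=> cU e0; set U := fun x => u (e1 x) in cU.
have Uper x : U (x + 1) = U x by rewrite /U e1_periodic.
pose hat (k : int) := cintegral `[0, 1] (fun x => U x * echar (- k) x).
have [K K0 hK] := @poisson_integral_approx R.
have [M M0 hM] := ccontinuous_bounded 0 2 cU.
have e8 : 0 < e / (8 * K) by rewrite divr_gt0 // mulr_gt0.
have [eta' eta'0 heta] := heine_ccontinuous 0 2 cU e8.
pose eta := Num.min (eta' / 2) 4^-1.
have eta0 : 0 < eta by rewrite lt_min; apply/andP; split; [rewrite divr_gt0|rewrite invr_gt0].
have eta4 : eta <= 4^-1 by rewrite ge_min lexx orbT.
have etah : 2 * eta <= eta' by rewrite mulrC -ler_pdivlMr // ge_min lexx.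
(* The last bound keeps the part of the kernel beyond [eta] below [e / 4]; uniform continuity gives
   another [e / 4], and the truncation below gets [e / 2]. *)
pose d := Num.min (Num.min 2^-1 eta) (e * eta ^+ 2 / (8 * K * (M + 1))).
have KM : 0 < 8 * K * (M + 1) by rewrite !mulr_gt0 //; lra.
have d0 : 0 < d.
  rewrite lt_min; apply/andP; split; last by rewrite divr_gt0 // mulr_gt0 // exprn_gt0.
  by rewrite lt_min; apply/andP; split=> //; rewrite invr_gt0.
have d2 : d <= 2^-1 by rewrite ge_min; apply/orP; left; rewrite ge_min lexx.
have deta : d <= eta by rewrite ge_min; apply/orP; left; rewrite ge_min lexx orbT.
have dK : d * (8 * K * (M + 1)) <= e * eta ^+ 2 by rewrite -ler_pdivlMr // ge_min lexx orbT.
pose r := 1 - d.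
have r01 : 0 <= r < 1 by apply/andP; rewrite /r; lra.
have [N0 hN0] := geometric_small (2 / (1 - r) * M) r01 (divr_gt0 e0 (ltr0Sn R 1)).
(* At least one term, so that the constant coefficient can be split off from the conjugate sum. *)
pose N := N0.+1.
pose p : {poly C} := \poly_(k < N) (r%:C%C ^+ k * hat k).
pose q : {poly C} := \poly_(k < N) (if k == 0%N then 0 else (r%:C%C ^+ k * hat (- k%:Z))^*%C).
exists p, q; split.
- by rewrite coef_poly.
- move=> h; apply/polyP => k; rewrite coef_poly coef0; case: ifP => // _.
  case: k => // k; rewrite /= /hat opprK h // mulr0 conjc0 //.
move=> z /unit_circle_e1[x xr ->]; rewrite -/(U x).
have mw := measurable_window x.
have UI : cintegrable (window x) U by exact: cintegrable_window_continuous.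
have UcI : cintegrable (window x) (fun y => U y - U x).
  by apply: cintegrableB => //; exact: cintegrable_cst.
have win y : window x y -> 0 <= y <= 2.
  by move: xr => /andP[x1 x2]; rewrite /window /= in_itv /= => /andP[a b]; apply/andP; lra.
have x02 : 0 <= x <= 2 by move: xr => /andP[x1 x2]; apply/andP; lra.
have hatE k : window_coef x U k = hat k.
  have c1 : ccontinuous (fun y => U y * echar (- k) y).
    by apply: ccontinuousM => //; exact: ccontinuous_echar.
  have per y : U (y + 1) * echar (- k) (y + 1) = U y * echar (- k) y.
    by rewrite Uper /echar e1_intM_periodic.
  have s01 : 0 <= x - 2^-1 <= 1 by move: xr => /andP[x1 x2]; apply/andP; lra.
  have [c2 c3] := c1.
  apply: complex_eqP; rewrite /= /window.
  - by apply: Rintegral_period => // y; rewrite per.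
  - by apply: Rintegral_period => // y; rewrite per.
have l1 g : (forall y, window x y -> cmod (g y) <= 2 * M) -> cintegrable (window x) g ->
    RI (window x) (fun y => cmod (g y)) <= 2 * M.
  move=> gM gI; have -> : 2 * M = RI (window x) (fun=> 2 * M).
    by rewrite /window Rintegral_itv_cst ?lerDl // addrAC subrr add0r mulr1.
  apply: le_Rintegral => //; [exact: cintegrable_cmod|exact: cst_Rintegrable].
have A1 : cmod (poisson_integral r U x - U x) <= e / 2.
  apply: le_trans (hK r eta (2 * (e / (8 * K))) x U (U x) _ _ _ UI _) _.
  - by apply/andP; rewrite /r; lra.
  - by apply/andP; rewrite /r; lra.
  - by rewrite mulr_ge0 // ltW.
  - move=> h h0 h2.
    have hb y : ball x h y -> cmod (U y - U x) <= e / (8 * K).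
      rewrite /ball /= /ball_ => xy; rewrite cmod_distrC; apply: heta => //.
      by apply: lt_le_trans xy _; lra.
    have bE : ball x h = `]x - h, x + h[%classic by rewrite ball_itv.
    have sub : ball x h `<=` `[x - h, x + h].
      by rewrite bE; exact: subset_itv_oo_cc.
    have mb : measurable (ball x h) by exact: measurable_ball.
    have -> : 2 * (e / (8 * K)) * h = RI `[x - h, x + h] (fun=> e / (8 * K)).
      by rewrite Rintegral_itv_cst; [ring|lra].
    have nI : rI `[x - h, x + h] (fun y => cmod (U y - U x)).
      apply: cintegrable_cmod => //; apply: ccontinuous_cintegrable.
      by apply: ccontinuousB => //; exact: ccontinuous_cst.
    have cI : rI `[x - h, x + h] (fun=> e / (8 * K)) by exact: cst_Rintegrable.
    apply: (@le_trans _ _ (RI (ball x h) (fun=> e / (8 * K)))).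
      apply: le_Rintegral; [exact: mb| | |exact: hb].
      - by apply: integrableS nI.
      - by apply: integrableS cI.
    apply: le_Rintegral_subset => //; first by move=> _; exact: ltW.
  - have h2M : RI (window x) (fun y => cmod (U y - U x)) <= 2 * M.
      apply: l1 => // y wy; apply: le_trans (cmodB _ _) _.
      by have := hM _ (win _ wy); have := hM _ x02; lra.
    have rd : 1 - r = d by rewrite /r; lra.
    rewrite rd.
    have h3 : d / eta ^+ 2 * RI (window x) (fun y => cmod (U y - U x)) <= e / (4 * K).
      apply: (@le_trans _ _ (d / eta ^+ 2 * (2 * M))).
        by rewrite ler_wpM2l // divr_ge0 ?sqr_ge0 // ltW.
      rewrite mulrAC ler_pdivrMr ?exprn_gt0 // mulrAC ler_pdivlMr ?mulr_gt0 //.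
      have dKge : 0 <= d * K by rewrite mulr_ge0 // ltW.
      lra.
    have -> : e / 2 = K * (2 * (e / (8 * K)) + e / (4 * K)) by field; rewrite gt_eqF.
    by rewrite ler_wpM2l ?(ltW K0) // lerD2l.
have A2 := @poisson_integral_series R r x U N r01 UI.
have pE : p.[e1 x] = \sum_(k < N) (r%:C%C * e1 x) ^+ k * window_coef x U k.
  by rewrite horner_poly; apply: eq_bigr => k _; rewrite hatE exprMn; ring.
have qE : (q.[e1 x])^*%C = \sum_(k < N) ((r%:C%C * e1 x) ^+ k)^*%C * window_coef x U (- k%:Z) - window_coef x U 0.
  rewrite horner_poly /N big_ord_recl [X in (X + _)^*%C](_ : _ = 0) ?add0r; last by rewrite mul0r.
  rewrite [in RHS]big_ord_recl expr0 conjc1 mul1r.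
  rewrite [X in _ = X + _ - _](_ : _ = window_coef x U 0) // [RHS]addrAC subrr add0r.
  rewrite conjc_sum; apply: eq_bigr => k _.
  have kE : lift ord0 k = k.+1 :> nat by [].
  rewrite kE hatE [LHS](_ : _ = ((r%:C%C ^+ k.+1 * hat (- k.+1%:Z))^*%C * e1 x ^+ k.+1)^*%C) // conjcM conjcK [RHS]mulrC exprMn conjcM.
  have -> : (r%:C%C ^+ k.+1)^*%C = r%:C%C ^+ k.+1 :> C by rewrite -rmorphXn conjc_real.
  by ring.
have A3 : cmod (poisson_integral r U x - (p.[e1 x] + (q.[e1 x])^*%C)) <= e / 2.
  rewrite pE qE addrA; apply: le_trans A2 _.
  have h : RI (window x) (fun y => cmod (U y)) <= M.
    have -> : M = RI (window x) (fun=> M).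
      by rewrite /window Rintegral_itv_cst ?lerDl // addrAC subrr add0r mulr1.
    apply: le_Rintegral => //; [exact: cintegrable_cmod|exact: cst_Rintegrable|].
    by move=> y /win; exact: hM.
  apply: le_trans (hN0 N (leqnSn _)).
  have -> : r ^+ N * (2 / (1 - r) * M) = 2 * r ^+ N / (1 - r) * M by ring.
  rewrite ler_wpM2l // divr_ge0 //; last by move: r01 => /andP[? ?]; lra.
  by rewrite mulr_ge0 // exprn_ge0 //; case/andP: r01.
apply: le_trans (cmod_dist_triangle _ (poisson_integral r U x) _) _.
rewrite cmod_distrC; lra.
Qed.

End UniformApproximation.

(** * Mean values of analytic functions on small circles *)

Section MeanValueProperty.
Local Open Scope classical_set_scope.
Local Open Scope ring_scope.
Context {R : realType}.
Local Notation C := (R[i]).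
Local Notation mu := (@lebesgue_measure R).
Local Notation RI D f := (Rintegral mu D f).
Implicit Types (u f : C -> C) (z : C).

Definition continuous_at u z := forall e : R, 0 < e -> exists2 d : R, 0 < d &
  forall w, cmod (w - z) < d -> cmod (u w - u z) <= e.

Definition circle z (rho x : R) : C := z + rho%:C%C * e1 x.

(* The moments of order k > 0 make the class stable under multiplication by z. *)
Definition local_moments u z := exists2 r0 : R, 0 < r0 & forall rho, 0 < rho < r0 ->
  forall k : nat, cintegral `[0, 1] (fun x => u (circle z rho x) * e1 x ^+ k) = (k == 0%N)%:R * u z.

Lemma cmod_circle z (rho x : R) : 0 <= rho -> cmod (circle z rho x) <= cmod z + rho.
Proof.
by move=> r0; apply: le_trans (cmodD _ _) _; rewrite lerD2l cmodM cmod_real cmod_e1 mulr1 ger0_norm.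
Qed.

Lemma ccontinuous_circle z rho : ccontinuous (circle z rho).
Proof.
apply: ccontinuousD; first exact: ccontinuous_cst.
apply: ccontinuousM; [exact: ccontinuous_cst|exact: ccontinuous_e1].
Qed.

Lemma ccontinuous_comp u (c : R -> C) : ccontinuous c ->
  (forall x, continuous_at u (c x)) -> ccontinuous (fun x => u (c x)).
Proof.
move=> /ccontinuousP cc cu; apply/ccontinuousP => x e e0.
have e2 : 0 < e / 2 by rewrite divr_gt0.
have [d d0 hd] := cu x _ e2.
apply: filterS (cc x d d0) => y hy; apply: (@le_lt_trans _ _ (e / 2)); last by lra.
by rewrite cmod_distrC hd // cmod_distrC.
Qed.

Lemma ccontinuous_e1X (k : nat) : ccontinuous (fun x : R => e1 x ^+ k).
Proof.
rewrite (_ : (fun x => _) = echar k); first exact: ccontinuous_echar.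
by apply/funext => x; rewrite echar_nat.
Qed.

Lemma cintegral_e1X (k : nat) : cintegral `[0, 1] (fun x : R => e1 x ^+ k) = (k == 0%N)%:R.
Proof.
have := cintegral_echar (k : int) (0 : R); rewrite add0r => h.
transitivity (cintegral `[0, 1] (@echar R k)); last exact: h.
by apply: eq_cintegral => x _; rewrite echar_nat.
Qed.

Lemma continuous_atM u v z : continuous_at u z -> continuous_at v z ->
  continuous_at (fun w => u w * v w) z.
Proof.
move=> cu cv e e0.
pose M := cmod (u z) + cmod (v z) + 1.
have M1 : 1 <= M by have := cmod_ge0 (u z); have := cmod_ge0 (v z); rewrite /M; lra.
pose d := Num.min 1 (e / (2 * M)).
have d0 : 0 < d by rewrite lt_min; apply/andP; split=> //; rewrite divr_gt0 // mulr_gt0 //; lra.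
have d1 : d <= 1 by rewrite ge_min lexx.
have dM : d * (2 * M) <= e by rewrite -ler_pdivlMr ?ge_min ?lexx ?orbT // mulr_gt0 //; lra.
have [du du0 hu] := cu d d0; have [dv dv0 hv] := cv d d0.
exists (Num.min du dv); first by rewrite lt_min du0.
move=> w; rewrite lt_min => /andP[/hu h1 /hv h2].
have -> : u w * v w - u z * v z = (u w - u z) * (v w - v z) + (u w - u z) * v z + u z * (v w - v z).
  by ring.
apply: le_trans (cmodD _ _) _; apply: le_trans (lerD (cmodD _ _) (lexx _)) _; rewrite !cmodM.
have a0 := cmod_ge0 (u w - u z); have b0 := cmod_ge0 (v w - v z).
have c0 := cmod_ge0 (u z); have e0' := cmod_ge0 (v z).
have p1 : cmod (u w - u z) * cmod (v w - v z) <= d * 1.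
  by apply: ler_pM => //; exact: le_trans h2 d1.
have p2 : cmod (u w - u z) * cmod (v z) <= d * cmod (v z) by rewrite ler_wpM2r.
have p3 : cmod (u z) * cmod (v w - v z) <= cmod (u z) * d by rewrite ler_wpM2l.
rewrite /M in dM M1; nra.
Qed.

Lemma continuous_at_id z : continuous_at id z.
Proof. by move=> e e0; exists e => // w /ltW. Qed.

Lemma continuous_at_cst (c : C) z : continuous_at (fun=> c) z.
Proof. by move=> e e0; exists 1 => // w _; rewrite subrr cmod0 ltW. Qed.

Lemma continuous_atD u v z : continuous_at u z -> continuous_at v z ->
  continuous_at (fun w => u w + v w) z.
Proof.
move=> cu cv e e0; have e2 : 0 < e / 2 by rewrite divr_gt0.
have [du du0 hu] := cu _ e2; have [dv dv0 hv] := cv _ e2.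
exists (Num.min du dv); first by rewrite lt_min du0.
move=> w; rewrite lt_min => /andP[/hu h1 /hv h2].
have -> : u w + v w - (u z + v z) = (u w - u z) + (v w - v z) by ring.
by apply: le_trans (cmodD _ _) _; lra.
Qed.

Lemma continuous_at_horner (p : {poly C}) z : continuous_at (fun w => p.[w]) z.
Proof.
elim/poly_ind: p => [|p c IH].
  by move=> e e0; exists 1 => // w _; rewrite !horner0 subrr cmod0 ltW.
rewrite (_ : (fun w => _) = (fun w => p.[w] * w + c)); last first.
  by apply/funext => w; rewrite hornerMXaddC.
exact: (continuous_atD (continuous_atM IH (@continuous_at_id z)) (@continuous_at_cst c z)).
Qed.

(** On the circle the variable is [z + rho e(x)], so multiplication by it combines the moments of
    order [k] and [k + 1], and the latter vanishes. *)
Lemma local_moments_mulX u z : local_moments u z -> (forall w, cmod w < 1 -> continuous_at u w) ->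
  cmod z < 1 -> local_moments (fun w => w * u w) z.
Proof.
move=> [r0 r00 hr] cu z1.
exists (Num.min r0 (1 - cmod z)); first by rewrite lt_min r00 subr_gt0.
move=> rho /andP[rho0]; rewrite lt_min => /andP[rhor rho1] k.
have h := hr rho _; rewrite rho0 rhor in h; have {}h := h isT.
have cc : ccontinuous (fun x => u (circle z rho x)).
  apply: ccontinuous_comp; first exact: ccontinuous_circle.
  by move=> x; apply: cu; apply: le_lt_trans (cmod_circle _ _ (ltW rho0)) _; lra.
have I j : cintegrable `[0, 1] (fun x => u (circle z rho x) * e1 x ^+ j).
  by apply: ccontinuous_cintegrable; apply: ccontinuousM => //; exact: ccontinuous_e1X.
transitivity (cintegral `[0, 1] (fun x => z * (u (circle z rho x) * e1 x ^+ k) + rho%:C%C * (u (circle z rho x) * e1 x ^+ k.+1))).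
  by apply: eq_cintegral => x _; rewrite /circle exprS; ring.
rewrite cintegralD //; try exact: cintegrableZ.
by rewrite !cintegralZ // !h /=; ring.
Qed.

(** Convergence at the single point [z0 + s], with [s] half the radius, bounds [cmod (c k) * s ^+ k]
    by [M]; for [cmod h <= s / 2] the tails are then geometric with ratio at most 1/2. *)
Lemma power_series_bound (f : C -> C) (z0 : C) : analytic_at f z0 ->
  exists c : nat -> C, exists M s : R, [/\ 0 <= M, 0 < s &
    forall h, cmod h <= s / 2 -> forall n,
      cmod (f (z0 + h) - \sum_(0 <= k < n) c k * h ^+ k) <= 2 * M * (cmod h / s) ^+ n].
Proof.
move=> [c [r [r0 hr]]].
have cvgS h : cmod h < r -> forall e : R, 0 < e -> exists N, forall n, (N <= n)%N ->
    cmod (f (z0 + h) - \sum_(0 <= k < n) c k * h ^+ k) < e.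
  move=> hh e e0.
  have := hr (z0 + h); rewrite addrAC subrr add0r => /(_ hh)/cvg_cmodP/(_ e e0)[N _ hN].
  by exists N => n Nn; exact: hN.
pose s := r / 2; have s0 : 0 < s by rewrite divr_gt0.
have [N hN] := cvgS s%:C%C ltac:(by rewrite cmod_real gtr0_norm // /s; lra) 1 ltr01.
(* A term of index at least [N] is the difference of two remainders smaller than 1, hence the 2. *)
pose M := 2 + \sum_(0 <= k < N) cmod (c k) * s ^+ k.
have M0 : 0 <= M by rewrite addr_ge0 // sumr_ge0 // => k _; rewrite mulr_ge0 ?cmod_ge0 ?exprn_ge0 // ltW.
have term k : cmod (c k) * s ^+ k <= M.
  have [kN|Nk] := ltnP k N.
    rewrite /M big_mkord (bigD1 (Ordinal kN)) //= addrCA lerDl addr_ge0 // sumr_ge0 // => j _.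
    by rewrite mulr_ge0 ?cmod_ge0 ?exprn_ge0 // ltW.
  have := hN k Nk; have := hN k.+1 (leqW Nk); rewrite big_nat_recr //=.
  set S := \sum_(0 <= _ < k) _; set F := f _ => h1 h2.
  have : cmod (c k * s%:C%C ^+ k) <= 2.
    rewrite (_ : c k * _ = (F - S) - (F - (S + c k * s%:C%C ^+ k))); last by ring.
    by apply: le_trans (cmodB _ _) _; lra.
  rewrite cmodM cmodX cmod_real (gtr0_norm s0) => h; apply: le_trans h _.
  by rewrite lerDl sumr_ge0 // => j _; rewrite mulr_ge0 ?cmod_ge0 ?exprn_ge0 // ltW.
exists c, M, s; split => // h hs n.
have hh : cmod h < r by move: hs; rewrite /s; lra.
pose t := cmod h / s; have t0 : 0 <= t by rewrite divr_ge0 ?cmod_ge0 // ltW.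
have t2 : t <= 2^-1 by rewrite ler_pdivrMr // mulrC.
have tail m : cmod (\sum_(n <= k < n + m) c k * h ^+ k) <= 2 * M * t ^+ n - M * t ^+ n * 2 * 2^-1 ^+ m.
  elim: m => [|m IH]; first by rewrite addn0 big_geq // cmod0 expr0 mulr1; lra.
  rewrite addnS big_nat_recr ?leq_addr //=; apply: le_trans (cmodD _ _) _.
  have h1 : cmod (c (n + m)%N * h ^+ (n + m)) <= M * t ^+ n * 2^-1 ^+ m.
    rewrite cmodM cmodX.
    have -> : cmod h ^+ (n + m) = s ^+ (n + m) * t ^+ (n + m).
      by rewrite -exprMn /t mulrC divfK // gt_eqF.
    rewrite mulrA; apply: (@le_trans _ _ (M * t ^+ (n + m))).
      by rewrite ler_wpM2r ?exprn_ge0.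
    rewrite exprD mulrA ler_wpM2l ?mulr_ge0 ?exprn_ge0 // lerXn2r ?nnegrE ?invr_ge0 //.
  have -> : 2^-1 ^+ m.+1 = 2^-1 * 2^-1 ^+ m :> R by rewrite exprS.
  move: (2^-1 ^+ m) h1 IH => q h1 IH; lra.
apply/ler_addgt0Pr => e e0; have [K hK] := cvgS h hh e e0.
have := hK (n + K)%N (leq_addl _ _); rewrite (big_cat_nat (leq0n n) (leq_addr K n)) /=.
set S := \sum_(0 <= _ < n) _; set T := \sum_(n <= _ < _) _ => h1.
have h2 : cmod T <= 2 * M * t ^+ n.
  apply: le_trans (tail K) _; rewrite gerBl !mulr_ge0 ?exprn_ge0 ?invr_ge0 //.
rewrite (_ : f (z0 + h) - S = (f (z0 + h) - (S + T)) + T); last by ring.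
by apply: le_trans (cmodD _ _) _; rewrite -/t; lra.
Qed.

Lemma analytic_continuous f z0 : analytic_at f z0 -> continuous_at f z0.
Proof.
move=> /power_series_bound[c [M [s [M0 s0 hM]]]].
have f0 : f z0 = c 0%N.
  have := hM 0 _ 1%N; rewrite cmod0 divr_ge0 ?(ltW s0) // => /(_ isT).
  rewrite addr0 big_nat1 expr0 mulr1 mul0r expr1 mulr0 => h.
  by apply/eqP; rewrite -subr_eq0 -cmod_eq0 eq_le h cmod_ge0.
move=> e e0; pose d := Num.min (s / 2) (e * s / (2 * M + 1)).
have M1 : 0 < 2 * M + 1 by lra.
exists d; first by rewrite lt_min; apply/andP; split; rewrite divr_gt0 // mulr_gt0.
move=> w; rewrite lt_min => /andP[h1 h2].
have := hM (w - z0) (ltW h1) 1%N; rewrite [z0 + _]addrC subrK big_nat1 expr0 mulr1 -f0 expr1 => h.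
apply: le_trans h _; rewrite mulrA ler_pdivrMr //.
move: h2; rewrite ltr_pdivlMr // => h2; have := cmod_ge0 (w - z0); lra.
Qed.

(** For a truncation of the power series the integral of [e1 x ^+ (j + k)] vanishes unless
    [j = k = 0]; the remainder is uniformly small on circles of radius below [s / 2]. *)
Lemma analytic_local_moments f z0 : analytic_in_disc f -> cmod z0 < 1 -> local_moments f z0.
Proof.
move=> hf z1; have [c [M [s [M0 s0 hM]]]] := power_series_bound (hf z0 z1).
have f0 : f z0 = c 0%N.
  have := hM 0 _ 1%N; rewrite cmod0 divr_ge0 ?(ltW s0) // => /(_ isT).
  rewrite addr0 big_nat1 expr0 mulr1 mul0r expr1 mulr0 => h.
  by apply/eqP; rewrite -subr_eq0 -cmod_eq0 eq_le h cmod_ge0.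
exists (Num.min (s / 2) (1 - cmod z0)).
  by rewrite lt_min divr_gt0 //= subr_gt0.
move=> rho /andP[rho0]; rewrite lt_min => /andP[rhos rho1] k.
have cc : ccontinuous (fun x => f (circle z0 rho x)).
  apply: ccontinuous_comp; first exact: ccontinuous_circle.
  move=> x; apply: analytic_continuous; apply: hf.
  by apply: le_lt_trans (cmod_circle _ _ (ltW rho0)) _; lra.
have fI : cintegrable `[0, 1] (fun x => f (circle z0 rho x) * e1 x ^+ k).
  by apply: ccontinuous_cintegrable; apply: ccontinuousM => //; exact: ccontinuous_e1X.
apply: eq_of_cmod_le => e e0.
have half01 : 0 <= (2^-1 : R) < 1 by apply/andP; lra.
have [N hN] := geometric_small (2 * M) half01 e0.
pose n := N.+1.
pose S x := \sum_(0 <= j < n) c j * (rho%:C%C * e1 x) ^+ j.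
have SE x : S x * e1 x ^+ k = \sum_(0 <= j < n) (c j * rho%:C%C ^+ j) * e1 x ^+ (j + k).
  by rewrite mulr_suml; apply: eq_bigr => j _; rewrite exprMn exprD; ring.
have eI (j : nat) : cintegrable `[0, 1] (fun x : R => e1 x ^+ j).
  by apply: ccontinuous_cintegrable; exact: ccontinuous_e1X.
have SI : cintegrable `[0, 1] (fun x => S x * e1 x ^+ k).
  rewrite (_ : (fun x => _) = (fun x => \sum_(0 <= j < n) (c j * rho%:C%C ^+ j) * e1 x ^+ (j + k))); last by apply/funext.
  by apply: cintegrable_sum => // j _; exact: cintegrableZ.
have Sint : cintegral `[0, 1] (fun x => S x * e1 x ^+ k) = (k == 0%N)%:R * f z0.
  transitivity (cintegral `[0, 1] (fun x => \sum_(0 <= j < n) (c j * rho%:C%C ^+ j) * e1 x ^+ (j + k))).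
    by apply: eq_cintegral => x _.
  rewrite cintegral_sum //; last by move=> j _; exact: cintegrableZ.
  under eq_bigr do rewrite cintegralZ // cintegral_e1X.
  rewrite /n big_nat_recl // big1 ?addr0; last by move=> j _; rewrite addSn mulr0.
  by rewrite add0n expr0 mulr1 mulrC f0.
rewrite -Sint -cintegralB //; apply: le_trans (cmod_cintegral_le _ (cintegrableB _ fI SI)) _ => //.
have <- : RI `[0, 1] (fun=> e) = e by rewrite Rintegral_itv_cst // subr0 mulr1.
apply: le_Rintegral => //.
- by apply: cintegrable_cmod => //; exact: cintegrableB.
- exact: cst_Rintegrable.
move=> x _; rewrite -mulrBl cmodM cmodX cmod_e1 expr1n mulr1.
have hx : cmod (rho%:C%C * e1 x) = rho by rewrite cmodM cmod_real cmod_e1 mulr1 gtr0_norm.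
apply: le_trans (hM _ _ n) _; rewrite hx; first exact: ltW.
apply: le_trans (hN n (leqnSn _)); rewrite mulrC ler_wpM2r ?mulr_ge0 //.
rewrite ler_pXn2r ?nnegrE ?divr_ge0 ?(ltW s0) ?(ltW rho0) ?invr_ge0 //.
by rewrite ler_pdivrMr //; lra.
Qed.

End MeanValueProperty.

(** * Maximum principle for functions with the mean value property *)

Section MaximumPrinciple.
Local Open Scope classical_set_scope.
Local Open Scope ring_scope.
Context {R : realType}.
Local Notation C := (R[i]).
Local Notation mu := (@lebesgue_measure R).
Local Notation Re := (@complex.Re R).
Local Notation Im := (@complex.Im R).
Local Notation RI D f := (Rintegral mu D f).
Local Notation rI D f := (mu.-integrable D (EFin \o f)).
Implicit Types (u w f : C -> C) (z : C).

Definition mean_value w z := exists2 r0 : R, 0 < r0 & forall rho, 0 < rho < r0 ->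
  cintegral `[0, 1] (fun x => w (circle z rho x)) = w z.

Lemma local_moments_mean_value w z : local_moments w z -> mean_value w z.
Proof.
move=> [r0 r00 h]; exists r0 => // rho hr; have := h rho hr 0%N; rewrite mul1r => <-.
by apply: eq_cintegral => x _; rewrite expr0 mulr1.
Qed.

Lemma cintegral_conj D (F : R -> C) : measurable D -> cintegrable D F ->
  cintegral D (fun x => (F x)^*%C) = (cintegral D F)^*%C.
Proof.
move=> mD [_ FI]; apply: complex_eqP => /=.
- by apply: eq_Rintegral => x _; case: (F x).
- rewrite -mulN1r -RintegralZl //.
  by apply: eq_Rintegral => x _; case: (F x) => a b /=; rewrite mulN1r.
Qed.

Lemma cintegrable_conj D (F : R -> C) : measurable D -> cintegrable D F ->
  cintegrable D (fun x => (F x)^*%C).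
Proof.
move=> mD [rI iI]; split.
- by rewrite (_ : (fun x => _) = (fun x => (Re (F x))%:E)) //; apply/funext => x; case: (F x).
- rewrite (_ : (fun x => _) = (EFin \o (fun x => (-1) * Im (F x)))); first exact: RintegrableZl.
  by apply/funext => x /=; case: (F x) => a b /=; rewrite mulN1r.
Qed.

Lemma continuous_at_conj w z : continuous_at w z -> continuous_at (fun v => (w v)^*%C) z.
Proof.
move=> cw e e0; have [d d0 hd] := cw e e0; exists d => // v /hd.
by rewrite -rmorphB /= cmod_conj.
Qed.

Lemma ccontinuous_on_circle w z rho (R0 : R) : 0 <= rho -> cmod z + rho < R0 ->
  (forall v, cmod v < R0 -> continuous_at w v) -> ccontinuous (fun x => w (circle z rho x)).
Proof.
move=> r0 zr cw; apply: ccontinuous_comp; first exact: ccontinuous_circle.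
by move=> x; apply: cw; apply: le_lt_trans (cmod_circle _ _ r0) _.
Qed.

(** The excess [rho ^+ 2] over the value at the centre is what makes the perturbation in the maximum
    principle strict. *)
Lemma cintegral_sqr_circle z (rho : R) :
  cintegral `[0, 1] (fun x => circle z rho x * (circle z rho x)^*%C) = z * z^*%C + (rho ^+ 2)%:C%C.
Proof.
have E1 (k : int) : k != 0 -> cintegral `[0, 1] (fun x : R => echar k x) = 0.
  by move=> /negbTE k0; have := cintegral_echar k (0 : R); rewrite add0r k0 /= => ->.
have eI (k : int) : cintegrable `[0, 1] (fun x : R => echar k x).
  by apply: ccontinuous_cintegrable; exact: ccontinuous_echar.
transitivity (cintegral `[0, 1] (fun x => (z * z^*%C + (rho ^+ 2)%:C%C) +
    ((rho%:C%C * z^*%C) * echar 1 x + (rho%:C%C * z) * echar (-1) x))).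
  apply: eq_cintegral => x _; rewrite /circle.
  have -> : echar (-1) x = (e1 x)^*%C by rewrite /echar rmorphN mulN1r e1N.
  have -> : echar 1 x = e1 x by rewrite /echar mul1r.
  have h : e1 x * (e1 x)^*%C = 1 by rewrite mul_conjc cmod_e1 expr1n.
  have -> : (z + rho%:C%C * e1 x)^*%C = z^*%C + rho%:C%C * (e1 x)^*%C.
    by rewrite rmorphD rmorphM /=; congr (_ + _ * _); rewrite /conjc /= oppr0.
  have -> : (rho ^+ 2)%:C%C = rho%:C%C * rho%:C%C by rewrite -rmorphM.
  move: (e1 x) ((e1 x)^*%C) h (z^*%C) (rho%:C%C) => E E' h z' r; rewrite -[r * r]mulr1 -h.
  by ring.
rewrite cintegralD //; last 2 first.
- exact: cintegrable_cst.
- by apply: cintegrableD => //; apply: cintegrableZ.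
rewrite cintegral_cst // subr0 mulr1 cintegralD //; try exact: cintegrableZ.
by rewrite !cintegralZ // !E1 // !mulr0 !addr0.
Qed.

(** Adding [eta] times the squared modulus of [z] to [Re (u * w)] makes every interior circular mean
    strictly larger than the value at the centre, so the maximum over the closed disc lies on its
    boundary. The unit [u] is fixed by the point under study, and the price is
    [eta * R0 ^+ 2 = e']. *)
Lemma maximum_principle w (R0 e : R) : 0 < R0 ->
  (forall z, cmod z <= R0 -> continuous_at w z) ->
  (forall z, cmod z < R0 -> mean_value w z) ->
  (forall z, cmod z = R0 -> cmod (w z) <= e) ->
  forall z, cmod z <= R0 -> cmod (w z) <= e.
Proof.
move=> R00 cw mw bw z1 z1R; apply/ler_addgt0Pr => e' e'0.
pose eta := e' / R0 ^+ 2; have eta0 : 0 < eta by rewrite divr_gt0 // exprn_gt0.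
have [u u1 uz] := exists_unit_multiplier (w z1).
pose W z := u * w z + eta%:C%C * (z * z^*%C).
have cW z : cmod z <= R0 -> continuous_at W z.
  move=> zR; apply: continuous_atD; apply: continuous_atM; try exact: continuous_at_cst.
  - exact: cw.
  - by apply: continuous_atM; [exact: continuous_at_id|apply: continuous_at_conj; exact: continuous_at_id].
have ReW z : Re (W z) = Re (u * w z) + eta * cmod z ^+ 2.
  by rewrite /W ReD mul_conjc; congr (_ + _); rewrite ReM /= mul0r subr0.
(* The closed disc is viewed in [R * R], where it is a closed subset of a compact square. *)
pose pt (p : R * R) : C := (p.1 +i* p.2)%C.
pose K := [set p : R * R | cmod (pt p) <= R0].
have ptB p q : cmod (pt q - pt p) <= `|p.1 - q.1| + `|p.2 - q.2|.
  by apply: le_trans (cmod_le_ReIm _) _ => /=; rewrite distrC [`|_ - p.2|]distrC.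
have ballpt p d q : ball p (d / 2) q -> cmod (pt q - pt p) < d.
  by move=> [/= h1 h2]; apply: le_lt_trans (ptB _ _) _; move: h1 h2; rewrite /ball /= /ball_; lra.
have closedK : closed K.
  rewrite (_ : K = (fun p => cmod (pt p)) @^-1` [set x | x <= R0]) //.
  apply: preimage_closed; last exact: closed_le.
  move=> p _; apply/cvgrPdist_lt => d d0.
  have d2 : 0 < d / 2 by rewrite divr_gt0.
  apply: filterS (nbhsx_ballx p (d / 2) d2) => q /ballpt h; apply: le_lt_trans h.
  rewrite distrC ler_norml; apply/andP; split.
  - by have := cmodD (pt p - pt q) (pt q); rewrite subrK [cmod (pt p - _)]cmod_distrC; lra.
  - by have := cmodD (pt q - pt p) (pt p); rewrite subrK; lra.
have compactK : compact K.
  apply: (@subclosed_compact _ _ (`[- R0, R0] `*` `[- R0, R0])) => //.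
  - by apply: compact_setX; exact: segment_compact.
  move=> p /= hp; rewrite !in_itv /= -!ler_norml; split.
  - exact: le_trans (ler_Re_cmod (pt p)) hp.
  - exact: le_trans (ler_Im_cmod (pt p)) hp.
pose v (p : R * R) := Re (W (pt p)).
have cv : {within K, continuous v}.
  apply: continuous_in_subspaceT => p; rewrite inE => pK; apply/cvgrPdist_le => d d0.
  have [d' d'0 hd'] := cW (pt p) pK d d0; have d2 : 0 < d' / 2 by rewrite divr_gt0.
  apply: filterS (nbhsx_ballx p (d' / 2) d2) => q /ballpt /hd' h; rewrite distrC.
  by apply: le_trans h; rewrite /v -ReB; exact: ler_Re_cmod.
have K0 : K !=set0 by exists (Re z1, Im z1); rewrite /K /pt /=; case: (z1) z1R.
have [p0] := compact_EVT_max K0 compactK cv; rewrite inE => p0K vmax.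
pose z0 := pt p0.
have Wmax z : cmod z <= R0 -> Re (W z) <= Re (W z0).
  by case: z => a b h; have := vmax (a, b); rewrite inE; exact.
have z0R : cmod z0 = R0.
  apply/eqP; rewrite eq_le p0K leNgt; apply/negP => z0lt.
  have [r0 r00 hr] := mw z0 z0lt.
  pose rho := Num.min (r0 / 2) ((R0 - cmod z0) / 2).
  have rho0 : 0 < rho by rewrite lt_min !divr_gt0 // subr_gt0.
  have rho1 : rho <= r0 / 2 by rewrite ge_min lexx.
  have rho2 : rho <= (R0 - cmod z0) / 2 by rewrite ge_min lexx orbT.
  have cR : cmod z0 + rho < R0 by move: z0lt; rewrite -/z0; lra.
  have wI : cintegrable `[0, 1] (fun x => w (circle z0 rho x)).
    apply: ccontinuous_cintegrable; apply: (@ccontinuous_on_circle _ _ _ R0) => //; first exact: ltW.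
    by move=> z' /ltW; exact: cw.
  have sI : cintegrable `[0, 1] (fun x => circle z0 rho x * (circle z0 rho x)^*%C).
    apply: ccontinuous_cintegrable; apply: (@ccontinuous_on_circle (fun z => z * z^*%C) _ _ R0) => //; first exact: ltW.
    by move=> z' _; apply: continuous_atM; [exact: continuous_at_id|apply: continuous_at_conj; exact: continuous_at_id].
  have : Re (cintegral `[0, 1] (fun x => W (circle z0 rho x))) = Re (W z0) + eta * rho ^+ 2.
    rewrite /W cintegralD //; try exact: cintegrableZ.
    rewrite !cintegralZ // hr; last by rewrite rho0; lra.
    rewrite cintegral_sqr_circle mulrDr addrA ReD; congr (_ + _).
    by rewrite ReM /= mul0r subr0.
  have WI : cintegrable `[0, 1] (fun x => W (circle z0 rho x)).
    by apply: cintegrableD => //; exact: cintegrableZ.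
  have : Re (cintegral `[0, 1] (fun x => W (circle z0 rho x))) <= Re (W z0).
    have <- : RI `[0, 1] (fun=> Re (W z0)) = Re (W z0) by rewrite Rintegral_itv_cst // subr0 mulr1.
    apply: le_Rintegral => //; [by case: WI|exact: cst_Rintegrable|].
    by move=> x _; apply: Wmax; apply: le_trans (cmod_circle _ _ (ltW rho0)) (ltW cR).
  have : 0 < eta * rho ^+ 2 by rewrite mulr_gt0 ?exprn_gt0.
  by move=> h1 h2 h3; move: h2; rewrite h3; lra.
have h1 := Wmax _ z1R; rewrite !ReW uz z0R in h1.
have h2 : Re (u * w z0) <= e.
  by apply: le_trans (ler_norm _) _; apply: le_trans (ler_Re_cmod _) _; rewrite cmodM u1 mul1r bw.
have h3 : eta * R0 ^+ 2 = e' by rewrite divfK // gt_eqF // exprn_gt0.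
have h4 : 0 <= eta * cmod z1 ^+ 2 by rewrite mulr_ge0 ?exprn_ge0 ?cmod_ge0 ?(ltW eta0).
by lra.
Qed.

End MaximumPrinciple.

(** * Uniform approximation of dilated analytic functions by polynomials *)

Section PolynomialApproximation.
Local Open Scope classical_set_scope.
Local Open Scope ring_scope.
Context {R : realType}.
Local Notation C := (R[i]).
Local Notation mu := (@lebesgue_measure R).
Local Notation RI D f := (Rintegral mu D f).
Implicit Types (u f : C -> C) (z : C).

Lemma local_moments_cst (c : C) z : local_moments (fun=> c) z.
Proof.
exists 1 => // rho _ k; rewrite cintegralZ //; last first.
  by apply: ccontinuous_cintegrable; exact: ccontinuous_e1X.
by rewrite cintegral_e1X mulrC.
Qed.

Lemma local_momentsD u (w : C -> C) z :
  (forall v, cmod v < 1 -> continuous_at u v) -> (forall v, cmod v < 1 -> continuous_at w v) ->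
  cmod z < 1 -> local_moments u z -> local_moments w z -> local_moments (fun v => u v + w v) z.
Proof.
move=> cu cw z1 [r0 r00 hr] [s0 s00 hs].
exists (Num.min (Num.min r0 s0) (1 - cmod z)); first by rewrite !lt_min r00 s00 subr_gt0.
move=> rho /andP[rho0]; rewrite 2!lt_min => /andP[/andP[rhor rhos] rho1] k.
have I (v : C -> C) : (forall v', cmod v' < 1 -> continuous_at v v') ->
    cintegrable `[0, 1] (fun x => v (circle z rho x) * e1 x ^+ k).
  move=> cv; apply: ccontinuous_cintegrable; apply: ccontinuousM; last exact: ccontinuous_e1X.
  by apply: (@ccontinuous_on_circle _ _ _ _ 1) => //; [exact: ltW|lra].
under eq_cintegral do rewrite mulrDl.
by rewrite cintegralD //; [rewrite hr ?rho0 // hs ?rho0 // mulrDr|exact: I..].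
Qed.

Lemma local_moments_horner (p : {poly C}) z : cmod z < 1 -> local_moments (horner p) z.
Proof.
elim/poly_ind: p z => [|p c IH] z z1.
  by rewrite (_ : horner 0 = fun=> 0); [exact: local_moments_cst|apply/funext => w; rewrite horner0].
rewrite (_ : horner _ = (fun w => w * p.[w] + c)); last first.
  by apply/funext => w; rewrite hornerMXaddC mulrC.
apply: (@local_momentsD (fun w => w * p.[w]) (fun=> c)) => //.
- move=> v _; apply: continuous_atM; [exact: continuous_at_id|exact: continuous_at_horner].
- move=> v _; exact: continuous_at_cst.
- by apply: local_moments_mulX => //; [exact: IH|move=> v _; exact: continuous_at_horner].
- exact: local_moments_cst.
Qed.

Lemma mean_value_conj u z : (forall v, cmod v < 1 -> continuous_at u v) -> cmod z < 1 ->
  mean_value u z -> mean_value (fun v => (u v)^*%C) z.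
Proof.
move=> cu z1 [r0 r00 hr]; exists (Num.min r0 (1 - cmod z)).
  by rewrite lt_min r00 subr_gt0.
move=> rho /andP[rho0]; rewrite lt_min => /andP[rhor rho1].
rewrite cintegral_conj //; first by rewrite hr // rho0.
apply: ccontinuous_cintegrable.
by apply: (@ccontinuous_on_circle _ _ _ _ 1) => //; [exact: ltW|lra].
Qed.

Lemma mean_valueB u (w : C -> C) z :
  (forall v, cmod v < 1 -> continuous_at u v) -> (forall v, cmod v < 1 -> continuous_at w v) ->
  cmod z < 1 -> mean_value u z -> mean_value w z -> mean_value (fun v => u v - w v) z.
Proof.
move=> cu cw z1 [r0 r00 hr] [s0 s00 hs].
exists (Num.min (Num.min r0 s0) (1 - cmod z)); first by rewrite !lt_min r00 s00 subr_gt0.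
move=> rho /andP[rho0]; rewrite 2!lt_min => /andP[/andP[rhor rhos] rho1].
rewrite cintegralB // ?hr ?hs ?rho0 //.
- apply: ccontinuous_cintegrable.
  by apply: (@ccontinuous_on_circle _ _ _ _ 1) => //; [exact: ltW|lra].
- apply: ccontinuous_cintegrable.
  by apply: (@ccontinuous_on_circle _ _ _ _ 1) => //; [exact: ltW|lra].
Qed.

Lemma continuous_atB u v z : continuous_at u z -> continuous_at v z ->
  continuous_at (fun w => u w - v w) z.
Proof.
move=> cu cv; rewrite (_ : (fun w => _) = (fun w => u w + (-1) * v w)); last first.
  by apply/funext => w; rewrite mulN1r.
by apply: continuous_atD => //; apply: continuous_atM => //; exact: continuous_at_cst.
Qed.

Lemma continuous_at_scale u (r : R) z : 0 < r -> continuous_at u (r%:C%C * z) ->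
  continuous_at (fun w => u (r%:C%C * w)) z.
Proof.
move=> r0 cu e e0; have [d d0 hd] := cu e e0.
exists (d / r); first by rewrite divr_gt0.
move=> w hw; apply: hd; rewrite -mulrBr cmodM cmod_real gtr0_norm //.
by rewrite mulrC -ltr_pdivlMr.
Qed.

Lemma circle_scale (r : R) z rho x : r%:C%C * circle z rho x = circle (r%:C%C * z) (r * rho) x.
Proof. by rewrite /circle rmorphM /=; ring. Qed.

Lemma mean_value_scale u (r : R) z : 0 < r -> mean_value u (r%:C%C * z) ->
  mean_value (fun w => u (r%:C%C * w)) z.
Proof.
move=> r0 [s0 s00 hs]; exists (s0 / r); first by rewrite divr_gt0.
move=> rho /andP[rho0 rhos].
rewrite -(hs (r * rho)); last by rewrite mulr_gt0 //= mulrC -ltr_pdivlMr.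
by apply: eq_cintegral => x _; rewrite circle_scale.
Qed.

(** The properties of analytic functions on which the approximation rests, in a form that passes
    directly to [z ^+ m * u z]. *)
Definition disc_regular u := forall z, cmod z < 1 -> continuous_at u z /\ local_moments u z.

Lemma analytic_disc_regular f : analytic_in_disc f -> disc_regular f.
Proof.
move=> hf z z1; split; last exact: analytic_local_moments.
by apply: analytic_continuous; exact: hf.
Qed.

Lemma disc_regular_mulX u (m : nat) : disc_regular u -> disc_regular (fun z => z ^+ m * u z).
Proof.
move=> hu; elim: m => [|m IH].
  by rewrite (_ : (fun z => _) = u) //; apply/funext => z; rewrite expr0 mul1r.
rewrite (_ : (fun z => _) = (fun z => z * (z ^+ m * u z))); last first.
  by apply/funext => z; rewrite exprS mulrA.
move=> z z1; have [c1 m1] := IH z z1; split.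
- by apply: continuous_atM => //; exact: continuous_at_id.
- by apply: local_moments_mulX => // w /IH[].
Qed.

Lemma cintegral_horner_e1 (p : {poly C}) : cintegral `[0, 1] (fun x => p.[e1 x]) = p`_0.
Proof.
have h0 : cmod (0 : C) < 1 by rewrite cmod0.
elim/poly_ind: p => [|p c _].
  by rewrite coef0 -[RHS](@cintegral0 R `[0, 1]); apply: eq_cintegral => x _; rewrite horner0.
transitivity (cintegral `[0, 1] (fun x : R => c + \sum_(j < size p) p`_j * e1 x ^+ j.+1)).
  apply: eq_cintegral => x _; rewrite hornerMXaddC addrC horner_coef mulr_suml.
  by congr (_ + _); apply: eq_bigr => j _; rewrite exprSr mulrA.
have I (j : nat) : cintegrable `[0, 1] (fun x : R => e1 x ^+ j).
  by apply: ccontinuous_cintegrable; exact: ccontinuous_e1X.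
rewrite cintegralD //; last 2 first.
- exact: cintegrable_cst.
- by apply: cintegrable_sum => // j _; apply: cintegrableZ => //; exact: (I j.+1).
rewrite cintegral_sum //; last by move=> j _; apply: cintegrableZ => //; exact: (I j.+1).
rewrite big1 ?addr0; last by move=> j _; rewrite cintegralZ ?cintegral_e1X ?mulr0 //; exact: (I j.+1).
by rewrite cintegral_cst // subr0 mulr1 coefD coefMX coefC /= add0r.
Qed.

(** The approximation is available on the circle; its error has the mean value property inside, so
    the maximum principle carries the estimate to the disc. *)
Lemma harmonic_approx_in_disc u (R0 e : R) : 0 < R0 < 1 -> 0 < e -> disc_regular u ->
  exists p q : {poly C}, [/\ q`_0 = 0,
    (forall k : nat, (0 < k)%N -> cintegral `[0, 1] (fun x => u (R0%:C%C * e1 x) * echar k x) = 0) -> q = 0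
    & forall z, cmod z <= 1 -> cmod (u (R0%:C%C * z) - (p.[z] + (q.[z])^*%C)) <= e].
Proof.
move=> /andP[R00 R01] e0 hu; pose v z := u (R0%:C%C * z).
have scale z : cmod z <= 1 -> cmod (R0%:C%C * z) < 1.
  by move=> z1; rewrite cmodM cmod_real gtr0_norm //; nra.
have cv z : cmod z <= 1 -> continuous_at v z.
  by move=> z1; apply: continuous_at_scale => //; have [] := hu _ (scale z z1).
have [p [q [q0 hq happ]]] := @harmonic_poly_approx R v e ltac:(
  apply: ccontinuous_comp; [exact: ccontinuous_e1|by move=> x; apply: cv; rewrite cmod_e1]) e0.
exists p, q; split => // z; apply: (@maximum_principle _ (fun z => v z - (p.[z] + (q.[z])^*%C))) => //.
- move=> {}z z1; apply: continuous_atB; first exact: cv.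
  apply: continuous_atD; first exact: continuous_at_horner.
  by apply: continuous_at_conj; exact: continuous_at_horner.
- move=> {}z z1.
  rewrite (_ : (fun z => _) = (fun z => (v z - p.[z]) - (q.[z])^*%C)); last first.
    by apply/funext => w; rewrite opprD addrA.
  have cp (r : {poly C}) w : cmod w < 1 -> continuous_at (horner r) w.
    by move=> _; exact: continuous_at_horner.
  apply: mean_valueB => //.
  + by move=> w /ltW w1; apply: continuous_atB; [exact: cv|exact: continuous_at_horner].
  + by move=> w w1; apply: continuous_at_conj; exact: cp.
  + apply: mean_valueB => //.
    * by move=> w /ltW; exact: cv.
    * by move=> w w1; exact: cp.
    * apply: mean_value_scale => //; apply: local_moments_mean_value.
      by have [] := hu _ (scale z (ltW z1)).
    * by apply: local_moments_mean_value; exact: local_moments_horner.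
  + apply: mean_value_conj => //; first by move=> w w1; exact: cp.
    by apply: local_moments_mean_value; exact: local_moments_horner.
Qed.

(** From small circles to the circle of radius [R0]: for the harmonic approximant with [q] vanishing
    at 0, both the mean over the unit circle and the value at 0 equal the constant coefficient of
    [p]. *)
Lemma disc_mean_value u (R0 : R) : 0 < R0 < 1 -> disc_regular u ->
  cintegral `[0, 1] (fun x => u (R0%:C%C * e1 x)) = u 0.
Proof.
move=> R01 hu; have /andP[R00 R0lt1] := R01.
have cu : ccontinuous (fun x => u (R0%:C%C * e1 x)).
  apply: ccontinuous_comp.
    by apply: ccontinuousM; [exact: ccontinuous_cst|exact: ccontinuous_e1].
  move=> x; have [] // := hu (R0%:C%C * e1 x).
  by rewrite cmodM cmod_real cmod_e1 mulr1 gtr0_norm.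
apply: eq_of_cmod_le => e e0; have e2 : 0 < e / 2 by rewrite divr_gt0.
have [p [q [q0 _ happ]]] := harmonic_approx_in_disc R01 e2 hu.
have cp (r : {poly C}) : ccontinuous (fun x => r.[e1 x]).
  by apply: ccontinuous_comp; [exact: ccontinuous_e1|move=> x; exact: continuous_at_horner].
have cIp := ccontinuous_cintegrable 0 1 (cp p); have cIq := ccontinuous_cintegrable 0 1 (cp q).
have cIu := ccontinuous_cintegrable 0 1 cu.
have cIpq : cintegrable `[0, 1] (fun x => p.[e1 x] + (q.[e1 x])^*%C).
  by apply: cintegrableD => //; exact: cintegrable_conj.
have mpq : cintegral `[0, 1] (fun x => p.[e1 x] + (q.[e1 x])^*%C) = p`_0.
  by rewrite cintegralD ?cintegral_conj ?cintegral_horner_e1 ?q0 ?conjc0 ?addr0 //; exact: cintegrable_conj.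
have h0 := happ 0; rewrite cmod0 mulr0 !horner_coef0 q0 conjc0 addr0 in h0.
have {}h0 := h0 ler01.
have h1 : cmod (cintegral `[0, 1] (fun x => u (R0%:C%C * e1 x)) - p`_0) <= e / 2.
  rewrite -mpq -cintegralB //; apply: le_trans (cmod_cintegral_le _ (cintegrableB _ cIu cIpq)) _ => //.
  have <- : RI `[0, 1] (fun=> e / 2) = e / 2 by rewrite Rintegral_itv_cst // subr0 mulr1.
  apply: le_Rintegral => //.
  - by apply: cintegrable_cmod => //; exact: cintegrableB.
  - exact: cst_Rintegrable.
  - by move=> x _; apply: happ; rewrite cmod_e1.
have := cmod_dist_triangle (cintegral `[0, 1] (fun x => u (R0%:C%C * e1 x))) p`_0 (u 0).
by rewrite [cmod (p`_0 - _)]cmod_distrC; lra.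
Qed.

(** For [k > 0] the function [z ^+ k * u z] vanishes at 0, hence so does its mean over the circle of
    radius [R0]. Up to the factor [R0 ^+ k] this mean is the moment whose vanishing makes
    [q = 0]. *)
Lemma polynomial_approx_in_disc u (R0 e : R) : 0 < R0 < 1 -> 0 < e -> disc_regular u ->
  exists p : {poly C}, forall z, cmod z <= 1 -> cmod (u (R0%:C%C * z) - p.[z]) <= e.
Proof.
move=> R01 e0 hu; have [p [q [_ hq happ]]] := harmonic_approx_in_disc R01 e0 hu.
exists p => z /happ; rewrite hq ?horner0 ?conjc0 ?addr0 // => -[//|k] _.
have := disc_mean_value R01 (disc_regular_mulX k.+1 hu).
rewrite expr0n mul0r => h; have R0k : R0%:C%C ^+ k.+1 != 0 :> C.
  rewrite expf_neq0 //; have /andP[/gt_eqF/negbT R00 _] := R01.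
  by apply: contra R00; rewrite -cmod_eq0 cmod_real normr_eq0.
apply: (mulfI R0k); rewrite mulr0 -{}h -cintegralZ //.
  by apply: eq_cintegral => x _; rewrite echar_nat exprMn; ring.
have /andP[R00 R0lt1] := R01.
apply: ccontinuous_cintegrable; apply: ccontinuousM; last exact: ccontinuous_echar.
apply: ccontinuous_comp.
  by apply: ccontinuousM; [exact: ccontinuous_cst|exact: ccontinuous_e1].
move=> x; have [] // := hu (R0%:C%C * e1 x).
by rewrite cmodM cmod_real cmod_e1 mulr1 gtr0_norm.
Qed.

End PolynomialApproximation.

(** * Factorization of H1 functions with square-summable coefficients *)

Section HardyFactorization.
Local Open Scope classical_set_scope.
Local Open Scope ring_scope.
Context {R : realType}.
Local Notation C := (R[i]).
Local Notation mu := (@lebesgue_measure R).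
Local Notation Re := (@complex.Re R).
Local Notation Im := (@complex.Im R).
Local Notation RI D f := (Rintegral mu D f).
Local Notation rI D f := (mu.-integrable D (EFin \o f)).
Implicit Types (f : C -> C).

(** The limit is the supremum of the [t] such that [t <= x n] on a set of [U]; the ultrafilter
    dichotomy gives the upper estimate. *)
Lemma ultra_bounded_lim (U : set_system nat) (x : nat -> R) (M : R) : UltraFilter U ->
  (forall n, `|x n| <= M) -> exists l : R, forall e : R, 0 < e -> U [set n | `|x n - l| < e].
Proof.
move=> UU xM; pose E := [set t : R | U [set n | t <= x n]].
have E0 : E (- M).
  apply: filterS (filterT : U setT) => n _ /=.
  by have := xM n; rewrite ler_norml => /andP[].
have Eub : ubound E M.
  move=> t /filter_ex[n /= tn]; apply: le_trans tn _; exact: le_trans (ler_norm _) (xM n).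
have hE : has_sup E by split; [exists (- M)|exists M].
exists (sup E) => e e0; have e2 : 0 < e / 2 by rewrite divr_gt0.
have [t tE ht] := sup_adherent e2 hE.
have nE : ~ E (sup E + e / 2).
  by move=> /(ub_le_sup hE.2); rewrite gerDl leNgt e2.
have [//|nU] := @in_ultra_setVsetC _ U [set n | sup E + e / 2 <= x n] UU.
apply: filterS (filterI tE nU) => n [/= h1 /negP]; rewrite -ltNge => h2.
by rewrite ltr_norml; lra.
Qed.

Lemma ultra_bounded_climit (U : set_system nat) (x : nat -> C) (M : R) : UltraFilter U ->
  (forall n, cmod (x n) <= M) -> exists l : C, forall e : R, 0 < e -> U [set n | cmod (x n - l) <= e].
Proof.
move=> UU xM.
have [a ha] := @ultra_bounded_lim U (fun n => Re (x n)) M UU (fun n => le_trans (ler_Re_cmod _) (xM n)).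
have [b hb] := @ultra_bounded_lim U (fun n => Im (x n)) M UU (fun n => le_trans (ler_Im_cmod _) (xM n)).
exists (a +i* b)%C => e e0; have e2 : 0 < e / 2 by rewrite divr_gt0.
apply: filterS (filterI (ha _ e2) (hb _ e2)) => n [/= h1 h2].
by apply: le_trans (cmod_le_ReIm _) _; rewrite ReB ImB /=; lra.
Qed.

Lemma Rintegral_2pi (h : R -> R) : continuous h ->
  RI `[0, 2 * pi] h = 2 * pi * RI `[0, 1] (fun x => h (2 * pi * x)).
Proof.
move=> ch; have pi0 := pi_gt0 R; pose F (x : R) := 2 * pi * x.
have dF x : is_derive x (1 : R) F (2 * pi).
  by apply: is_derive_eq; exact: mulr1.
have F1 : derive1 F = cst (2 * pi).
  by apply/funext => x; rewrite derive1E; have [_ ->] := dF x.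
have cF x : {for x, continuous F} by apply: cvgM; [exact: cvg_cst|exact: cvg_id].
have F0 : F 0 = 0 by rewrite /F mulr0.
have FE : F 1 = 2 * pi by rewrite /F mulr1.
have chF : continuous (fun x => h (F x)) by move=> x; apply: continuous_comp; [exact: cF|exact: ch].
rewrite -FE -{1}F0 {1}/Rintegral (@integration_by_substitution_increasing _ F h 0 1) //.
- rewrite FE -RintegralZl //; last exact: continuous_Rintegrable.
  by congr fine; apply: eq_integral => x _ /=; rewrite F1 mulrC.
- by move=> x y _ _ xy; rewrite /F ltr_pM2l // mulr_gt0.
- by move=> x _; rewrite F1; exact: cvg_cst.
- by rewrite F1; exact: is_cvg_cst.
- by rewrite F1; exact: is_cvg_cst.
- split => [x _||]; first by have [] := dF x.
  + by apply: cvg_at_right_filter; exact: cF.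
  + by apply: cvg_at_left_filter; exact: cF.
- exact: continuous_subspaceT.
Qed.

(** [H1_norm] integrates over [[0, 2 * pi]]; this is the same quantity in the coordinate [x] of
    [[0, 1]]. *)
Definition H1_mean f : R := fine (H1_norm f) / (2 * pi).

Lemma ccontinuous_radial f (r : R) : analytic_in_disc f -> 0 <= r < 1 ->
  ccontinuous (fun x => f (r%:C%C * e1 x)).
Proof.
move=> hf /andP[r0 r1]; apply: ccontinuous_comp.
  by apply: ccontinuousM; [exact: ccontinuous_cst|exact: ccontinuous_e1].
move=> x; apply: analytic_continuous; apply: hf.
by rewrite cmodM cmod_real cmod_e1 mulr1 ger0_norm.
Qed.

Lemma H1_norm_fin_num f : H1 f -> (0 <= H1_norm f)%E /\ H1_norm f \is a fin_num.
Proof.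
move=> [hf fin].
have h0 : (0 <= H1_norm f)%E.
  apply: le_trans (ereal_sup_ubound _); last by exists 0 => //=; rewrite lexx ltr01.
  by apply: integral_ge0 => t _; rewrite lee_fin cmod_ge0.
by split => //; rewrite ge0_fin_numE.
Qed.

Lemma H1_mean_ge f (r : R) : H1 f -> 0 <= r < 1 ->
  RI `[0, 1] (fun x => cmod (f (r%:C%C * e1 x))) <= H1_mean f.
Proof.
move=> Hf r01; have [hf _] := Hf; have [h0 hfin] := H1_norm_fin_num Hf.
have pi0 := pi_gt0 R; have pi20 : 0 < 2 * pi :> R by rewrite mulr_gt0.
rewrite /H1_mean ler_pdivlMr // mulrC.
have cc : continuous (fun t : R => cmod (f (r%:C%C * cexp t))).
  rewrite (_ : (fun t => _) = (fun x => cmod (f (r%:C%C * e1 x))) \o (fun t => t / (2 * pi))); last first.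
    by apply/funext => t /=; rewrite /e1 [2 * pi * _]mulrC divfK // gt_eqF.
  move=> t; apply: continuous_comp; first by apply: cvgM; [exact: cvg_id|exact: cvg_cst].
  by apply: ccontinuous_cmod; exact: ccontinuous_radial.
have -> : 2 * pi * RI `[0, 1] (fun x => cmod (f (r%:C%C * e1 x))) =
    RI `[0, 2 * pi] (fun t => cmod (f (r%:C%C * cexp t))).
  by rewrite Rintegral_2pi.
rewrite -lee_fin -EFin_Rintegral //; last exact: continuous_Rintegrable.
rewrite (fineK hfin).
by apply: ereal_sup_ubound; exists r.
Qed.

Lemma sum_coef_sqr (p : {poly C}) (n : nat) :
  \sum_(0 <= j < n) cmod p`_j ^+ 2 <= RI `[0, 1] (fun x => cmod p.[e1 x] ^+ 2).
Proof.
have ik : {in iota 0 (size p) &, injective (fun j : nat => j%:Z)} by move=> i j _ _ [].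
have := trigsum_parseval (fun j => p`_j) (0 : R) (iota_uniq 0 (size p)) ik.
rewrite add0r => h.
have -> : RI `[0, 1] (fun x => cmod p.[e1 x] ^+ 2) = \sum_(0 <= j < size p) cmod p`_j ^+ 2.
  rewrite /index_iota subn0 -h; apply: eq_Rintegral => x _; congr (cmod _ ^+ 2).
  rewrite horner_coef /trigsum -(big_mkord xpredT (fun j => p`_j * e1 x ^+ j)) /index_iota subn0.
  by apply: eq_bigr => j _; rewrite echar_nat.
have [np|pn] := leqP n (size p).
  rewrite (big_cat_nat (leq0n n) np) /= lerDl sumr_ge0 // => j _; exact: sqr_ge0.
rewrite (big_cat_nat (leq0n _) (ltnW pn)) /= [X in _ + X]big_nat [X in _ + X]big1 ?addr0 // => j /andP[pj _].
by rewrite nth_default // cmod0 expr0n.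
Qed.

(** The dilate is approximated by a polynomial [P], which is then factored approximately on the
    circle. By Parseval the coefficients of each factor are controlled by the mean of [cmod P] plus
    the error, and the maximum principle for [P - F * G] gives the estimate in the disc. *)
Lemma H1_approx_factorization f (r e : R) : H1 f -> 0 < r < 1 -> 0 < e ->
  exists F G : {poly C}, [/\ forall z, cmod z <= 1 -> cmod (f (r%:C%C * z) - F.[z] * G.[z]) <= e,
    forall n, \sum_(0 <= j < n) cmod F`_j ^+ 2 <= H1_mean f + e &
    forall n, \sum_(0 <= j < n) cmod G`_j ^+ 2 <= H1_mean f + e].
Proof.
move=> Hf r01 e0; have [hf _] := Hf; have r01' : 0 <= r < 1 by case/andP: r01 => /ltW -> ->.
have e2 : 0 < e / 2 by rewrite divr_gt0.
have [P hP] := polynomial_approx_in_disc r01 e2 (analytic_disc_regular hf).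
have [F [G hFG]] := @poly_approx_factorable R P _ e2.
have fI : rI `[0, 1] (fun x => cmod (f (r%:C%C * e1 x)) + e).
  apply: RintegrableD => //; last exact: cst_Rintegrable.
  by apply: continuous_Rintegrable; apply: ccontinuous_cmod; exact: ccontinuous_radial.
have coefs (H : {poly C}) : (forall z, cmod z = 1 -> cmod H.[z] ^+ 2 <= cmod P.[z] + e / 2) ->
    forall n, \sum_(0 <= j < n) cmod H`_j ^+ 2 <= H1_mean f + e.
  move=> hH n; apply: le_trans (sum_coef_sqr _ _) _.
  have -> : H1_mean f + e = H1_mean f + RI `[0, 1] (fun=> e) by rewrite Rintegral_itv_cst // subr0 mulr1.
  apply: (@le_trans _ _ (RI `[0, 1] (fun x => cmod (f (r%:C%C * e1 x)) + e))); last first.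
    rewrite RintegralD //; last exact: cst_Rintegrable.
      by rewrite lerD2r H1_mean_ge.
    by apply: continuous_Rintegrable; apply: ccontinuous_cmod; exact: ccontinuous_radial.
  apply: le_Rintegral => //.
    by apply: continuous_Rintegrable; apply: continuous_cmod_sqr; exact: ccontinuous_poly_e1.
  move=> x _; have E1 := cmod_e1 x; apply: le_trans (hH _ E1) _.
  have := hP (e1 x); rewrite E1 lexx => /(_ isT) h.
  have := cmodD (P.[e1 x] - f (r%:C%C * e1 x)) (f (r%:C%C * e1 x)).
  by rewrite subrK cmod_distrC; lra.
exists F, G; split; last 2 first.
- by apply: coefs => z /hFG[].
- by apply: coefs => z /hFG[].
move=> z z1.
have h1 : cmod ((P - F * G).[z]) <= e / 2.
  apply: (@maximum_principle R (horner (P - F * G)) 1) => //.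
  - by move=> w _; exact: continuous_at_horner.
  - by move=> w w1; apply: local_moments_mean_value; exact: local_moments_horner.
  - by move=> w w1; rewrite hornerD hornerN hornerM; have [] := hFG w w1.
rewrite hornerD hornerN hornerM in h1.
rewrite (_ : f _ - _ = (f (r%:C%C * z) - P.[z]) + (P.[z] - F.[z] * G.[z])); last by ring.
by apply: le_trans (cmodD _ _) _; have := hP z z1; lra.
Qed.

Lemma poly_tail_le (p : {poly C}) (z : C) (M : R) (J : nat) : 0 <= M -> cmod z < 1 ->
  (forall j, cmod p`_j <= M) ->
  cmod (p.[z] - \sum_(0 <= j < J) p`_j * z ^+ j) <= cmod z ^+ J * (M / (1 - cmod z)).
Proof.
move=> M0 z1 hM; have z0 := cmod_ge0 z; have z1' : 0 < 1 - cmod z by lra.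
have rhs0 : 0 <= cmod z ^+ J * (M / (1 - cmod z)).
  by rewrite mulr_ge0 ?exprn_ge0 // divr_ge0 // ltW.
have geo m : (\sum_(J <= j < J + m) cmod z ^+ j) * (1 - cmod z) <= cmod z ^+ J.
  have -> : (\sum_(J <= j < J + m) cmod z ^+ j) * (1 - cmod z) = cmod z ^+ J - cmod z ^+ (J + m).
    elim: m => [|m IH]; first by rewrite addn0 big_geq // mul0r subrr.
    by rewrite addnS big_nat_recr ?leq_addr //= mulrDl IH exprS; ring.
  by rewrite gerBl exprn_ge0.
have tail m : cmod (\sum_(J <= j < J + m) p`_j * z ^+ j) <= cmod z ^+ J * (M / (1 - cmod z)).
  apply: le_trans (cmod_sum _ _ _) _.
  apply: (@le_trans _ _ (M * \sum_(J <= j < J + m) cmod z ^+ j)).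
    rewrite mulr_sumr; apply: ler_sum => j _; rewrite cmodM cmodX ler_wpM2r ?exprn_ge0 //.
  rewrite mulrCA ler_wpM2l // ler_pdivlMr //; exact: geo.
rewrite horner_coef -(big_mkord xpredT (fun j => p`_j * z ^+ j)).
have [Js|sJ] := leqP J (size p).
  rewrite (big_cat_nat (leq0n J) Js) /= [X in X - _]addrC addrK.
  by have := tail (size p - J)%N; rewrite subnKC.
rewrite (big_cat_nat (leq0n _) (ltnW sJ)) /= [X in _ - (_ + X)]big_nat [X in _ - (_ + X)]big1 ?addr0 ?subrr ?cmod0 //.
by move=> j /andP[sj _]; rewrite nth_default // mul0r.
Qed.

(** The approximate factors of the dilates of radius [1 - d M] have bounded l2 norms, so their
    coefficients converge along an ultrafilter. Bounded coefficients have geometric tails inside the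
    disc; hence the values converge at each point and the product relation passes to the limit. *)
Lemma H1_factorization f : H1 f -> exists F G : nat -> C,
  [/\ forall n, \sum_(0 <= j < n) cmod (F j) ^+ 2 <= H1_mean f,
      forall n, \sum_(0 <= j < n) cmod (G j) ^+ 2 <= H1_mean f &
      forall z, cmod z < 1 -> forall e : R, 0 < e -> exists N, forall J, (N <= J)%N ->
        cmod (f z - (\sum_(0 <= j < J) F j * z ^+ j) * (\sum_(0 <= j < J) G j * z ^+ j)) <= e].
Proof.
move=> Hf; have [hf _] := Hf; set L := H1_mean f.
pose d (M : nat) : R := (M.+2%:R)^-1.
have d0 M : 0 < d M by rewrite invr_gt0 ltr0n.
have d1 M : d M < 1 by rewrite invf_lt1 ?ltr1n ?ltr0n.
have dsmall (e : R) : 0 < e -> \forall M \near \oo, d M <= e.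
  move=> e0; pose K := Num.truncn e^-1; exists K => // M /= KM.
  rewrite -[e]invrK lef_pV2 ?posrE ?ltr0n ?invr_gt0 //.
  apply: ltW; apply: lt_le_trans (truncnS_gt _) _.
  by rewrite ler_nat ltnS; exact: leqW.
have ex M : exists FG : {poly C} * {poly C},
    [/\ forall z, cmod z <= 1 -> cmod (f ((1 - d M)%:C%C * z) - FG.1.[z] * FG.2.[z]) <= d M,
    forall n, \sum_(0 <= j < n) cmod FG.1`_j ^+ 2 <= L + d M &
    forall n, \sum_(0 <= j < n) cmod FG.2`_j ^+ 2 <= L + d M].
  have := @H1_approx_factorization f (1 - d M) (d M) Hf _ (d0 M).
  case; first by rewrite subr_gt0 d1 gtrBl d0.
  by move=> F [G h]; exists (F, G).
have [FG hFG] := choice ex.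
pose F M := (FG M).1; pose G M := (FG M).2.
have L0 : 0 <= L.
  apply: le_trans (H1_mean_ge Hf (r := 0) _); last by rewrite lexx ltr01.
  by apply: Rintegral_ge0 => x _; exact: cmod_ge0.
pose B := L + 2; have B0 : 0 <= B by rewrite /B; lra.
have coefB (H : nat -> {poly C}) : (forall M n, \sum_(0 <= j < n) cmod (H M)`_j ^+ 2 <= L + d M) ->
    forall M j, cmod (H M)`_j <= B.
  move=> hH M j; have := hH M j.+1; rewrite big_nat_recr //= => h.
  have h1 : cmod (H M)`_j ^+ 2 <= L + 1.
    have : 0 <= \sum_(0 <= i < j) cmod (H M)`_i ^+ 2 by apply: sumr_ge0 => i _; exact: sqr_ge0.
    by have := d1 M; lra.
  have := cmod_ge0 (H M)`_j; rewrite /B; nra.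
(* [U] contains every set of all large [M], so [d M] may be taken small together with finitely many
   conditions in [U]. *)
have [U [UU Uoo]] := @ultraFilterLemma nat \oo _.
have UI (A A' : set nat) : U A -> U A' -> U (A `&` A') by move=> UA UA'; exact: filterI.
have lims (H : nat -> {poly C}) : (forall M n, \sum_(0 <= j < n) cmod (H M)`_j ^+ 2 <= L + d M) ->
  exists h : nat -> C, [/\ forall n, \sum_(0 <= j < n) cmod (h j) ^+ 2 <= L,
     forall n, cmod (h n) <= B &
     forall z, cmod z < 1 -> forall e : R, 0 < e -> exists N, forall J, (N <= J)%N ->
       U [set M | cmod ((H M).[z] - \sum_(0 <= j < J) h j * z ^+ j) <= e]].
  move=> hH; have cB := coefB H hH.
  have [h hh] := choice (fun j => ultra_bounded_climit UU (fun M => cB M j)).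
  have unif n (e : R) : 0 < e -> U [set M | forall j, (j < n)%N -> cmod ((H M)`_j - h j) <= e].
    move=> e0; elim: n => [|n IH]; first by apply: filterS (filterT : U setT).
    apply: filterS (filterI IH (hh n e e0)) => M [/= h1 h2] j.
    by rewrite ltnS leq_eqVlt => /predU1P[->//|]; exact: h1.
  have hB j : cmod (h j) <= B.
    apply/ler_addgt0Pr => e e0; have /filter_ex[M /= hM] := hh j e e0.
    rewrite -[h j](subrK (H M)`_j); apply: le_trans (cmodD _ _) _.
    by rewrite cmod_distrC; have := cB M j; lra.
  exists h; split => //.
  - move=> n; apply/ler_addgt0Pr => e e0.
    (* From [(q + t) ^+ 2 <= q ^+ 2 + t * (2 * B + 1)] for [0 <= q <= B] and [0 <= t <= 1]. *)
    pose K := 2 * B + 1; have K0 : 0 < n%:R * K + 1.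
      by rewrite ltr_wpDl // mulr_ge0 // /K; lra.
    pose t := Num.min 1 (e / 2 / (n%:R * K + 1)).
    have e2 : 0 < e / 2 by rewrite divr_gt0.
    have t0 : 0 < t by rewrite lt_min ltr01 divr_gt0.
    have t1 : t <= 1 by rewrite ge_min lexx.
    have tK : t * (n%:R * K + 1) <= e / 2 by rewrite -ler_pdivlMr // ge_min lexx orbT.
    have /filter_ex[M [/= h1 h2]] := UI _ _ (unif n t t0) (Uoo _ (dsmall _ e2)).
    apply: (@le_trans _ _ (\sum_(0 <= j < n) (cmod (H M)`_j ^+ 2 + t * K))).
      rewrite !big_nat; apply: ler_sum => j /andP[_ jn]; have := h1 j jn; have := hB j; have := cB M j.
      have := cmodD (h j - (H M)`_j) (H M)`_j; rewrite subrK cmod_distrC.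
      have := cmod_ge0 (h j); have := cmod_ge0 (H M)`_j; rewrite /K.
      move: (cmod (h j)) (cmod (H M)`_j) (cmod (_ - _)) => p q s q0 p0 pq qB pB st.
      have h3 : p <= q + t by lra.
      have h4 : p ^+ 2 <= (q + t) ^+ 2 by rewrite lerXn2r // nnegrE; lra.
      nra.
    rewrite big_split /= sumr_const_nat subn0; have := hH M n; rewrite -mulr_natl.
    have : n%:R * (t * K) <= t * (n%:R * K + 1).
      by rewrite (_ : t * (n%:R * K + 1) = n%:R * (t * K) + t); [rewrite lerDl ltW|ring].
    by lra.
  - move=> z z1 e e0; have e2 : 0 < e / 2 by rewrite divr_gt0.
    have [N hN] := @geometric_small R (cmod z) (B / (1 - cmod z)) _ ltac:(by rewrite cmod_ge0 z1) e2.
    exists N => J NJ; have J1 : 0 < J%:R + 1 :> R by rewrite ltr_wpDl.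
    have t0 : 0 < e / 2 / (J%:R + 1) by rewrite divr_gt0.
    apply: filterS (unif J _ t0) => M /= hM.
    have h1 := poly_tail_le J B0 z1 (cB M).
    have h2 : cmod (\sum_(0 <= j < J) (H M)`_j * z ^+ j - \sum_(0 <= j < J) h j * z ^+ j) <= e / 2.
      rewrite -sumrB; apply: le_trans (cmod_sum _ _ _) _.
      apply: (@le_trans _ _ (\sum_(0 <= j < J) (e / 2 / (J%:R + 1)))).
        rewrite !big_nat; apply: ler_sum => j /andP[_ jJ]; rewrite -mulrBl cmodM cmodX.
        apply: le_trans (hM j jJ); rewrite ler_piMr ?cmod_ge0 // exprn_ile1 ?cmod_ge0 // ltW //.
      rewrite sumr_const_nat subn0 -[leLHS]mulr_natl mulrA ler_pdivrMr //.
      by rewrite [leRHS]mulrC ler_pM2r // lerDl.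
    have := cmod_dist_triangle (H M).[z] (\sum_(0 <= j < J) (H M)`_j * z ^+ j) (\sum_(0 <= j < J) h j * z ^+ j).
    by have := hN J NJ; lra.
have [a [aL aB ha]] := lims F (fun M => let: And3 _ h _ := hFG M in h).
have [b [bL bB hb]] := lims G (fun M => let: And3 _ _ h := hFG M in h).
exists a, b; split => // z z1 e e0.
have z0 := cmod_ge0 z.
pose K := B / (1 - cmod z) + 1.
have K1 : 1 <= K by rewrite /K lerDr divr_ge0 //; lra.
(* Five errors, each at most [t * K]: the dilation, the approximate factorization, and three from
   replacing the two values by partial sums. *)
pose t := Num.min 1 (e / (5 * K)).
have t0 : 0 < t by rewrite lt_min ltr01 divr_gt0 // mulr_gt0 //; lra.
have t1 : t <= 1 by rewrite ge_min lexx.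
have tK : t * (5 * K) <= e by rewrite -ler_pdivlMr ?ge_min ?lexx ?orbT // mulr_gt0 //; lra.
have [Na hNa] := ha z z1 t t0; have [Nb hNb] := hb z z1 t t0.
exists (maxn Na Nb) => J; rewrite geq_max => /andP[/hNa Ua /hNb Ub].
have [dd dd0 hdd] := analytic_continuous (hf z z1) t0.
have dd2 : 0 < dd / 2 by rewrite divr_gt0.
have /filter_ex[M [/= [[h1 h2] h3] h4]] :=
  UI _ _ (UI _ _ (UI _ _ Ua Ub) (Uoo _ (dsmall t t0))) (Uoo _ (dsmall _ dd2)).
have [h5 _ _] := hFG M; have {}h5 := h5 z (ltW z1).
have h6 : cmod (f ((1 - d M)%:C%C * z) - f z) <= t.
  apply: hdd; rewrite (_ : _ * z - z = - (d M)%:C%C * z); last first.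
    by rewrite rmorphB /= -[X in _ - X]mul1r -mulrBl; congr (_ * _); ring.
  rewrite cmodM cmodN cmod_real gtr0_norm //; have := d0 M; nra.
have hFK : cmod (F M).[z] <= K.
  have := poly_tail_le 0 B0 z1 (coefB F (fun M => let: And3 _ h _ := hFG M in h) M).
  by rewrite big_geq // subr0 expr0 mul1r /K; lra.
have hGK : cmod (G M).[z] <= K.
  have := poly_tail_le 0 B0 z1 (coefB G (fun M => let: And3 _ _ h := hFG M in h) M).
  by rewrite big_geq // subr0 expr0 mul1r /K; lra.
rewrite -/(F M) -/(G M) in h5.
set Sa := \sum_(0 <= j < J) _ in h1 *; set Sb := \sum_(0 <= j < J) _ in h2 *.
rewrite (_ : f z - _ = (f z - f ((1 - d M)%:C%C * z)) + (f ((1 - d M)%:C%C * z) - (F M).[z] * (G M).[z])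
   + (((F M).[z] - Sa) * (G M).[z] + (F M).[z] * ((G M).[z] - Sb) - ((F M).[z] - Sa) * ((G M).[z] - Sb))); last by ring.
apply: le_trans (cmodD _ _) _; apply: le_trans (lerD (cmodD _ _) (cmodB _ _)) _.
apply: le_trans (lerD (lexx _) (lerD (cmodD _ _) (lexx _))) _; rewrite !cmodM [cmod (f z - _)]cmod_distrC.
move: h1 h2 hFK hGK h5 h6 (cmod_ge0 ((F M).[z] - Sa)) (cmod_ge0 ((G M).[z] - Sb)) (cmod_ge0 (F M).[z]) (cmod_ge0 (G M).[z]).
move: (cmod ((F M).[z] - Sa)) (cmod ((G M).[z] - Sb)) (cmod (F M).[z]) (cmod (G M).[z]) => p q u v.
move=> h1 h2 hFK hGK h5 h6 p0 q0 u0 v0.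
have k1 : p * v <= t * K by exact: ler_pM.
have k2 : u * q <= K * t by exact: ler_pM.
have k3 : p * q <= t * 1 by apply: ler_pM => //; lra.
have k4 : t <= t * K by rewrite ler_peMr // ltW.
by lra.
Qed.

End HardyFactorization.

(** * Boundary functions of power series and radial limits *)

Section BoundaryFunctions.
Local Open Scope classical_set_scope.
Local Open Scope ring_scope.
Context {R : realType}.
Local Notation C := (R[i]).
Local Notation mu := (@lebesgue_measure R).
Local Notation Re := (@complex.Re R).
Local Notation Im := (@complex.Im R).
Local Notation RI D f := (Rintegral mu D f).
Local Notation rI D f := (mu.-integrable D (EFin \o f)).
Implicit Types (F : nat -> C) (u : R -> C).

Definition partial_poly F (J : nat) : {poly C} := \poly_(j < J) F j.

Lemma horner_partial_poly F J z : (partial_poly F J).[z] = \sum_(0 <= j < J) F j * z ^+ j.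
Proof. by rewrite horner_poly big_mkord. Qed.

(** [u] is the L2 limit of the partial sums on the circle, over every period. For [J = 0] the third
    clause is the square integrability of [u]. *)
Definition H2_boundary F u := [/\ periodic1 u, cmeasurable u,
  forall (J : nat) (s : R), rI `[s, (s + 1)%R] (fun x => cmod (u x - (partial_poly F J).[e1 x]) ^+ 2) &
  forall e : R, 0 < e -> exists N, forall (J : nat) (s : R), (N <= J)%N ->
    RI `[s, s + 1] (fun x => cmod (u x - (partial_poly F J).[e1 x]) ^+ 2) <= e].

Lemma partial_poly_parseval F (j k : nat) (s : R) : (j <= k)%N ->
  RI `[s, s + 1] (fun x => cmod ((partial_poly F k).[e1 x] - (partial_poly F j).[e1 x]) ^+ 2) =
  \sum_(j <= i < k) cmod (F i) ^+ 2.
Proof.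
move=> jk; have ik : {in index_iota j k &, injective (fun i : nat => i%:Z)} by move=> ? ? _ _ [].
rewrite -(trigsum_parseval F s (iota_uniq _ _) ik); apply: eq_Rintegral => x _.
congr (cmod _ ^+ 2); rewrite !horner_partial_poly (big_cat_nat (leq0n j) jk) /= addrAC subrr add0r.
by apply: eq_bigr => i _; rewrite echar_nat.
Qed.

Lemma exists_H2_boundary F (L : R) : (forall n, \sum_(0 <= j < n) cmod (F j) ^+ 2 <= L) ->
  exists u, H2_boundary F u.
Proof.
move=> FL.
have cauchy (e : R) : 0 < e -> exists N, forall j k (s : R), (N <= j)%N -> (j <= k)%N ->
    RI `[s, s + 1] (fun x => cmod ((partial_poly F k).[e1 x] - (partial_poly F j).[e1 x]) ^+ 2) <= e.
  move=> e0; have [N hN] := bounded_sums_cauchy (fun n => sqr_ge0 (cmod (F n))) FL e0.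
  by exists N => j k s Nj jk; rewrite partial_poly_parseval //; exact: hN.
have [u [h1 h2 h3 h4]] := @riesz_fischer R (fun J x => (partial_poly F J).[e1 x])
  (fun J => ccontinuous_poly_e1 _) (fun J x => congr1 (horner (partial_poly F J)) (@e1_periodic R x)) cauchy.
by exists u.
Qed.

Section Boundary.
Variables (F : nat -> C) (u : R -> C).
Hypothesis Fu : H2_boundary F u.

Lemma H2_boundary_sub_measurable J (D : set R) : measurable D ->
  measurable_fun D (Re \o (fun x => u x - (partial_poly F J).[e1 x])) /\
  measurable_fun D (Im \o (fun x => u x - (partial_poly F J).[e1 x])).
Proof.
move=> mD; have [_ um _ _] := Fu; have [m1 m2] := ccontinuous_measurable mD (ccontinuous_poly_e1 (partial_poly F J)).
split.
- rewrite (_ : _ \o _ = (Re \o u) \- (Re \o (fun x => (partial_poly F J).[e1 x]))); last by apply/funext => x /=; rewrite ReB.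
  by apply: measurable_funB => //; exact: measurable_funS um.1.
- rewrite (_ : _ \o _ = (Im \o u) \- (Im \o (fun x => (partial_poly F J).[e1 x]))); last by apply/funext => x /=; rewrite ImB.
  by apply: measurable_funB => //; exact: measurable_funS um.2.
Qed.

Lemma H2_boundary_sub_integrable J (s : R) :
  cintegrable `[s, s + 1] (fun x => u x - (partial_poly F J).[e1 x]).
Proof.
have [_ _ uI _] := Fu; have [m1 m2] := H2_boundary_sub_measurable J (measurable_itv `[s, s + 1]).
by apply: (@cmeasurable_L2_integrable _ _ s (s + 1)).
Qed.

Lemma partial_poly0 z : (partial_poly F 0).[z] = 0.
Proof. by rewrite horner_partial_poly big_geq. Qed.

Lemma H2_boundary_integrable (s : R) : cintegrable `[s, s + 1] u.
Proof.
have := H2_boundary_sub_integrable 0 s.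
by rewrite (_ : (fun x => _) = u) //; apply/funext => x; rewrite partial_poly0 subr0.
Qed.

Lemma H2_boundary_sqr_integrable (s : R) : rI `[s, s + 1] (fun x => cmod (u x) ^+ 2).
Proof.
have [_ _ uI _] := Fu; have := uI 0%N s.
by rewrite (_ : (fun x => cmod (_ - _) ^+ 2) = (fun x => cmod (u x) ^+ 2)) //; apply/funext => x; rewrite partial_poly0 subr0.
Qed.

(** Poisson integrals reproduce the partial sums, and the kernel is bounded at fixed [r], so L1
    convergence of the partial sums suffices. *)
Lemma H2_poisson (r x e : R) : 0 <= r < 1 -> 0 < e -> exists N, forall J, (N <= J)%N ->
  cmod (poisson_integral r u x - \sum_(0 <= j < J) F j * (r%:C%C * e1 x) ^+ j) <= e.
Proof.
move=> r01 e0; have /andP[r0 r1] := r01; have r1' : 0 < 1 - r by rewrite subr_gt0.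
pose t := e * (1 - r) / 2; have t0 : 0 < t by rewrite divr_gt0 // mulr_gt0.
have [_ _ uI small] := Fu; have [N hN] := small _ (exprn_gt0 2%N t0).
exists N => J NJ; have pI := H2_boundary_sub_integrable J (x - 2^-1).
rewrite -horner_partial_poly -(poisson_integral_poly x (partial_poly F J) r01).
rewrite -poisson_integralB //; last 2 first.
- exact: H2_boundary_integrable.
- by apply: cintegrable_window_continuous; exact: ccontinuous_poly_e1.
apply: le_trans (cmod_poisson_integral_le_L1 r01 pI) _.
have le1 : x - 2^-1 <= x - 2^-1 + 1 by lra.
have h := L1_le_L2 le1 t0 pI (uI J _).
have {}h : RI (window x) (fun y => cmod (u y - (partial_poly F J).[e1 y])) <= t.
  apply: le_trans h _; rewrite (_ : x - 2^-1 + 1 - (x - 2^-1) = 1); last by ring.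
  have h2 := hN J (x - 2^-1) NJ.
  rewrite mulr1 [leRHS]splitr lerD2l mulrC ler_pdivrMr ?mulr_gt0 //; apply: le_trans h2 _.
  by rewrite le_eqVlt; apply/orP; left; apply/eqP; field.
apply: le_trans (ler_wpM2l _ h) _; first by rewrite divr_ge0 // ltW.
by rewrite /t le_eqVlt; apply/orP; left; apply/eqP; field; rewrite gt_eqF.
Qed.

End Boundary.

(** The averages in [lebesgue_pt] are over balls of measure [2 h], whence the threshold
    [eps / 2]. *)
Lemma lebesgue_pt_small (g : R -> R) (x eps : R) : lebesgue_pt g x -> 0 < eps ->
  exists2 d : R, 0 < d & forall h : R, 0 < h <= d ->
    (\int[mu]_(y in ball x h) `|g y - g x|%:E <= (eps * h)%:E)%E.
Proof.
move=> /fine_cvgP[fin lim] eps0; have eps2 : 0 < eps / 2 by rewrite divr_gt0.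
have := filterI fin (cvgr_lt 0 lim _ eps2); rewrite /= => -[d /= d0 hd].
exists (d / 2); first by rewrite divr_gt0.
move=> h /andP[h0 hd2]; have [] := hd h; rewrite /= ?sub0r ?normrN ?gtr0_norm //; first by lra.
rewrite /davg /iavg lebesgue_measure_ball ?(ltW h0) //= => ffin flt.
have h20 : 0 < h *+ 2 by rewrite pmulrn_lgt0.
move: flt; rewrite -lte_fin fineK // inver gt_eqF // lte_pdivrMl // => /ltW.
rewrite [X in (_ <= X%:E)%E](_ : _ = eps * h); last by rewrite -mulr_natr; field.
by [].
Qed.

(** The Lebesgue condition fixes [eta]; then [1 - r] is taken so small that the part of the kernel
    beyond [eta] contributes at most [eps]. *)
Lemma radial_lebesgue_pt u (x : R) : (forall s, cintegrable `[s, s + 1] u) ->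
  (forall eps : R, 0 < eps -> exists2 d : R, 0 < d & forall h, 0 < h -> h <= d ->
     RI (ball x h) (fun y => cmod (u y - u x)) <= eps * h) ->
  forall e : R, 0 < e -> \forall r \near 1^'-, cmod (u x - poisson_integral r u x) < e.
Proof.
move=> uI hx e e0; have [K K0 hK] := @poisson_integral_approx R.
pose eps := e / (4 * K); have eps0 : 0 < eps by rewrite divr_gt0 // mulr_gt0.
have [d d0 hd] := hx eps eps0.
pose eta := Num.min (d / 2) 4^-1.
have eta0 : 0 < eta by rewrite lt_min !divr_gt0 //=.
have eta1 : eta <= d / 2 by rewrite ge_min lexx.
have eta2 : eta <= 4^-1 by rewrite ge_min lexx orbT.
pose A := RI (window x) (fun y => cmod (u y - u x)).
have A0 : 0 <= A by apply: Rintegral_ge0 => y _; exact: cmod_ge0.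
pose t := Num.min (Num.min eta 2^-1) (eps * eta ^+ 2 / (A + 1)).
have A1 : 0 < A + 1 by lra.
have t0 : 0 < t.
  rewrite lt_min; apply/andP; split; first by rewrite lt_min eta0 invr_gt0 ltr0n.
  by apply: divr_gt0 => //; apply: mulr_gt0 => //; exact: exprn_gt0.
have t1 : t <= eta by rewrite 2!ge_min lexx.
have t2 : t <= 2^-1 by rewrite 2!ge_min lexx orbT.
have t3 : t * (A + 1) <= eps * eta ^+ 2 by rewrite -ler_pdivlMr // ge_min lexx orbT.
have near1 : \forall r \near 1^'-, (1 - t < r /\ r < 1).
  apply: filterI; last exact: nbhs_left_lt.
  by apply: nbhs_left_gt; rewrite gtrBl.
apply: filterS near1 => r [r1 r2]; rewrite cmod_distrC.
have h : cmod (poisson_integral r u x - u x) <= K * (eps + (1 - r) / eta ^+ 2 * A).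
  apply: hK => //; [by apply/andP; split; lra|by apply/andP; split; lra|exact: ltW|exact: uI|].
  by move=> h h0 h2; apply: hd => //; lra.
apply: le_lt_trans h _.
have h1 : (1 - r) / eta ^+ 2 * A <= eps.
  rewrite mulrAC ler_pdivrMr ?exprn_gt0 //; apply: le_trans t3.
  by apply: ler_pM => //; lra.
apply: le_lt_trans (ler_wpM2l (ltW K0) (lerD (lexx _) h1)) _.
have -> : K * (eps + eps) = e / 2 by rewrite /eps; field; rewrite gt_eqF.
by lra.
Qed.

(** Differentiation is applied to the restriction of [g] to [[0, 1]], which is integrable on the
    line and coincides with [g] near interior points. *)
Lemma ae_lebesgue_pt_unit (g : R -> R) : mu.-integrable `[0, 1] (EFin \o g) ->
  {ae mu, forall x : R, 0 < x < 1 -> forall eps : R, 0 < eps ->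
    exists2 d : R, 0 < d & forall h : R, 0 < h <= d ->
    (\int[mu]_(y in ball x h) `|g y - g x|%:E <= (eps * h)%:E)%E}.
Proof.
move=> gI; pose g' := g \_ `[0, 1].
have g'I : rI setT g'.
  by rewrite /g' -restrict_EFin -integrable_mkcond.
have loc : locally_integrable setT g' by apply: open_integrable_locally => //; exact: openT.
apply: (@filterS _ _ (ae_filter_ringOfSetsType mu) _ _ _ (lebesgue_differentiation loc)).
move=> x xpt /andP[x0 x1] eps eps0; have [d d0 hd] := lebesgue_pt_small xpt eps0.
pose d' := Num.min d (Num.min x (1 - x)).
have d'0 : 0 < d' by rewrite !lt_min d0 x0 subr_gt0.
exists d' => // h /andP[h0 hd']; have hd1 : h <= d by apply: le_trans hd' _; rewrite ge_min lexx.
have hx0 : h <= x by apply: le_trans hd' _; rewrite 2!ge_min lexx orbT.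
have hx1 : h <= 1 - x by apply: le_trans hd' _; rewrite 2!ge_min lexx !orbT.
have E y : ball x h y -> g' y = g y.
  rewrite /ball /= /ball_ ltr_norml => /andP[a b]; rewrite /g' patchE mem_set //=.
  by rewrite in_itv /=; apply/andP; lra.
have := hd h; rewrite h0 hd1 => /(_ isT); apply: le_trans.
rewrite le_eqVlt; apply/orP; left; apply/eqP; apply: eq_integral => y; rewrite inE => yb.
by rewrite (E y yb) (E x) //; exact: ballxx.
Qed.

(** Almost every [x] is a Lebesgue point of both parts of [u], and the modulus is at most the sum of
    the absolute values of the parts. *)
Lemma poisson_fatou u : (forall s, cintegrable `[s, s + 1] u) ->
  {ae mu, forall x : R, 0 < x < 1 ->
    forall e : R, 0 < e -> \forall r \near 1^'-, cmod (u x - poisson_integral r u x) < e}.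
Proof.
move=> uI; have uI0 : cintegrable `[0, 1] u by have := uI 0; rewrite add0r.
apply: (@filterS2 _ _ (ae_filter_ringOfSetsType mu) _ _ _ _ (ae_lebesgue_pt_unit uI0.1) (ae_lebesgue_pt_unit uI0.2)) => x h1 h2 x01.
apply: radial_lebesgue_pt => // eps eps0; have eps2 : 0 < eps / 2 by rewrite divr_gt0.
have [d1 d10 hd1] := h1 x01 _ eps2; have [d2 d20 hd2] := h2 x01 _ eps2.
pose d := Num.min (Num.min d1 d2) 2^-1.
exists d; first by rewrite !lt_min d10 d20 /= invr_gt0.
move=> h h0 hd; have hd1' : h <= d1 by apply: le_trans hd _; rewrite 2!ge_min lexx.
have hd2' : h <= d2 by apply: le_trans hd _; rewrite 2!ge_min lexx orbT.
have h2' : h <= 2^-1 by apply: le_trans hd _; rewrite ge_min lexx orbT.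
have mb : measurable (ball x h) by exact: measurable_ball.
have uI' : cintegrable (ball x h) (fun y => u y - u x).
  have W : cintegrable (window x) (fun y => u y - u x).
    by apply: cintegrableB; [exact: measurable_window|exact: uI|exact: cintegrable_cst].
  by split; [apply: integrableS W.1|apply: integrableS W.2] => //;
    [exact: measurable_window|exact: ball_window|exact: measurable_window|exact: ball_window].
have [m1 m2] := cintegrable_measurable uI'.
rewrite -lee_fin -EFin_Rintegral //; last exact: cintegrable_cmod.
apply: (@le_trans _ _ (\int[mu]_(y in ball x h) (`|Re (u y) - Re (u x)|%:E + `|Im (u y) - Im (u x)|%:E))%E).
  apply: ge0_le_integral => //.
  - by move=> y _; rewrite lee_fin cmod_ge0.
  - by apply/measurable_EFinP; apply: Rintegrable_measurable; exact: cintegrable_cmod.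
  - apply/measurable_EFinP; apply: measurable_funD; apply: measurableT_comp => //.
    + by move: m1; rewrite (_ : _ \o _ = fun y => Re (u y) - Re (u x)) //; apply/funext => y /=; rewrite ReB.
    + by move: m2; rewrite (_ : _ \o _ = fun y => Im (u y) - Im (u x)) //; apply/funext => y /=; rewrite ImB.
  - by move=> y _; rewrite -EFinD lee_fin; apply: le_trans (cmod_le_ReIm _) _; rewrite ReB ImB.
rewrite ge0_integralD //; last 2 first.
- apply/measurable_EFinP; apply: measurableT_comp => //.
  by move: m1; rewrite (_ : _ \o _ = fun y => Re (u y) - Re (u x)) //; apply/funext => y /=; rewrite ReB.
- apply/measurable_EFinP; apply: measurableT_comp => //.
  by move: m2; rewrite (_ : _ \o _ = fun y => Im (u y) - Im (u x)) //; apply/funext => y /=; rewrite ImB.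
have -> : eps * h = eps / 2 * h + eps / 2 * h by rewrite -mulrDl -splitr.
by rewrite EFinD; apply: leeD; [apply: hd1; rewrite h0|apply: hd2; rewrite h0].
Qed.

End BoundaryFunctions.

(** * Integrals of almost everywhere equal functions *)

Section AlmostEverywhereEqual.
Local Open Scope classical_set_scope.
Local Open Scope ring_scope.
Context d (T : measurableType d) {R : realType}.
Variable mu : {measure set T -> \bar R}.
Import HBNNSimple.
Implicit Types (f g : T -> \bar R) (D : set T).

(* The boundary function of an element of H^1 is not known to be measurable. *)
Lemma ge0_ae_le_integral D f g : (forall x, 0 <= f x)%E -> (forall x, 0 <= g x)%E ->
  ae_eq mu D f g -> (\int[mu]_(x in D) f x <= \int[mu]_(x in D) g x)%E.
Proof.
move=> f0 g0 fg; have [N [mN N0 subN]] := fg; rewrite !ge0_integralE //.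
apply: ge_ereal_sup => _ [h hf <-].
(* The simple function below [f] is cut off on the null set: its integral is unchanged and it now
   lies below [g] everywhere. *)
pose k := proj_nnsfun h (measurableC mN).
have -> : sintegral mu h = sintegral mu k.
  rewrite -!integralT_nnsfun; apply: ge0_ae_eq_integral => //.
  - by apply/measurable_EFinP; exact: measurable_funPT.
  - by apply/measurable_EFinP; exact: measurable_funPT.
  - by move=> x _; rewrite lee_fin; exact: fun_ge0.
  - by move=> x _; rewrite lee_fin; exact: fun_ge0.
  exists N; split => // x; apply: contra_notP => Nx _ /=.
  by rewrite /mindic indicE mem_set // mulr1.
apply: ereal_sup_ubound; exists k => // x /=.
have [Nx|nNx] := pselect (N x).
  by rewrite /mindic indicE memNset ?mulr0 // /patch; case: ifP.
rewrite /mindic indicE mem_set // mulr1; apply: le_trans (hf x) _.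
rewrite /patch; case: ifPn => // xD.
have [<- //|fgx] := pselect (f x = g x).
by exfalso; apply: nNx; apply: subN => /= /(_ (set_mem xD)).
Qed.

Lemma ae_eq_integral_nomeas D f g : ae_eq mu D f g ->
  (\int[mu]_(x in D) f x = \int[mu]_(x in D) g x)%E.
Proof.
have ge0 (u v : T -> \bar R) : (forall x, 0 <= u x)%E -> (forall x, 0 <= v x)%E -> ae_eq mu D u v ->
    (\int[mu]_(x in D) u x = \int[mu]_(x in D) v x)%E.
  move=> u0 v0 uv; apply: le_anti; rewrite !ge0_ae_le_integral //; exact: ae_eq_sym.
move=> fg; rewrite integralE [RHS]integralE; congr (_ - _)%E; apply: ge0 => //;
  by have [] := (ae_eq_funeposneg mu D f g).1 fg.
Qed.

End AlmostEverywhereEqual.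

(** * Boundary values of H1 functions as products *)

Section HardyCoefficients.
Local Open Scope classical_set_scope.
Local Open Scope ring_scope.
Context {R : realType}.
Local Notation C := (R[i]).
Local Notation mu := (@lebesgue_measure R).
Implicit Types (F G : nat -> C) (u v : R -> C) (f : C -> C).

Lemma ae_eq_cintegral (D : set R) u v : {ae mu, forall x, D x -> u x = v x} ->
  cintegral D u = cintegral D v.
Proof.
move=> uv; apply: complex_eqP => /=; rewrite /Rintegral; congr fine; apply: ae_eq_integral_nomeas.
- by apply: (@filterS _ _ (ae_filter_ringOfSetsType mu) _ _ _ uv) => x h Dx; rewrite h.
- by apply: (@filterS _ _ (ae_filter_ringOfSetsType mu) _ _ _ uv) => x h Dx; rewrite h.
Qed.

(** Inside the disc [f] is the product of the Poisson integrals of [u] and [v], as all are limits of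
    the same partial sums. Both factors have radial limits almost everywhere, so there the [lim] in
    [boundary f] is a true limit. *)
Lemma boundary_product f F G u v : H2_boundary F u -> H2_boundary G v ->
  (forall z, cmod z < 1 -> forall e : R, 0 < e -> exists N, forall J, (N <= J)%N ->
     cmod (f z - (\sum_(0 <= j < J) F j * z ^+ j) * (\sum_(0 <= j < J) G j * z ^+ j)) <= e) ->
  {ae mu, forall x : R, `[0, 1]%classic x -> boundary f x = u x * v x}.
Proof.
move=> Fu Gv hf.
have fE (r x : R) : 0 <= r < 1 ->
    f (r%:C%C * e1 x) = poisson_integral r u x * poisson_integral r v x.
  move=> r01; set U := poisson_integral r u x; set V := poisson_integral r v x.
  apply: eq_of_cmod_le => e e0.
  pose K := cmod U + cmod V + 1.
  have U0 := cmod_ge0 U; have V0 := cmod_ge0 V.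
  have K1 : 1 <= K by rewrite /K; lra.
  pose t := Num.min 1 (e / (3 * K)).
  have K3 : 0 < 3 * K by rewrite mulr_gt0 //; lra.
  have t0 : 0 < t by rewrite lt_min ltr01 divr_gt0.
  have t1 : t <= 1 by rewrite ge_min lexx.
  have tK : t * (3 * K) <= e by rewrite -ler_pdivlMr // ge_min lexx orbT.
  have z1 : cmod (r%:C%C * e1 x) < 1.
    by rewrite cmodM cmod_real cmod_e1 mulr1; case/andP: r01 => r0; rewrite ger0_norm.
  have [N1 h1] := hf _ z1 t t0.
  have [N2 h2] := H2_poisson Fu x r01 t0; have [N3 h3] := H2_poisson Gv x r01 t0.
  pose J := maxn N1 (maxn N2 N3).
  have {}h1 := h1 J (leq_maxl _ _).
  have {}h2 := h2 J (leq_trans (leq_maxl _ _) (leq_maxr _ _)).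
  have {}h3 := h3 J (leq_trans (leq_maxr _ _) (leq_maxr _ _)).
  move: h1 h2 h3; rewrite -/U -/V; set S := \sum_(0 <= j < J) _; set T := \sum_(0 <= j < J) _ => h1 h2 h3.
  rewrite (_ : f _ - _ = (f (r%:C%C * e1 x) - S * T) + ((U - S) * (V - T) - ((U - S) * V + U * (V - T)))); last by ring.
  apply: le_trans (cmodD _ _) _; apply: le_trans (lerD (lexx _) (cmodB _ _)) _.
  apply: le_trans (lerD (lexx _) (lerD (lexx _) (cmodD _ _))) _; rewrite !cmodM.
  move: (cmod_ge0 (U - S)) (cmod_ge0 (V - T)) h1 h2 h3.
  move: (cmod (U - S)) (cmod (V - T)) => p q p0 q0 h1 h2 h3.
  have k1 : p * q <= t * 1 by apply: ler_pM => //; lra.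
  have k2 : p * cmod V <= t * cmod V by rewrite ler_wpM2r.
  have k3 : cmod U * q <= cmod U * t by rewrite ler_wpM2l.
  apply: le_trans tK; rewrite /K; nra.
(* Radial limits are known at interior points of [[0, 1]]; the two endpoints form a null set. *)
have end0 : {ae mu, forall x : R, `[0, 1]%classic x -> 0 < x < 1}.
  exists [set 0; 1]; split; first by apply: measurableU; exact: measurable_set1.
    by rewrite measureU0 //; exact: lebesgue_measure_set1.
  move=> x /= /not_implyP[]; rewrite in_itv /= => /andP[x0 x1] /negP.
  by rewrite negb_and -!leNgt => /orP[h|h]; [left|right]; apply/eqP; rewrite eq_le ?x0 ?x1 ?h.
have uI := H2_boundary_integrable Fu; have vI := H2_boundary_integrable Gv.
apply: (@filterS3 _ _ (ae_filter_ringOfSetsType mu) _ _ _ _ _ end0 (poisson_fatou uI) (poisson_fatou vI)).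
move=> x h01 hu hv x01; have {}h01 := h01 x01; have {}hu := hu h01; have {}hv := hv h01.
suff H : (fun r : R => f (r%:C%C * e1 x) : C^o) @ 1^'- --> (u x * v x : C^o).
  have E := @cvg_lim C^o (@norm_hausdorff _ _) _ _ _ _ _ H.
  exact: E.
apply/cvg_cmodP => e e0.
pose K := cmod (u x) + cmod (v x) + 1.
have u0 := cmod_ge0 (u x); have v0 := cmod_ge0 (v x).
have K1 : 1 <= K by rewrite /K; lra.
pose t := Num.min 1 (e / (2 * K)).
have K3 : 0 < 2 * K by rewrite mulr_gt0 //; lra.
have t0 : 0 < t by rewrite lt_min ltr01 divr_gt0.
have t1 : t <= 1 by rewrite ge_min lexx.
have tK : t * (2 * K) <= e by rewrite -ler_pdivlMr // ge_min lexx orbT.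
have near0 : \forall r \near (1 : R)^'-, 0 < r by apply: nbhs_left_gt.
have near1 : \forall r \near (1 : R)^'-, r < 1 by apply: nbhs_left_lt.
apply: filterS3 (filterI near0 near1) (hu t t0) (hv t t0) => r [r0 r1] h1 h2.
rewrite fE ?(ltW r0) //.
set U := poisson_integral r u x in h1 *; set V := poisson_integral r v x in h2 *.
rewrite (_ : _ - _ = (u x - U) * v x + u x * (v x - V) - (u x - U) * (v x - V)); last by ring.
apply: le_lt_trans (cmodB _ _) _; apply: le_lt_trans (lerD (cmodD _ _) (lexx _)) _; rewrite !cmodM.
move: (cmod_ge0 (u x - U)) (cmod_ge0 (v x - V)) h1 h2.
move: (cmod (u x - U)) (cmod (v x - V)) => p q p0 q0 h1 h2.
have k1 : p * q <= t * 1 by apply: ler_pM; lra.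
have k2 : p * cmod (v x) <= t * cmod (v x) by rewrite ler_wpM2r // ltW.
have k3 : cmod (u x) * q <= cmod (u x) * t by rewrite ler_wpM2l // ltW.
apply: lt_le_trans tK; rewrite /K; nra.
Qed.

End HardyCoefficients.

(** * Fourier coefficients of H1 functions as Cauchy products *)

Section HardyInequality.
Local Open Scope classical_set_scope.
Local Open Scope ring_scope.
Context {R : realType}.
Local Notation C := (R[i]).
Local Notation mu := (@lebesgue_measure R).
Local Notation Re := (@complex.Re R).
Local Notation Im := (@complex.Im R).
Local Notation RI D f := (Rintegral mu D f).
Local Notation rI D f := (mu.-integrable D (EFin \o f)).
Implicit Types (F G : nat -> C) (u v : R -> C) (f : C -> C).

Lemma cintegral_horner_echar (p : {poly C}) (k : nat) :
  cintegral `[0, 1] (fun x => echar (- k%:Z) x * p.[e1 x]) = p`_k.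
Proof.
have h := cintegral_trigsum_echar (iota 0 (size p)) (fun j => j%:Z) (fun j => p`_j) k%:Z (0 : R).
rewrite add0r in h.
transitivity (cintegral `[0, 1] (fun x : R => trigsum (iota 0 (size p)) (fun j => j%:Z) (fun j => p`_j) x * echar (- k%:Z) x)).
  apply: eq_cintegral => x _; rewrite mulrC horner_coef /trigsum; congr (_ * _).
  rewrite -(big_mkord xpredT (fun j => p`_j * e1 x ^+ j)) /index_iota subn0.
  by apply: eq_bigr => j _; rewrite echar_nat.
rewrite {}h (eq_bigl (fun j => j == k)); last by move=> j; rewrite eqz_nat.
have [kp|pk] := ltnP k (size p); last first.
  rewrite nth_default // big_seq_cond big1 // => j /andP[]; rewrite mem_iota add0n => /andP[_ jp] /eqP jk.
  by move: jp; rewrite jk ltnNge pk.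
rewrite -big_filter (_ : seq.filter _ _ = [:: k]) ?big_seq1 //.
by rewrite (@filter_pred1_uniq _ (iota 0 (size p)) k) ?iota_uniq // mem_iota.
Qed.

Lemma partial_poly_sqr_le F (L : R) J : (forall n, \sum_(0 <= j < n) cmod (F j) ^+ 2 <= L) ->
  RI `[0, 1] (fun x => cmod (partial_poly F J).[e1 x] ^+ 2) <= L.
Proof.
move=> FL; apply: le_trans (FL J); rewrite -(partial_poly_parseval F 0 (leq0n J)) add0r.
rewrite le_eqVlt; apply/orP; left; apply/eqP; apply: eq_Rintegral => x _.
by rewrite partial_poly0 subr0.
Qed.

(** For partial sums with [J > k] the coefficient is the Cauchy product. The error is dominated by
    [M * (A + B) + eta / 2 * (P + Q)]: [eta] is chosen first, from the bound [L] on the integrals of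
    [P] and [Q], then [J], from [M], which depends on [eta]. *)
Lemma H2_product_coef F G u v (L : R) (k : nat) : H2_boundary F u -> H2_boundary G v ->
  (forall n, \sum_(0 <= j < n) cmod (F j) ^+ 2 <= L) ->
  (forall n, \sum_(0 <= j < n) cmod (G j) ^+ 2 <= L) ->
  cintegral `[0, 1] (fun x => echar (- k%:Z) x * (u x * v x)) = \sum_(0 <= j < k.+1) F j * G (k - j)%N.
Proof.
move=> Fu Gv FL GL.
have L0 : 0 <= L by have := FL 0%N; rewrite big_geq.
apply: eq_of_cmod_le => e e0.
pose eta := e / (2 * (L + 1)).
have eta0 : 0 < eta by rewrite divr_gt0 // mulr_gt0 // ltr_wpDl.
have etaL : eta * L <= e / 2.
  have -> : e / 2 = eta * (L + 1) by rewrite /eta; field; rewrite gt_eqF // ltr_wpDl.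
  by rewrite ler_wpM2l ?(ltW eta0) // lerDl.
pose M := 1 + (2 * eta)^-1; have M0 : 0 < M by rewrite ltr_pwDl // invr_ge0 mulr_ge0 // ltW.
pose dl := e / (4 * M); have dl0 : 0 < dl by rewrite divr_gt0 // mulr_gt0.
have [_ _ uI us] := Fu; have [_ _ vI vs] := Gv.
have [N1 h1] := us dl dl0; have [N2 h2] := vs dl dl0.
pose J := maxn k.+1 (maxn N1 N2).
have kJ : (k < J)%N by exact: leq_maxl.
have {}h1 := h1 J 0 (leq_trans (leq_maxl _ _) (leq_maxr _ _)).
have {}h2 := h2 J 0 (leq_trans (leq_maxr _ _) (leq_maxr _ _)).
have {}uI := uI J 0; have {}vI := vI J 0; rewrite add0r in h1 h2 uI vI.
pose p := partial_poly F J; pose q := partial_poly G J.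
have mI : measurable (`[0, 1]%classic : set R) by [].
have coef : cintegral `[0, 1] (fun x => echar (- k%:Z) x * (p.[e1 x] * q.[e1 x])) = \sum_(0 <= j < k.+1) F j * G (k - j)%N.
  transitivity ((p * q)`_k).
    by rewrite -cintegral_horner_echar; apply: eq_cintegral => x _; rewrite hornerM.
  rewrite coefM big_mkord; apply: eq_bigr => j _; rewrite !coef_poly.
  by rewrite (leq_ltn_trans _ kJ) ?(leq_ltn_trans (leq_subr _ _) kJ) // -ltnS.
have u2 := H2_boundary_sqr_integrable Fu 0; have v2 := H2_boundary_sqr_integrable Gv 0; rewrite add0r in u2 v2.
have uC := H2_boundary_integrable Fu 0; have vC := H2_boundary_integrable Gv 0; rewrite add0r in uC vC.
have [ur ui] := cintegrable_measurable uC; have [vr vi] := cintegrable_measurable vC.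
have uvI : cintegrable `[0, 1] (fun x => u x * v x).
  apply: (@cintegrable_le _ _ _ (fun x => cmod (u x) ^+ 2 + cmod (v x) ^+ 2)) => //.
  - rewrite (_ : _ \o _ = ((Re \o u) \* (Re \o v)) \- ((Im \o u) \* (Im \o v))); last by apply/funext => x /=; rewrite ReM.
    by apply: measurable_funB; exact: measurable_funM.
  - rewrite (_ : _ \o _ = ((Re \o u) \* (Im \o v)) \+ ((Im \o u) \* (Re \o v))); last by apply/funext => x /=; rewrite ImM.
    by apply: measurable_funD; exact: measurable_funM.
  - move=> x _; rewrite cmodM; have := sqr_ge0 (cmod (u x) - cmod (v x)).
    by have := sqr_ge0 (cmod (u x)); have := sqr_ge0 (cmod (v x)); nra.
  - exact: RintegrableD.
have echarI (w : R -> C) : cintegrable `[0, 1] w -> cintegrable `[0, 1] (fun x => echar (- k%:Z) x * w x).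
  move=> wI; have [m1 m2] := ccontinuous_measurable mI (@ccontinuous_echar R (- k%:Z)).
  by apply: (@cintegrableM_bounded _ _ _ _ 1) => // x _; rewrite cmod_echar.
have pqI : cintegrable `[0, 1] (fun x => p.[e1 x] * q.[e1 x]).
  by apply: ccontinuous_cintegrable; apply: ccontinuousM; exact: ccontinuous_poly_e1.
rewrite -coef -cintegralB //; try exact: echarI.
apply: le_trans (cmod_cintegral_le mI _) _; first by apply: cintegrableB => //; exact: echarI.
pose A x := cmod (u x - p.[e1 x]) ^+ 2; pose B x := cmod (v x - q.[e1 x]) ^+ 2.
pose P x := cmod p.[e1 x] ^+ 2; pose Q x := cmod q.[e1 x] ^+ 2.
have PI : rI `[0, 1] P by apply: continuous_Rintegrable; apply: continuous_cmod_sqr; exact: ccontinuous_poly_e1.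
have QI : rI `[0, 1] Q by apply: continuous_Rintegrable; apply: continuous_cmod_sqr; exact: ccontinuous_poly_e1.
have ABI : rI `[0, 1] (fun x => M * (A x + B x)) by apply: RintegrableZl => //; exact: RintegrableD.
have PQI : rI `[0, 1] (fun x => (eta / 2) * (P x + Q x)) by apply: RintegrableZl => //; exact: RintegrableD.
apply: (@le_trans _ _ (RI `[0, 1] (fun x => M * (A x + B x) + eta / 2 * (P x + Q x)))).
  apply: le_Rintegral => //.
  - by apply: cintegrable_cmod => //; apply: cintegrableB => //; exact: echarI.
  - exact: RintegrableD.
  move=> x _; rewrite -mulrBr cmodM cmod_echar mul1r /A /B /P /Q.
  set a := u x - _; set b := v x - _.
  rewrite (_ : u x * v x - _ = a * b + (p.[e1 x] * b + q.[e1 x] * a)); last by rewrite /a /b; ring.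
  apply: le_trans (cmodD _ _) _; apply: le_trans (lerD (lexx _) (cmodD _ _)) _; rewrite !cmodM.
  have w1 := weighted_amgm (cmod a) (cmod q.[e1 x]) eta0 ltr01.
  have w2 := weighted_amgm (cmod b) (cmod p.[e1 x]) eta0 ltr01.
  rewrite !divr1 mul1r in w1 w2; rewrite ?mul1r in w2.
  have w3 := sqr_ge0 (cmod a - cmod b); have a2 := sqr_ge0 (cmod a); have b2 := sqr_ge0 (cmod b).
  rewrite /M mulrDl mul1r; move: w1 w2 w3 a2 b2.
  move: (cmod a) (cmod b) (cmod p.[e1 x]) (cmod q.[e1 x]) ((2 * eta)^-1) => a' b' p' q' t w1 w2 w3 a2 b2.
  nra.
rewrite RintegralD // RintegralZl //; last exact: RintegrableD.
rewrite RintegralZl //; last exact: RintegrableD.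
rewrite !RintegralD //.
have hP : RI `[0, 1] P <= L by exact: partial_poly_sqr_le.
have hQ : RI `[0, 1] Q <= L by exact: partial_poly_sqr_le.
have k1 : M * (RI `[0, 1] A + RI `[0, 1] B) <= e / 2.
  have -> : e / 2 = M * (dl + dl) by rewrite /dl; field; rewrite gt_eqF.
  by apply: ler_wpM2l; [exact: ltW|exact: lerD].
have k2 : eta / 2 * (RI `[0, 1] P + RI `[0, 1] Q) <= eta / 2 * (L + L).
  by apply: ler_wpM2l; [by rewrite divr_ge0 ?(ltW eta0)|exact: lerD].
lra.
Qed.

Lemma cmod_H1_coef_le f : H1 f -> exists A B : nat -> R,
  [/\ forall k, 0 <= A k, forall k, 0 <= B k,
      forall n, \sum_(0 <= k < n) A k ^+ 2 <= H1_mean f,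
      forall n, \sum_(0 <= k < n) B k ^+ 2 <= H1_mean f &
      forall m : nat, cmod (H1_coef f m%:Z) <= \sum_(0 <= k < m.+1) A k * B (m - k)%N].
Proof.
move=> Hf; have [F [G [FL GL hf]]] := H1_factorization Hf.
have [u Fu] := exists_H2_boundary FL; have [v Gv] := exists_H2_boundary GL.
exists (fun k => cmod (F k)), (fun k => cmod (G k)); split => // [k|k|m]; try exact: cmod_ge0.
have -> : H1_coef f m%:Z = \sum_(0 <= j < m.+1) F j * G (m - j)%N.
  rewrite -(H2_product_coef m Fu Gv FL GL); apply: ae_eq_cintegral.
  apply: (@filterS _ _ (ae_filter_ringOfSetsType mu) _ _ _ (boundary_product Fu Gv hf)) => x h x01.
  by rewrite (h x01) /echar rmorphN.
by apply: le_trans (cmod_sum _ _ _) _; apply: ler_sum => j _; rewrite cmodM.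
Qed.

End HardyInequality.

(** * The hypotheses of the theorem in finite, one-sided form *)

Lemma sum_sqr_bounded (R : realType) (a : nat -> R) :
  (\sum_(1 <= n <oo) (a n ^+ 2)%:E < +oo)%E -> exists E : R, forall X, \sum_(1 <= n < X) a n ^+ 2 <= E.
Proof.
move=> a_l2.
have t0 n : (1 <= n)%N -> true -> (0 <= (a n ^+ 2)%:E)%E by move=> _ _; rewrite lee_fin sqr_ge0.
exists (fine (\sum_(1 <= n <oo) (a n ^+ 2)%:E)%E) => X.
rewrite -lee_fin fineK; last by rewrite ge0_fin_numE // nneseries_ge0.
by rewrite -sumEFin; exact: nneseries_lim_ge.
Qed.

Section Normalization.
Context {R : realType}.
Variables (nu : nat -> nat) (a : nat -> R).
Hypothesis nu_pos : forall n, (1 <= n)%N -> (0 < nu n)%N.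
Hypothesis nu_incr : forall n, (1 <= n)%N -> (nu n < nu n.+1)%N.
Hypothesis a_pos : forall n, (1 <= n)%N -> 0 < a n.
Hypothesis ST_bounded : exists B : R, forall N, (1 <= N)%N ->
  (`| (Ssum nu a N)%:E * Ttail nu a N | <= B%:E)%E.
Hypothesis S_ratio_bounded : exists B : R, forall N, (1 <= N)%N ->
  `| Ssum nu a N.+1 / Ssum nu a N | <= B.

(** The value of [nu] at 0 is arbitrary; setting it to 0 gives a sequence increasing from index 0,
    with the same [Ssum] and the same gaps of index at least 2. *)
Definition zero_extension (n : nat) := if n == 0%N then 0%N else nu n.

Lemma zero_extension_incr n : (zero_extension n < zero_extension n.+1)%N.
Proof. by case: n => [|n]; rewrite /zero_extension /=; [exact: nu_pos|exact: nu_incr]. Qed.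

Lemma Ssum_zero_extension N : Ssum zero_extension a N = Ssum nu a N.
Proof. by rewrite /Ssum !big_add1; apply: eq_bigr. Qed.

Lemma gap_zero_extension n : (1 < n)%N -> gap zero_extension n = gap nu n :> R.
Proof. by case: n => [|[|n]]. Qed.

Lemma gap_nu_gt0 n : (1 < n)%N -> 0 < gap nu n :> R.
Proof. by case: n => [|[|n]] // _; rewrite subr_gt0 ltr_nat; exact: nu_incr. Qed.

Lemma Mgap_gt0 N n : (1 <= N)%N -> (N < n)%N -> 0 < Mgap nu N n :> R.
Proof.
move=> N1 Nn; rewrite /Mgap; case: eqP => _; first by apply: gap_nu_gt0; lia.
by rewrite lt_min !gap_nu_gt0 //; lia.
Qed.

Lemma Ssum_gt0 N : (1 <= N)%N -> 0 < Ssum nu a N.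
Proof.
case: N => // N _; rewrite /Ssum big_add1 /= big_nat_recl //= ltr_pwDl //.
  by rewrite mulr_gt0 ?a_pos // ltr0n nu_pos.
by apply: sumr_ge0 => i _; rewrite mulr_ge0 // ltW // a_pos.
Qed.

Lemma tail_sum_bounded : exists2 B : R, 0 <= B & forall N X, (1 <= N)%N ->
  Ssum nu a N * \sum_(N.+1 <= n < X) a n ^+ 2 / Mgap nu N n <= B.
Proof.
have [B hB] := ST_bounded; exists B.
  by have := hB 1%N isT; apply: contraTT; rewrite -!(ltNge, leNgt) => B0; apply: lt_le_trans (abse_ge0 _); rewrite lte_fin.
move=> N X N1; rewrite -lee_fin; apply: le_trans (hB N N1); apply: le_trans (lee_abs _).
rewrite EFinM; apply: lee_wpmul2l; first by rewrite lee_fin ltW // Ssum_gt0.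
rewrite -sumEFin; apply: nneseries_lim_ge => n Nn _.
by rewrite lee_fin divr_ge0 ?sqr_ge0 // ltW // Mgap_gt0.
Qed.

Lemma Ssum_ratio_bounded : exists2 rho : R, 0 <= rho & forall N, (1 <= N)%N ->
  Ssum nu a N.+1 <= rho * Ssum nu a N.
Proof.
have [rho h] := S_ratio_bounded; exists rho; first exact: le_trans (normr_ge0 _) (h 1%N isT).
move=> N N1; rewrite -ler_pdivrMr ?Ssum_gt0 //; apply: le_trans (h N N1); exact: ler_norm.
Qed.

Lemma ler_sum_nat_term (u v : nat -> R) m X : (forall i, (m <= i)%N -> u i <= v i) ->
  \sum_(m <= i < X) u i <= \sum_(m <= i < X) v i.
Proof. by move=> uv; rewrite !big_nat; apply: ler_sum => i /andP[mi _]; exact: uv. Qed.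

(** The term [n = N + 1] is the special first term of [T_N], with exactly this gap, and
    [S_(N+1) <= rho * S_N]. The remaining terms are covered by [T_(N+1)]. The hypothesis starts at
    [N = 1], so for [N = 0] the head is the separate constant [c]. *)
Lemma tail_sum_gapS : exists C1 : R, forall N X,
  Ssum zero_extension a N.+1 * \sum_(N.+1 <= n < X) a n ^+ 2 / gap zero_extension n.+1 <= C1.
Proof.
have [B B0 hB] := tail_sum_bounded; have [rho rho0 hrho] := Ssum_ratio_bounded.
pose c := Ssum nu a 1 * (a 1%N ^+ 2 / gap nu 2).
have c0 : 0 <= c by rewrite mulr_ge0 ?divr_ge0 ?sqr_ge0 // ltW ?Ssum_gt0 ?gap_nu_gt0.
exists (rho * B + c + B) => N X; rewrite Ssum_zero_extension.
have S0 := Ssum_gt0 (ltn0Sn N); have rB0 : 0 <= rho * B by rewrite mulr_ge0.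
have [XN|NX] := leqP X N.+1; first by rewrite big_geq // mulr0; lra.
have head : Ssum nu a N.+1 * (a N.+1 ^+ 2 / gap nu N.+2) <= rho * B + c.
  case: N {NX} S0 => [|N] S0; first by rewrite -/c lerDr.
  have h := hB N.+1 N.+3 isT; rewrite big_nat1 /Mgap eqxx in h.
  apply: (@le_trans _ _ (rho * B)); last by rewrite lerDl.
  apply: le_trans (ler_wpM2l rho0 h); rewrite [leRHS]mulrA ler_wpM2r ?hrho //.
  by rewrite divr_ge0 ?sqr_ge0 // ltW // gap_nu_gt0.
rewrite big_ltn // mulrDr gap_zero_extension //; apply: lerD => //.
apply: le_trans (hB N.+1 X isT); apply: ler_wpM2l; first exact: ltW.
apply: (@le_trans _ _ (\sum_(N.+2 <= n < X) a n ^+ 2 / Mgap nu N.+1 n)).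
  apply: ler_sum_nat_term => n Nn; rewrite gap_zero_extension; last by lia.
  rewrite ler_wpM2l ?sqr_ge0 // lef_pV2 ?posrE ?Mgap_gt0 ?gap_nu_gt0 //; last by lia.
  by rewrite /Mgap; case: ifP => // _; rewrite ge_min lexx orbT.
by [].
Qed.

(** In [T_N] the denominator is at most the gap below only from the second term on, that is for
    indices at least [N + 2]. Hence [n = N + 2], and passing from [S_n] to [S_(n-2)] uses the ratio
    bound twice. For [n = 2] the first term is the constant [c] and the rest is a tail of [T_1]. *)
Lemma tail_sum_gap : exists C : R, forall n X, (1 < n)%N ->
  Ssum zero_extension a n * \sum_(n <= i < X) a i ^+ 2 / gap zero_extension i <= C.
Proof.
have [B B0 hB] := tail_sum_bounded; have [rho rho0 hrho] := Ssum_ratio_bounded.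
have tail N X : (1 <= N)%N -> Ssum nu a N * \sum_(N.+2 <= i < X) a i ^+ 2 / gap nu i <= B.
  move=> N1; apply: le_trans (hB N X N1).
  apply: ler_wpM2l; first by rewrite ltW // Ssum_gt0.
  have [XN|NX] := leqP X N.+1.
    by rewrite !big_geq //; lia.
  rewrite [leRHS]big_ltn //; apply: (@le_trans _ _ (\sum_(N.+2 <= n < X) a n ^+ 2 / Mgap nu N n)).
    apply: ler_sum_nat_term => n Nn; rewrite ler_wpM2l ?sqr_ge0 // lef_pV2 ?posrE ?Mgap_gt0 ?gap_nu_gt0 //; try by lia.
    by rewrite /Mgap gtn_eqF // ge_min lexx.
  by rewrite lerDr divr_ge0 ?sqr_ge0 // ltW // Mgap_gt0.
pose c := Ssum nu a 2 * (a 2%N ^+ 2 / gap nu 2).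
have c0 : 0 <= c by rewrite mulr_ge0 ?divr_ge0 ?sqr_ge0 // ltW ?Ssum_gt0 ?gap_nu_gt0.
have rB0 : 0 <= rho * B by rewrite mulr_ge0.
have rrB0 : 0 <= rho * (rho * B) by rewrite mulr_ge0.
have sum0 m X : (1 < m)%N -> 0 <= \sum_(m <= i < X) a i ^+ 2 / gap nu i.
  move=> m1; rewrite big_nat; apply: sumr_ge0 => i /andP[mi _].
  by rewrite divr_ge0 ?sqr_ge0 // ltW // gap_nu_gt0 // (leq_trans m1).
exists (rho * (rho * B) + rho * B + c) => n X n1; rewrite Ssum_zero_extension.
rewrite (_ : \sum_(n <= i < X) _ = \sum_(n <= i < X) a i ^+ 2 / gap nu i); last first.
  rewrite big_nat [RHS]big_nat; apply: eq_bigr => i /andP[ni _].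
  by rewrite gap_zero_extension // (leq_trans n1).
case: n n1 => [|[|[|n]]] // _.
- have [X2|X2] := leqP X 2; first by rewrite big_geq // mulr0; lra.
  rewrite big_ltn // mulrDr -/c addrC lerD2r.
  apply: (@le_trans _ _ (rho * B)); last by rewrite lerDr.
  apply: le_trans (ler_wpM2l rho0 (tail 1%N X isT)); rewrite [leRHS]mulrA ler_wpM2r ?sum0 //.
  exact: hrho.
- apply: (@le_trans _ _ (rho * (rho * B))); last by rewrite -addrA lerDl addr_ge0.
  apply: le_trans (ler_wpM2l rho0 (ler_wpM2l rho0 (tail n.+1 X isT))).
  rewrite 2![leRHS]mulrA ler_wpM2r ?sum0 //; apply: le_trans (hrho n.+2 isT) _.
  by rewrite -[leRHS]mulrA ler_wpM2l // hrho.
Qed.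

End Normalization.

Theorem corollary2p2 (R : realType) (nu : nat -> nat) (a : nat -> R)
  (nu_pos : forall n, (1 <= n)%N -> (0 < nu n)%N)
  (nu_incr : forall n, (1 <= n)%N -> (nu n < nu n.+1)%N)
  (a_pos : forall n, (1 <= n)%N -> 0 < a n)
  (a_l2 : (\sum_(1 <= n <oo) (a n ^+ 2)%:E < +oo)%E)
  (ST_bounded : exists B : R, forall N, (1 <= N)%N ->
     (`| (Ssum nu a N)%:E * Ttail nu a N | <= B%:E)%E)
  (S_ratio_bounded : exists B : R, forall N, (1 <= N)%N ->
     `| Ssum nu a N.+1 / Ssum nu a N | <= B) :
  (forall b : nat -> R[i],
     (forall n, (1 <= n)%N -> cmod (b n) <= a n) ->
     exists g : R -> R[i], is_lacunary_sum nu b g /\ BMO g) /\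
  (exists C : R, forall f : R[i] -> R[i], H1 f ->
     (\sum_(1 <= n <oo) (a n * cmod (H1_coef f (nu n)%:Z))%:E
        <= C%:E * H1_norm f)%E).
Proof.
have [E hE] := sum_sqr_bounded a_l2.
have [C1 hC1] := tail_sum_gapS nu_pos nu_incr a_pos ST_bounded S_ratio_bounded.
have [C2 hC2] := tail_sum_gap nu_pos nu_incr a_pos ST_bounded S_ratio_bounded.
have incr := zero_extension_incr nu_pos nu_incr.
have ext n : (1 <= n)%N -> zero_extension nu n = nu n by case: n.
split=> [b ba|].
  have [g [[g2 gb g0] gBMO]] := exists_lacunary_sum_BMO (nu := zero_extension nu) erefl incr ba hC1 hE.
  exists g; split => //; split => // [n n1|k hk]; first by rewrite -ext // gb.
  by apply: g0 => n n1; rewrite ext // hk.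
(* The Hankel form is bounded by the normalized mean [H1_mean f], whence the division by
   [2 * pi]. *)
exists ((E + 2 * C2 + 18) / (2 * pi)) => f Hf.
have [A [B [A0 B0 hA hB hf]]] := cmod_H1_coef_le Hf; have [_ fin] := H1_norm_fin_num Hf.
have -> : (((E + 2 * C2 + 18) / (2 * pi))%:E * H1_norm f)%E = ((E + 2 * C2 + 18) * H1_mean f)%:E.
  by rewrite -{1}(fineK fin) -EFinM /H1_mean mulrAC mulrA.
apply: lime_le.
  by apply: is_cvg_nneseries => n n1 _; rewrite lee_fin mulr_ge0 ?cmod_ge0 // ltW // a_pos.
apply: nearW => X; rewrite sumEFin lee_fin.
apply: le_trans (positive_hankel_form (nu := zero_extension nu) erefl incr a_pos hC2 hE X A0 B0 hA hB).
apply: ler_sum_nat_term => n n1; rewrite ler_wpM2l ?(ltW (a_pos n n1)) // ext //.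
Qed.
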